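(* Let $\{a_n\}_{n=1}^\infty$ be a sequence of positive numbers satisfying $\sup_{n\in\mathbb{N}}|a_n-n|\le C<\infty$. Let $p\in(0,\infty]$, $\sigma_0>0$, and let $f\in M_{K,N}$ (for some constants $K>0$, $N\ge 0$) satisfy $A_{\sigma_0}(f)_p<\infty$. Then for every $\sigma>\sigma_0$ the following hold. (a) If $p=\infty$, then $$A_\sigma(f)_\infty\le \liminf_{n\to\infty}E_n\left(f,L_\infty([-a_n/\sigma,a_n/\sigma])\right)\le \limsup_{n\to\infty}E_n\left(f,L_\infty([-a_n/\sigma,a_n/\sigma])\right)\le A_{\sigma-0}(f)_\infty.$$ (b) If $p\in(0,\infty)$, then $$\lim_{n\to\infty}E_n\left(f,L_p([-a_n/\sigma,a_n/\sigma])\right)=A_\sigma(f)_p.$$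
   Context: $\mathbb{N}=\{1,2,\ldots\}$. $\mathcal{P}_n$ is the set of all algebraic polynomials with complex coefficients of degree at most $n$. For $\sigma\ge 0$, $B_\sigma$ is the set of all complex-valued entire functions of exponential type (at most) $\sigma$, i.e. entire $g$ such that for every $\varepsilon>0$ there is a constant $C_\varepsilon$ with $|g(z)|\le C_\varepsilon e^{(\sigma+\varepsilon)|z|}$ for all $z\in\mathbb{C}$. $M_{K,N}$ is the space of all measurable functions $f:\mathbb{R}\to\mathbb{C}$ with $|f(x)|\le K(1+|x|)^N$ for all $x\in\mathbb{R}$, where $N\ge0$ and $K>0$ are constants. For measurable $\Omega\subseteq\mathbb{R}$, $\|f\|_{L_p(\Omega)}=\left(\int_\Omega|f(x)|^p\,dx\right)^{1/p}$ for $0<p<\infty$ and $\|f\|_{L_\infty(\Omega)}=\operatorname{ess\,sup}_{x\in\Omega}|f(x)|$; for $0<p<1$ this is a quasinorm. For $a>0$ and $f\in L_p([-a,a])$, $E_n(f,L_p([-a,a])):=\inf_{P\in\mathcal{P}_n}\|f-P\|_{L_p([-a,a])}$. For a measurable function $f$ on $\mathbb{R}$ (not necessarily in $L_p(\mathbb{R})$) and $\sigma>0$, $A_\sigma(f)_p:=\inf_{g\in B_\sigma}\|f-g\|_{L_p(\mathbb{R})}\in[0,\infty]$, and $A_{\sigma-0}(f)_p:=\lim_{\tau\to\sigma-}A_\tau(f)_p$. *)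

(* Defs.v *)
From HB Require Import structures.
From mathcomp Require Import all_boot all_order all_algebra.
From mathcomp Require Import all_classical all_reals all_analysis.
From mathcomp.real_closed Require Import complex.

Set Implicit Arguments.
Unset Strict Implicit.
Unset Printing Implicit Defensive.

Import Order.TTheory GRing.Theory Num.Theory.
Import numFieldNormedType.Exports.

Local Open Scope classical_set_scope.
Local Open Scope ring_scope.
Local Open Scope complex_scope.

(* [R] with the sigma-algebra of Lebesgue measurable sets, on which
   [completed_lebesgue_measure] lives. The default structure on [R] and
   [lebesgue_measure] only know the Borel sets. *)
Notation lebesgue_space R := (caratheodory_type (wlength (@idfun R))^*%mu).

Definition lebesgue_measurable_fun (R : realType) (f : R -> R[i]) : Prop :=
  measurable_fun [set: lebesgue_space R]
    ((fun x => complex.Re (f x)) : lebesgue_space R -> R) /\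
  measurable_fun [set: lebesgue_space R]
    ((fun x => complex.Im (f x)) : lebesgue_space R -> R).

Definition M_space (R : realType) (K N : R) (f : R -> R[i]) : Prop :=
  lebesgue_measurable_fun f /\
  forall x : R, Normc.normc (f x) <= K * (1 + `|x|) `^ N.

(* The function is extended by 0 outside [Om], which changes neither the
   integral over [Om] nor the essential supremum of the modulus over [Om]. *)
Definition Lp_norm (R : realType) (p : \bar R) (Om : set R) (f : R -> R[i]) :
    \bar R :=
  Lnorm (@completed_lebesgue_measure R) p
    ((fun x : R => (Normc.normc (f x))%:E) \_ Om).

(* [R[i]^o] makes the increments and the limit complex: this is complex
   differentiability on the whole plane. *)
Definition entire (R : realType) (g : R[i] -> R[i]) : Prop :=
  forall z : R[i], derivable (g : R[i]^o -> R[i]^o) z 1.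

Definition B_space (R : realType) (sigma : R) : set (R[i] -> R[i]) :=
  [set g | entire g /\
    forall eps : R, 0 < eps -> exists C : R, forall z : R[i],
      Normc.normc (g z) <= C * expR ((sigma + eps) * Normc.normc z)].

Definition poly_approx_error (R : realType) (n : nat) (p : \bar R) (a : R)
    (f : R -> R[i]) : \bar R :=
  ereal_inf [set Lp_norm p `[- a, a] (fun x => f x - P.[x%:C]) |
             P in [set P : {poly R[i]} | (size P <= n.+1)%N]].

Definition entire_approx_error (R : realType) (sigma : R) (p : \bar R)
    (f : R -> R[i]) : \bar R :=
  ereal_inf [set Lp_norm p [set: R] (fun x => f x - g x%:C) |
             g in B_space sigma].

(* The limit exists since the error is nonincreasing in [tau]. *)
Definition entire_approx_error_left (R : realType) (sigma : R) (p : \bar R)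
    (f : R -> R[i]) : \bar R :=
  lim (entire_approx_error tau p f @[tau --> sigma^'-]).

(* Main.v *)
Require Import Defs.
From mathcomp Require Import all_boot all_order all_algebra.
From mathcomp Require Import all_classical all_reals all_analysis.
From mathcomp.real_closed Require Import complex.
From mathcomp Require Import separable cyclotomic ring lra zify.
From mathcomp Require Import measurable_realfun ess_sup_inf.

Import Order.TTheory GRing.Theory Num.Theory.
Import numFieldNormedType.Exports.

(** The intervals [[- a_n / sigma, a_n / sigma]] are chosen so that a polynomial of
    degree [n] on them behaves like an entire function of exponential type
    [sigma]: the degree divided by half the length tends to [sigma]. Each
    inequality between the errors is obtained by passing from one kind of
    approximant to the other.

    Upper bounds. Let [g] have type [tau < sigma] and be close to [f] in [L_p] on
    the line. As [f] grows polynomially, so does [g] on the line ([Lp_growth]),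
    hence [|g(z)|] is of order [exp (tau |Im z|)] up to a polynomial factor
    ([phragmen_lindelof]). On the ellipses with foci at the ends of the interval
    this makes the Chebyshev coefficients of [g] beyond the [n]-th exponentially
    small, since [tau < sigma] ([entire_poly_approx]). So [g] is replaced by
    polynomials of degree [n] at no cost, and the polynomial errors are eventually
    below every number larger than the error of type [tau] ([poly_error_le]). For
    [p = +oo] one lets [tau] tend to [sigma] from the left. For [p] finite one
    reaches [sigma] itself: if [g0] is an approximant of type [sigma0] and [g] a
    near optimal one of type [sigma], then [h = g - g0] is in [L_p], and
    [g0(x) + h(rho x)] with [rho < 1] close to [1] is almost as good as [g]
    ([smaller_type]).

    Lower bounds. Suppose that polynomials [P_n] are within [l] of [f] for
    infinitely many [n]. Subtract the polynomials that approximate [g0] on the same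
    intervals: the differences are bounded in [L_p]. A weighted Nikolskii
    inequality ([nikolskii]) turns this into uniform bounds with a weight that tends
    to [1] on compact sets, and the Bernstein-Walsh inequality ([bernstein_walsh])
    into bounds of type [sigma + e] on compact subsets of the plane. A subsequence
    therefore converges to an entire function of type [sigma]
    ([polynomial_compactness]). Adding [g0] back gives a function of type [sigma],
    and by Fatou's lemma it is within [l] of [f] on the line
    ([entire_approximant]).

    The complex analysis rests on Cauchy's formula on squares, obtained from
    [goursat], and on the expansion of entire functions in power series; Cauchy's
    estimates come from averages of polynomials over roots of unity. All norm
    estimates are stated for [Lp_le], which covers every [p > 0]. *)

Set Implicit Arguments.
Unset Strict Implicit.
Unset Printing Implicit Defensive.

Local Open Scope classical_set_scope.
Local Open Scope ring_scope.
Local Open Scope complex_scope.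

Local Notation nc := Normc.normc.

(** * The modulus on the complex numbers *)

Section Modulus.
Variable R : realType.
Implicit Types (z w : R[i]) (x : R).

Lemma normrE_nc z : `|z| = (nc z)%:C. Proof. by case: z. Qed.

Lemma nc_ge0 z : 0 <= nc z. Proof. by case: z => a b; rewrite sqrtr_ge0. Qed.

Lemma ncM z w : nc (z * w) = nc z * nc w. Proof. exact: Normc.normcM. Qed.

Lemma ncV z : nc z^-1 = (nc z)^-1. Proof. exact: Normc.normcV. Qed.

Lemma nc0 : nc (0 : R[i]) = 0. Proof. exact: Normc.normc0. Qed.

Lemma nc1 : nc (1 : R[i]) = 1. Proof. exact: Normc.normc1. Qed.

Lemma ncN z : nc (- z) = nc z. Proof. exact: normcN. Qed.

Lemma ncX z n : nc (z ^+ n) = nc z ^+ n.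
Proof. by elim: n => [|n IH]; rewrite ?expr0 ?nc1// !exprS ncM IH. Qed.

Lemma ncD z w : nc (z + w) <= nc z + nc w. Proof. exact: le_normcD. Qed.

Lemma nc_real x : nc x%:C = `|x|.
Proof. by rewrite /= expr0n/= addr0 sqrtr_sqr. Qed.

Lemma nc_eq0 z : (nc z == 0) = (z == 0).
Proof. by apply/eqP/eqP => [/Normc.eq0_normc//|->]; exact: nc0. Qed.

Lemma nc_gt0 z : (0 < nc z) = (z != 0).
Proof. by rewrite lt_def nc_ge0 andbT nc_eq0. Qed.

Lemma ncB z w : nc (z - w) <= nc z + nc w.
Proof. by rewrite -(ncN w); exact: ncD. Qed.

Lemma nc_distC z w : nc (z - w) = nc (w - z).
Proof. by rewrite -ncN opprB. Qed.

Lemma ncB_ge z w : nc z - nc w <= nc (z - w).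
Proof. by rewrite lerBlDr (le_trans _ (ncD _ _))// subrK. Qed.

Lemma ncD_ge z w : nc z - nc w <= nc (z + w).
Proof. by rewrite -(ncN w) -{2}(opprK w); exact: ncB_ge. Qed.

Lemma nc_sum I (r : seq I) (P : pred I) (F : I -> R[i]) :
  nc (\sum_(i <- r | P i) F i) <= \sum_(i <- r | P i) nc (F i).
Proof.
elim/big_ind2: _ => [|a b c d h1 h2|//]; first by rewrite nc0.
by rewrite (le_trans (ncD _ _))// lerD.
Qed.

Lemma ncE2 z : nc z ^+ 2 = complex.Re z ^+ 2 + complex.Im z ^+ 2.
Proof. by case: z => a b; rewrite /= sqr_sqrtr// addr_ge0 ?sqr_ge0. Qed.

Lemma Re_le_nc z : `|complex.Re z| <= nc z.
Proof.
rewrite -(@ler_pXn2r _ 2) ?nnegrE ?nc_ge0// ncE2 real_normK ?num_real//.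
by rewrite lerDl sqr_ge0.
Qed.

Lemma Im_le_nc z : `|complex.Im z| <= nc z.
Proof.
rewrite -(@ler_pXn2r _ 2) ?nnegrE ?nc_ge0// ncE2 real_normK ?num_real//.
by rewrite lerDr sqr_ge0.
Qed.

Lemma nc_le_ReIm z : nc z <= `|complex.Re z| + `|complex.Im z|.
Proof.
rewrite -(@ler_pXn2r _ 2) ?nnegrE ?nc_ge0 ?addr_ge0// ncE2 sqrrD.
by rewrite !real_normK ?num_real// lerD2r lerDl mulrn_wge0// mulr_ge0.
Qed.

Lemma nc_nat n : nc (n%:R : R[i]) = n%:R.
Proof. by rewrite -(rmorph_nat (real_complex R)) nc_real ger0_norm. Qed.

Lemma ReD z w : complex.Re (z + w) = complex.Re z + complex.Re w.
Proof. by case: z w => ? ? []. Qed.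
Lemma ImD z w : complex.Im (z + w) = complex.Im z + complex.Im w.
Proof. by case: z w => ? ? []. Qed.
Lemma ReN z : complex.Re (- z) = - complex.Re z. Proof. by case: z. Qed.
Lemma ImN z : complex.Im (- z) = - complex.Im z. Proof. by case: z. Qed.
Lemma ReM z w : complex.Re (z * w)
  = complex.Re z * complex.Re w - complex.Im z * complex.Im w.
Proof. by case: z w => ? ? []. Qed.
Lemma ImM z w : complex.Im (z * w)
  = complex.Re z * complex.Im w + complex.Im z * complex.Re w.
Proof. by case: z w => ? ? []. Qed.

Lemma complex_ext z w : complex.Re z = complex.Re w ->
  complex.Im z = complex.Im w -> z = w.
Proof. by case: z w => a b [c d] /= -> ->. Qed.

Lemma nc_le0_eq z w : (forall e, 0 < e -> nc (z - w) <= e) -> z = w.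
Proof.
move=> h; apply/eqP; rewrite -subr_eq0 -nc_eq0 eq_le nc_ge0 andbT.
by apply/ler_addgt0Pr => e e0; rewrite add0r h.
Qed.

Lemma complex_cauchy (u : nat -> R[i]) :
  (forall e : R, 0 < e -> exists N, forall n m, (N <= n)%N -> (N <= m)%N ->
     nc (u n - u m) <= e) ->
  exists l, forall e : R, 0 < e -> exists N, forall n, (N <= n)%N ->
     nc (u n - l) <= e.
Proof.
move=> hu.
have key (f : R[i] -> R) : (forall z w, `|f z - f w| <= nc (z - w)) ->
    exists l : R, forall e, 0 < e -> exists N, forall n, (N <= n)%N ->
     `|f (u n) - l| <= e.
  move=> hf.
  have /cauchy_cvg/cvgrPdist_le cv : cauchy ((f \o u) @ \oo).
    apply/cauchy_ballP => e e0.
    have [N hN] := hu (e / 2) (divr_gt0 e0 (ltr0n _ 2)).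
    rewrite near_simpl.
    exists (([set n | (N <= n)%N]), [set n | (N <= n)%N]).
      by split; exists N.
    move=> [n m] [/= hn hm]; rewrite /ball/=.
    rewrite (le_lt_trans (hf _ _))// (le_lt_trans (hN _ _ _ _))//.
    by rewrite ltr_pdivrMr// ltr_pMr// ltr1n.
  exists (lim ((f \o u) @ \oo)) => e e0.
  have [N _ hN] := cv _ e0.
  by exists N => n hn; rewrite distrC; exact: hN.
have [a ha] := key (@complex.Re R) (fun z w =>
  ltac:(rewrite -ReN -ReD; exact: Re_le_nc)).
have [b hb] := key (@complex.Im R) (fun z w =>
  ltac:(rewrite -ImN -ImD; exact: Im_le_nc)).
exists (a +i* b) => e e0.
have e2 : 0 < e / 2 by rewrite divr_gt0.
have [N1 h1] := ha _ e2; have [N2 h2] := hb _ e2.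
exists (maxn N1 N2) => n; rewrite geq_max => /andP[n1 n2].
rewrite (le_trans (nc_le_ReIm _))// ReD ImD ReN ImN/=.
by have := lerD (h1 _ n1) (h2 _ n2); rewrite -splitr.
Qed.

End Modulus.

(** * Cauchy estimates for polynomials *)

Section PolyCauchy.
Variable R : realType.

(** [X^n - 1] splits and is separable, and finite groups of roots of unity are
    cyclic. *)
Lemma complex_prim_root n : (0 < n)%N ->
  exists w : R[i], n.-primitive_root w.
Proof.
move=> n0.
have [r Dp] := closed_field_poly_normal ('X^n - 1 : {poly R[i]}).
have mon : lead_coef ('X^n - 1 : {poly R[i]}) = 1.
  by have /monicP := monicXnsubC (1 : R[i]) n0; rewrite polyC1.
move: Dp; rewrite mon scale1r => Dp.
have sz : size r = n.
  have := size_XnsubC (1 : R[i]) n0; rewrite polyC1 Dp size_prod_XsubC.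
  by case.
have ur : uniq r.
  rewrite -separable_prod_XsubC -Dp.
  apply: separable_Xn_sub_1; exact: (ltac:(by rewrite pnatr_eq0 -lt0n)).
have : has n.-primitive_root r.
  apply: cyclic.has_prim_root => //; last by rewrite sz.
  apply/allP => x xr; rewrite unity_rootE -subr_eq0.
  have : root ('X^n - 1) x by rewrite Dp root_prod_XsubC.
  by rewrite rootE !hornerE.
by move=> /hasP[w _ hw]; exists w.
Qed.

Lemma nc_unity_root n (w : R[i]) : (0 < n)%N -> w ^+ n = 1 -> nc w = 1.
Proof.
move=> n0 wn; apply/eqP; rewrite -(@eqrXn2 _ n)// ?nc_ge0//.
by rewrite -ncX wn nc1 expr1n.
Qed.

(** Averaging [P (r w^j) w^(-jk)] over the [N]-th roots of unity [w^j], with [N]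
    larger than the degree, isolates the [k]-th coefficient exactly. This gives
    Cauchy's estimate for polynomials by a finite sum. *)
Lemma poly_cauchy (P : {poly R[i]}) (r M : R) k : 0 < r ->
  (forall z, nc z = r -> nc P.[z] <= M) -> nc P`_k * r ^+ k <= M.
Proof.
move=> r0 hM.
have [kP|kP] := ltnP k (size P); last first.
  rewrite nth_default// nc0 mul0r.
  by rewrite (le_trans _ (hM r%:C _)) ?nc_ge0// nc_real gtr0_norm.
set N := size P; have N0 : (0 < N)%N by exact: leq_ltn_trans kP.
have [w pw] := complex_prim_root N0.
have w1 : w ^+ N = 1 := prim_expr_order pw.
have ncw j : nc (w ^+ j) = 1 by rewrite ncX (nc_unity_root N0 w1) expr1n.
have key : \sum_(j < N) P.[r%:C * w ^+ j] * w ^+ (j * (N - k)) =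
    N%:R * (P`_k * r%:C ^+ k).
  under eq_bigr => j _.
    rewrite horner_coef mulr_suml.
    under eq_bigr => i _.
      rewrite exprMn -!mulrA -!exprM -exprD -mulnDr mulrA.
      over.
    over.
  rewrite exchange_big/= (bigD1 (Ordinal kP))//=.
  rewrite [X in _ + X]big1 ?addr0; last first.
    move=> i ik; rewrite -mulr_sumr.
    have wi : w ^+ (i + (N - k)) != 1.
      rewrite -(prim_order_dvd pw); apply/negP => /dvdnP[q hq].
      have iN := ltn_ord i; rewrite -/N in iN.
      case: q hq => [|[|q]] hq.
      - by move: hq; rewrite mul0n; lia.
      - by move/eqP: ik; apply; apply/val_inj => /=; lia.
      - have : (i + (N - k) < N + N)%N.
          by apply: leq_ltn_trans (leq_add (leqnn i) (leq_subr k N)) _;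
            rewrite ltn_add2r.
        by rewrite hq !mulSn addnA ltnNge leq_addr.
    rewrite -subr_eq0 in wi.
    apply/eqP; rewrite mulf_eq0; apply/orP; right.
    rewrite -(mulrI_eq0 _ (mulfI wi)).
    under eq_bigr do rewrite mulnC exprM.
    by rewrite -subrX1 -exprM mulnC exprM w1 expr1n subrr.
  under eq_bigr do rewrite subnKC ?(ltnW kP)// mulnC exprM w1 expr1n mulr1.
  by rewrite sumr_const card_ord mulr_natl.
have N0R : (0 : R) < N%:R by rewrite ltr0n.
rewrite -(ler_pM2l N0R) -{1}(nc_nat R N) -(gtr0_norm (exprn_gt0 k r0)).
rewrite -nc_real rmorphXn/= -!ncM -key (le_trans (nc_sum _ _ _))//.
apply: (@le_trans _ _ (\sum_(j < N) M)).
  apply: ler_sum => j _; rewrite ncM ncw mulr1 hM//.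
  by rewrite ncM ncw mulr1 nc_real gtr0_norm.
by rewrite sumr_const card_ord mulr_natl.
Qed.

End PolyCauchy.

(** * Complex differentiability with real epsilons *)

Section ComplexDerivative.
Variable R : realType.
Implicit Types (F G : R[i] -> R[i]) (z w l : R[i]).

Definition cderivable F z := exists l, forall e : R, 0 < e ->
  exists2 d : R, 0 < d & forall w, nc (w - z) <= d ->
    nc (F w - F z - l * (w - z)) <= e * nc (w - z).

Definition ccontinuous F z := forall e : R, 0 < e ->
  exists2 d : R, 0 < d & forall w, nc (w - z) <= d -> nc (F w - F z) <= e.

Lemma complex_gt0P (e : R[i]) : 0 < e -> exists2 r : R, 0 < r & e = r%:C.
Proof.
case: e => a b; rewrite ltcE/= => /andP[/eqP -> a0].
by exists a.
Qed.

Lemma derivable_cderivable F z :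
  derivable (F : R[i]^o -> R[i]^o) z 1 <-> cderivable F z.
Proof.
split.
  move=> /cvg_ex[/= l /cvgrPdist_le Hl]; exists l => e e0.
  have /Hl : 0 < e%:C by rewrite ltcR.
  rewrite near_withinE => /nbhs_normP[_/posnumP[d] hd].
  have [d' d'0 dE] := complex_gt0P [gt0 of d%:num].
  exists (d' / 2) => [|w hw]; first by rewrite divr_gt0.
  have [->|wz] := eqVneq w z; first by rewrite !subrr mulr0 subrr nc0 mulr0.
  have wz0 : w - z != 0 by rewrite subr_eq0.
  have := hd (w - z).
  rewrite /= sub0r normrN normrE_nc dE ltcR => /(_ _ wz0).
  rewrite /shift/= /GRing.scale/= mulr1 subrK normrE_nc lecR => H.
  have {}H : nc (l - (w - z)^-1 * (F w - F z)) <= e.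
    by apply: H; rewrite (le_lt_trans hw)// ltr_pdivrMr// ltr_pMr// ltr1n.
  have -> : F w - F z - l * (w - z) =
      - ((l - (w - z)^-1 * (F w - F z)) * (w - z)) by field.
  by rewrite ncN ncM ler_wpM2r// nc_ge0.
move=> [l hl]; apply/cvg_ex; exists l; apply/cvgrPdist_le => /= e /complex_gt0P.
case=> {}e e0 ->; have [d d0 hd] := hl _ e0.
rewrite near_withinE.
apply/nbhs_normP; exists d%:C => /=; first by rewrite ltcR.
move=> h /=; rewrite sub0r normrN normrE_nc ltcR => hh h0.
rewrite /shift/= /GRing.scale/= mulr1 normrE_nc lecR.
have := hd (h + z); rewrite addrK => /(_ (ltW hh)) H.
rewrite nc_distC.
have -> : h^-1 * (F (h + z) - F z) - l =
   (F (h + z) - F z - l * h) * h^-1 by field.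
by rewrite ncM ncV ler_pdivrMr// nc_gt0.
Qed.

Lemma cderivable_ccontinuous F z : cderivable F z -> ccontinuous F z.
Proof.
move=> [l hl] e e0.
have [d d0 hd] := hl _ (ltr01 : (0 : R) < 1).
set K := nc l + 1.
have K0 : 0 < K by rewrite ltr_wpDl// nc_ge0.
exists (Num.min d (e / K)); first by rewrite lt_min d0 divr_gt0.
move=> w; rewrite le_min => /andP[wd we].
have H := hd _ wd.
rewrite -[F w - F z](subrK (l * (w - z))).
rewrite (le_trans (ncD _ _))//.
rewrite (@le_trans _ _ (K * nc (w - z)))//.
  by rewrite mulrDl addrC ncM; apply: lerD.
by rewrite mulrC -ler_pdivlMr.
Qed.

Lemma cderivable_cst l z : cderivable (fun _ => l) z.
Proof. by apply/derivable_cderivable; exact: derivable_cst. Qed.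

Lemma cderivable_id z : cderivable id z.
Proof. by apply/derivable_cderivable; exact: derivable_id. Qed.

Lemma cderivableB F G z : cderivable F z -> cderivable G z ->
  cderivable (fun w => F w - G w) z.
Proof.
move=> /derivable_cderivable h /derivable_cderivable k.
by apply/derivable_cderivable; exact: derivableB h k.
Qed.

Lemma cderivableD F G z : cderivable F z -> cderivable G z ->
  cderivable (fun w => F w + G w) z.
Proof.
move=> /derivable_cderivable h /derivable_cderivable k.
by apply/derivable_cderivable; exact: derivableD h k.
Qed.

Lemma cderivableM F G z : cderivable F z -> cderivable G z ->
  cderivable (fun w => F w * G w) z.
Proof.
move=> /derivable_cderivable h /derivable_cderivable k.
by apply/derivable_cderivable; exact: derivableM h k.
Qed.

Lemma cderivableV F z : F z != 0 -> cderivable F z ->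
  cderivable (fun w => (F w)^-1) z.
Proof.
move=> F0 /derivable_cderivable h.
by apply/derivable_cderivable; exact: derivableV.
Qed.

Lemma cderivableX F z n : cderivable F z -> cderivable (fun w => F w ^+ n) z.
Proof.
move=> h; elim: n => [|n IH].
  by rewrite (_ : (fun _ => _) = fun=> 1)//; exact: cderivable_cst.
rewrite (_ : (fun w => _) = fun w => F w * F w ^+ n); first exact: cderivableM.
by apply/funext => w; rewrite exprS.
Qed.

Lemma cderivable_shift F z w : cderivable F (z + w) ->
  cderivable (fun u => F (u + w)) z.
Proof.
move=> [l hl]; exists l => e e0; have [d d0 hd] := hl _ e0.
exists d => // u ud; have := hd (u + w).
have -> : u + w - (z + w) = u - z by ring.
by move=> /(_ ud).
Qed.

Lemma cderivable_horner (P : {poly R[i]}) z : cderivable (fun w => P.[w]) z.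
Proof.
elim/poly_ind: P => [|P c IH].
  by rewrite (_ : (fun _ => _) = fun=> 0) ?funeqE => [|w];
    [exact: cderivable_cst|rewrite horner0].
rewrite (_ : (fun _ => _) = fun w => P.[w] * w + c); last first.
  by apply/funext => w; rewrite hornerMXaddC.
apply: cderivableD; last exact: cderivable_cst.
by apply: cderivableM => //; exact: cderivable_id.
Qed.

Lemma entireP F : entire F <-> forall z, cderivable F z.
Proof. by split=> h z; apply/derivable_cderivable; exact: h. Qed.

End ComplexDerivative.

(** * Integrals along horizontal and vertical segments *)

Section SegmentIntegral.
Variable R : realType.
Implicit Types (F G : R -> R[i]) (a b c : R).

Definition cint a b F : R[i] :=
  (\int[lebesgue_measure]_(x in `[a, b]) complex.Re (F x))%R +i*
  (\int[lebesgue_measure]_(x in `[a, b]) complex.Im (F x))%R.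

Definition scontinuous a b F :=
  {within `[a, b], continuous (fun x => complex.Re (F x))} /\
  {within `[a, b], continuous (fun x => complex.Im (F x))}.

Lemma scontinuous_integrable a b F : scontinuous a b F ->
  lebesgue_measure.-integrable `[a, b] (EFin \o (fun x => complex.Re (F x))) /\
  lebesgue_measure.-integrable `[a, b] (EFin \o (fun x => complex.Im (F x))).
Proof.
by move=> [h1 h2]; split; apply: continuous_compact_integrable => //;
  exact: segment_compact.
Qed.

Lemma scontinuousW a b a' b' F : a <= a' -> b' <= b ->
  scontinuous a b F -> scontinuous a' b' F.
Proof.
move=> aa bb [h1 h2]; have sub : `[a', b'] `<=` `[a, b].
  by apply: subset_itvScc => //; rewrite ?bnd_simp.
by split; [exact: continuous_subspaceW h1|exact: continuous_subspaceW h2].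
Qed.

Lemma scontinuous_line (H : R[i] -> R[i]) (p q : R[i]) a b :
  (forall x, a <= x <= b -> ccontinuous H (p + q * x%:C)) ->
  scontinuous a b (fun x => H (p + q * x%:C)).
Proof.
move=> hH.
have key (f : R[i] -> R) : (forall z w, `|f z - f w| <= nc (z - w)) ->
    {within `[a, b], continuous (fun x => f (H (p + q * x%:C)))}.
  move=> hf; apply: continuous_in_subspaceT => x; rewrite inE/= in_itv/= => xab.
  apply/cvgrPdist_le => e e0.
  have [d d0 hd] := hH _ xab _ e0.
  have q0 : 0 < nc q + 1 by rewrite ltr_wpDl ?nc_ge0.
  apply/nbhs_normP; exists (d / (nc q + 1)); first by rewrite /= divr_gt0.
  move=> y /=; rewrite ltr_pdivlMr// distrC => xy.
  rewrite distrC (le_trans (hf _ _))// hd//.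
  have -> : p + q * y%:C - (p + q * x%:C) = q * (y - x)%:C.
    by rewrite rmorphB/=; ring.
  rewrite ncM nc_real (le_trans _ (ltW xy))// mulrC ler_wpM2l// lerDl//.
split; apply: key => z w.
  by rewrite -ReN -ReD Re_le_nc.
by rewrite -ImN -ImD Im_le_nc.
Qed.

Lemma scontinuous_cst a b (k : R[i]) : scontinuous a b (fun=> k).
Proof. by split; exact: continuous_subspaceT (fun x => cvg_cst _). Qed.

Lemma scontinuousD a b F G : scontinuous a b F -> scontinuous a b G ->
  scontinuous a b (fun x => F x + G x).
Proof.
move=> [f1 f2] [g1 g2]; split.
  rewrite (_ : (fun _ => _) =
    (fun x => complex.Re (F x)) \+ (fun x => complex.Re (G x))).
    by move=> x; apply: continuousD; [exact: f1|exact: g1].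
  by apply/funext => x; rewrite ReD.
rewrite (_ : (fun _ => _) =
  (fun x => complex.Im (F x)) \+ (fun x => complex.Im (G x))).
  by move=> x; apply: continuousD; [exact: f2|exact: g2].
by apply/funext => x; rewrite ImD.
Qed.

Lemma scontinuousN a b F : scontinuous a b F -> scontinuous a b (fun x => - F x).
Proof.
move=> [f1 f2]; split.
  rewrite (_ : (fun _ => _) = \- (fun x => complex.Re (F x))).
    by move=> x; apply: continuousN; exact: f1.
  by apply/funext => x; rewrite ReN.
rewrite (_ : (fun _ => _) = \- (fun x => complex.Im (F x))).
  by move=> x; apply: continuousN; exact: f2.
by apply/funext => x; rewrite ImN.
Qed.

Lemma scontinuousB a b F G : scontinuous a b F -> scontinuous a b G ->
  scontinuous a b (fun x => F x - G x).
Proof. by move=> f g; apply: scontinuousD => //; exact: scontinuousN. Qed.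

Lemma cintD a b F G : scontinuous a b F -> scontinuous a b G ->
  cint a b (fun x => F x + G x) = cint a b F + cint a b G.
Proof.
move=> /scontinuous_integrable[f1 f2] /scontinuous_integrable[g1 g2].
apply: complex_ext; rewrite ?ReD ?ImD /=.
  by rewrite -RintegralD//; apply: eq_Rintegral => x _; rewrite ReD.
by rewrite -RintegralD//; apply: eq_Rintegral => x _; rewrite ImD.
Qed.

Lemma cintZ a b k F : scontinuous a b F ->
  cint a b (fun x => k * F x) = k * cint a b F.
Proof.
move=> /scontinuous_integrable[f1 f2].
have Z (r : R) (f : R -> R) : lebesgue_measure.-integrable `[a, b] (EFin \o f) ->
   lebesgue_measure.-integrable `[a, b] (EFin \o (fun x => r * f x)).
  move=> hf.
  rewrite (_ : EFin \o _ = (fun x => r%:E * (EFin \o f) x)%E) ?funeqE//.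
  by apply: integrableZl => //; exact: measurable_itv.
apply: complex_ext; rewrite ?ReM ?ImM /= -!RintegralZl// -?RintegralB -?RintegralD;
  do ?[exact: Z | exact: measurable_itv].
- by apply: eq_Rintegral => x _; rewrite ReM.
- by apply: eq_Rintegral => x _; rewrite ImM.
Qed.

Lemma cintN a b F : scontinuous a b F ->
  cint a b (fun x => - F x) = - cint a b F.
Proof.
move=> hF; rewrite -mulN1r -cintZ//; congr cint.
by apply/funext => x; rewrite mulN1r.
Qed.

Lemma cintB a b F G : scontinuous a b F -> scontinuous a b G ->
  cint a b (fun x => F x - G x) = cint a b F - cint a b G.
Proof. by move=> hF hG; rewrite cintD ?cintN//; exact: scontinuousN. Qed.

Lemma eq_cint a b F G : (forall x, a <= x <= b -> F x = G x) ->
  cint a b F = cint a b G.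
Proof.
move=> h; congr (_ +i* _); apply: eq_Rintegral => x;
  by rewrite inE/= in_itv/= => /h ->.
Qed.

Lemma cint_cst a b (k : R[i]) : a <= b -> cint a b (fun=> k) = k * (b - a)%:C.
Proof.
move=> ab; have e : fine (lebesgue_measure `[a, b]) = b - a :> R.
  rewrite lebesgue_measure_itv/= lte_fin; case: ltrgtP ab => //= -> _.
  by rewrite subrr.
apply: complex_ext; rewrite ?ReM ?ImM/= !mulr0 ?subr0 ?add0r
  Rintegral_cst//= e//.
Qed.

Lemma cint_split a b c F : a <= b <= c -> scontinuous a c F ->
  cint a c F = cint a b F + cint b c F.
Proof.
move=> /andP[ab bc] hF.
have [f1 f2] := scontinuous_integrable hF.
have [g1 g2] := scontinuous_integrable (scontinuousW ab (lexx c) hF).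
have S (f : R -> R) : lebesgue_measure.-integrable `[a, c] (EFin \o f) ->
    lebesgue_measure.-integrable `[b, c] (EFin \o f) ->
    (\int[lebesgue_measure]_(x in `[a, c]) f x =
    \int[lebesgue_measure]_(x in `[a, b]) f x +
    \int[lebesgue_measure]_(x in `[b, c]) f x)%R.
  move=> fac fbc.
  rewrite -(@Rintegral_itv_obnd_cbnd _ b)//; last first.
    by apply: integrableS fbc => //; exact: subset_itv_oc_cc.
  by rewrite -(@Rintegral_itvB _ f (BLeft a) (BRight c) b)// 1?addrC ?subrK.
by apply: complex_ext; rewrite ?ReD ?ImD/=; exact: S.
Qed.

Lemma cint_le a b F M : a <= b -> scontinuous a b F ->
  (forall x, a <= x <= b -> nc (F x) <= M) ->
  nc (cint a b F) <= 2 * ((b - a) * M).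
Proof.
move=> ab /scontinuous_integrable[f1 f2] hM.
have ci : lebesgue_measure.-integrable `[a, b] (EFin \o (fun=> M)).
  apply: continuous_compact_integrable; first exact: segment_compact.
  by exact: continuous_subspaceT (fun x => cvg_cst _).
have key (f : R -> R) : lebesgue_measure.-integrable `[a, b] (EFin \o f) ->
    (forall x, a <= x <= b -> `|f x| <= M) ->
    `|\int[lebesgue_measure]_(x in `[a, b]) f x|%R <= (b - a) * M.
  move=> fi fM; rewrite (le_trans (le_normr_Rintegral _ fi))//.
  have -> : (b - a) * M = (\int[lebesgue_measure]_(x in `[a, b]) (fun=> M) x)%R.
    have := cint_cst M%:C ab => /(congr1 (@complex.Re R)).
    by rewrite ReM/= mulr0 subr0 mulrC => ->.
  apply: le_Rintegral => //.
  exact: integrable_norm.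
rewrite (le_trans (nc_le_ReIm _))// mulr2n mulrDl mul1r lerD//=.
  by apply: key => // x xab; rewrite (le_trans (Re_le_nc _))// hM.
by apply: key => // x xab; rewrite (le_trans (Im_le_nc _))// hM.
Qed.

End SegmentIntegral.

(** * Goursat's theorem on rectangles *)

Section Rectangles.
Variable R : realType.
Implicit Types (F G : R[i] -> R[i]) (a b c d x y : R).

Lemma scontinuous_h F y a b :
  (forall x, a <= x <= b -> ccontinuous F (x +i* y)) ->
  scontinuous a b (fun x => F (x +i* y)).
Proof.
have e x : x +i* y = (0 +i* y) + 1 * x%:C by rewrite mul1r; simpc.
move=> h; rewrite (_ : (fun x => _) = fun x => F ((0 +i* y) + 1 * x%:C)).
  by apply: scontinuous_line => x xab; rewrite -e; exact: h.
by apply/funext => x; rewrite -e.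
Qed.

Lemma scontinuous_v F x c d :
  (forall y, c <= y <= d -> ccontinuous F (x +i* y)) ->
  scontinuous c d (fun y => F (x +i* y)).
Proof.
have e y : x +i* y = x%:C + 'i%C * y%:C by simpc.
move=> h; rewrite (_ : (fun y => _) = fun y => F (x%:C + 'i%C * y%:C)).
  by apply: scontinuous_line => y ycd; rewrite -e; exact: h.
by apply/funext => y; rewrite -e.
Qed.

(** The contour integral over the boundary of [[a, b] x [c, d]], opposite sides
    being paired so that constants cancel inside the integrals. *)
Definition rect_int F a b c d : R[i] :=
  cint a b (fun x => F (x +i* c) - F (x +i* d)) +
  'i%C * cint c d (fun y => F (b +i* y) - F (a +i* y)).

Definition cont_sides F a b c d :=
  (forall x, a <= x <= b ->
    ccontinuous F (x +i* c) /\ ccontinuous F (x +i* d)) /\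
  (forall y, c <= y <= d ->
    ccontinuous F (a +i* y) /\ ccontinuous F (b +i* y)).

Definition on_sides a b c d (P : R[i] -> Prop) :=
  (forall x, a <= x <= b -> P (x +i* c) /\ P (x +i* d)) /\
  (forall y, c <= y <= d -> P (a +i* y) /\ P (b +i* y)).

Lemma cont_sidesS F a b c d : cont_sides F a b c d ->
  [/\ scontinuous a b (fun x => F (x +i* c)),
      scontinuous a b (fun x => F (x +i* d)),
      scontinuous c d (fun y => F (a +i* y)) &
      scontinuous c d (fun y => F (b +i* y))].
Proof.
by move=> [h1 h2]; split; [apply: scontinuous_h => x xab; case: (h1 x xab)..|
  apply: scontinuous_v => x xab; case: (h2 x xab)|
  apply: scontinuous_v => x xab; case: (h2 x xab)].
Qed.

Lemma rect_intB F G a b c d : cont_sides F a b c d -> cont_sides G a b c d ->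
  rect_int (fun z => F z - G z) a b c d = rect_int F a b c d - rect_int G a b c d.
Proof.
move=> /cont_sidesS[f1 f2 f3 f4] /cont_sidesS[g1 g2 g3 g4].
rewrite /rect_int !cintB//; do ?exact: scontinuousB; ring.
Qed.

Lemma rect_intD F G a b c d : cont_sides F a b c d -> cont_sides G a b c d ->
  rect_int (fun z => F z + G z) a b c d = rect_int F a b c d + rect_int G a b c d.
Proof.
move=> /cont_sidesS[f1 f2 f3 f4] /cont_sidesS[g1 g2 g3 g4].
rewrite /rect_int !cintB//; do ?exact: scontinuousD.
rewrite !cintD//; ring.
Qed.

Lemma rect_intZ F k a b c d : cont_sides F a b c d ->
  rect_int (fun z => k * F z) a b c d = k * rect_int F a b c d.
Proof.
move=> /cont_sidesS[f1 f2 f3 f4]; rewrite /rect_int.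
under eq_cint do rewrite -mulrBr.
under [X in _ + _ * X]eq_cint do rewrite -mulrBr.
rewrite !cintZ//; do ?exact: scontinuousB; ring.
Qed.

Lemma eq_rect_int F G a b c d : on_sides a b c d (fun z => F z = G z) ->
  rect_int F a b c d = rect_int G a b c d.
Proof.
move=> [h1 h2]; congr (_ + _ * _); apply: eq_cint.
  by move=> x /h1[-> ->].
by move=> y /h2[-> ->].
Qed.

Lemma rect_int_affine k l a b c d : a <= b -> c <= d ->
  rect_int (fun z => k + l * z) a b c d = 0.
Proof.
move=> ab cd; rewrite /rect_int.
have e1 x : k + l * (x +i* c) - (k + l * (x +i* d)) = l * (0 +i* (c - d)).
  rewrite -[0 +i* (c - d)]/(Complex 0 (c - d)).
  have -> : Complex 0 (c - d) = (x +i* c) - (x +i* d) by simpc.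
  by ring.
have e2 y : k + l * (b +i* y) - (k + l * (a +i* y)) = l * ((b - a) +i* 0).
  have -> : (b - a) +i* 0 = (b +i* y) - (a +i* y) by simpc.
  by ring.
under eq_cint do rewrite e1.
under [X in _ + _ * X]eq_cint do rewrite e2.
rewrite !cint_cst//.
have -> : 0 +i* (c - d) = - ('i%C * (d - c)%:C) by simpc.
have -> : (b - a) +i* 0 = (b - a)%:C by [].
by ring.
Qed.

Lemma cont_sides_cderivable F a b c d :
  on_sides a b c d (cderivable F) -> cont_sides F a b c d.
Proof.
by move=> [h1 h2]; split=> t /[dup] ht; [move=> /h1|move=> /h2] => -[? ?];
  split; exact: cderivable_ccontinuous.
Qed.

Lemma rect_int_le F a b c d M : a <= b -> c <= d -> cont_sides F a b c d ->
  on_sides a b c d (fun z => nc (F z) <= M) ->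
  nc (rect_int F a b c d) <= 4 * ((b - a) + (d - c)) * M.
Proof.
move=> ab cd /cont_sidesS[f1 f2 f3 f4] [h1 h2].
rewrite (le_trans (ncD _ _))// ncM.
have -> : nc ('i%C : R[i]) = 1.
  by rewrite /= expr0n/= expr1n add0r sqrtr1.
rewrite mul1r mulrDr mulrDl lerD//.
  have -> : 4 * (b - a) * M = 2 * ((b - a) * (M + M)) by ring.
  apply: cint_le => // [|x xab]; first exact: scontinuousB.
  by have [? ?] := h1 x xab; rewrite (le_trans (ncB _ _))// lerD.
have -> : 4 * (d - c) * M = 2 * ((d - c) * (M + M)) by ring.
apply: cint_le => // [|x xab]; first exact: scontinuousB.
by have [? ?] := h2 x xab; rewrite (le_trans (ncB _ _))// lerD.
Qed.

Lemma rect_int_hsplit F a m b c d : a <= m <= b -> cont_sides F a b c d ->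
  (forall y, c <= y <= d -> ccontinuous F (m +i* y)) ->
  rect_int F a b c d = rect_int F a m c d + rect_int F m b c d.
Proof.
move=> amb /cont_sidesS[f1 f2 f3 f4] /scontinuous_v f5.
rewrite /rect_int (cint_split amb); last exact: scontinuousB.
have -> : (fun y => F (b +i* y) - F (a +i* y)) =
  (fun y => (F (m +i* y) - F (a +i* y)) + (F (b +i* y) - F (m +i* y))).
  by apply/funext => y; ring.
rewrite (@cintD _ c d (fun y => F (m +i* y) - F (a +i* y))
  (fun y => F (b +i* y) - F (m +i* y))); do ?exact: scontinuousB; ring.
Qed.

Lemma rect_int_vsplit F a b c m d : c <= m <= d -> cont_sides F a b c d ->
  (forall x, a <= x <= b -> ccontinuous F (x +i* m)) ->
  rect_int F a b c d = rect_int F a b c m + rect_int F a b m d.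
Proof.
move=> amb /cont_sidesS[f1 f2 f3 f4] /scontinuous_h f5.
rewrite /rect_int (cint_split amb); last exact: scontinuousB.
have -> : (fun x => F (x +i* c) - F (x +i* d)) =
  (fun x => (F (x +i* c) - F (x +i* m)) + (F (x +i* m) - F (x +i* d))).
  by apply/funext => y; ring.
rewrite cintD; do ?exact: scontinuousB; ring.
Qed.

Definition in_rect a b c d (z : R[i]) :=
  (a <= complex.Re z <= b) && (c <= complex.Im z <= d).

Lemma nested_point (u v : nat -> R) : (forall n, u n <= u n.+1) ->
  (forall n, v n.+1 <= v n) -> (forall n, u n <= v n) ->
  exists x, forall n, u n <= x <= v n.
Proof.
move=> hu hv uv.
have nu n m : (n <= m)%N -> u n <= u m.
  elim: m => [|m IH]; first by rewrite leqn0 => /eqP ->.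
  by rewrite leq_eqVlt => /orP[/eqP ->//|/IH/le_trans]; apply.
have nv n m : (n <= m)%N -> v m <= v n.
  elim: m => [|m IH]; first by rewrite leqn0 => /eqP ->.
  by rewrite leq_eqVlt => /orP[/eqP ->//|/IH]; apply: le_trans.
have ub n : ubound (range u) (v n).
  move=> _ [m _ <-].
  have [nm|mn] := leqP n m; first by rewrite (le_trans (uv m))// nv.
  by rewrite (le_trans _ (uv n))// nu// ltnW.
exists (sup (range u)) => n; apply/andP; split.
  apply: sup_upper_bound; last by exists n.
  by split; [exists (u 0); exists 0|exists (v 0)].
by apply: ge_sup; [exists (u 0); exists 0|exact: ub].
Qed.

(** The four integrals add up to the whole one, so they cannot all be smaller than
    a quarter of it. *)
Lemma quarter F a b c d : a <= b -> c <= d ->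
  (forall z, in_rect a b c d z -> ccontinuous F z) ->
  exists q : (R * R) * (R * R),
    [/\ [/\ a <= q.1.1, q.1.2 <= b, q.1.1 <= q.1.2 & q.1.2 - q.1.1 = (b - a) / 2],
        [/\ c <= q.2.1, q.2.2 <= d, q.2.1 <= q.2.2 & q.2.2 - q.2.1 = (d - c) / 2] &
        nc (rect_int F a b c d) <= 4 * nc (rect_int F q.1.1 q.1.2 q.2.1 q.2.2)].
Proof.
move=> ab cd hF; set m := (a + b) / 2; set n := (c + d) / 2.
have amb : a <= m <= b by rewrite /m; lra.
have cnd : c <= n <= d by rewrite /n; lra.
have [am mb] := andP amb; have [cn nd] := andP cnd.
have hc x y : a <= x <= b -> c <= y <= d -> ccontinuous F (x +i* y).
  by move=> hx hy; apply: hF; rewrite /in_rect/= hx hy.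
have cs a' b' c' d' : a <= a' -> a' <= b' -> b' <= b -> c <= c' -> c' <= d' ->
    d' <= d -> cont_sides F a' b' c' d'.
  move=> ? ? ? ? ? ?; split=> t /andP[? ?]; split; apply: hc; lra.
have E : rect_int F a b c d =
  (rect_int F a m c n + rect_int F a m n d) +
  (rect_int F m b c n + rect_int F m b n d).
  rewrite (rect_int_hsplit amb); [|by apply: cs; lra|by move=> y ?; apply: hc].
  rewrite (@rect_int_vsplit _ a m c n d)//; [|by apply: cs; lra|
    by move=> x /andP[? ?]; apply: hc; lra].
  by rewrite (@rect_int_vsplit _ m b c n d)//; [by apply: cs; lra|
    by move=> x /andP[? ?]; apply: hc; lra].
have T := ncD (rect_int F a m c n + rect_int F a m n d)
  (rect_int F m b c n + rect_int F m b n d).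
have T1 := ncD (rect_int F a m c n) (rect_int F a m n d).
have T2 := ncD (rect_int F m b c n) (rect_int F m b n d).
rewrite -E in T.
have w1 : m - a = (b - a) / 2 by rewrite /m; field.
have w2 : b - m = (b - a) / 2 by rewrite /m; field.
have w3 : n - c = (d - c) / 2 by rewrite /n; field.
have w4 : d - n = (d - c) / 2 by rewrite /n; field.
have [h1|h1] := leP (nc (rect_int F a b c d)) (4 * nc (rect_int F a m c n)).
  by exists ((a, m), (c, n)).
have [h2|h2] := leP (nc (rect_int F a b c d)) (4 * nc (rect_int F a m n d)).
  by exists ((a, m), (n, d)).
have [h3|h3] := leP (nc (rect_int F a b c d)) (4 * nc (rect_int F m b c n)).
  by exists ((m, b), (c, n)).
have [h4|h4] := leP (nc (rect_int F a b c d)) (4 * nc (rect_int F m b n d)).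
  by exists ((m, b), (n, d)).
by exfalso; move: T T1 T2 h1 h2 h3 h4; clear; lra.
Qed.

(** Bisection: some quarter always carries at least a quarter of the integral;
    the quarters shrink to a point where [F] is affine up to [o(diameter)], and
    affine functions have no integral, so the integral over the [n]-th quarter
    is [o(4^-n)]. *)
Lemma goursat F a b c d : a <= b -> c <= d ->
  (forall z, in_rect a b c d z -> cderivable F z) -> rect_int F a b c d = 0.
Proof.
move=> ab cd hF.
have hc z : in_rect a b c d z -> ccontinuous F z.
  by move/hF; exact: cderivable_ccontinuous.
pose T := ((R * R) * (R * R))%type.
pose valid (q : T) := [/\ a <= q.1.1, q.1.2 <= b & q.1.1 <= q.1.2] /\
  [/\ c <= q.2.1, q.2.2 <= d & q.2.1 <= q.2.2].
pose rel (q q' : T) := valid q -> [/\ valid q',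
   [/\ q.1.1 <= q'.1.1, q'.1.2 <= q.1.2 & q'.1.2 - q'.1.1 = (q.1.2 - q.1.1) / 2],
   [/\ q.2.1 <= q'.2.1, q'.2.2 <= q.2.2 & q'.2.2 - q'.2.1 = (q.2.2 - q.2.1) / 2]
   & nc (rect_int F q.1.1 q.1.2 q.2.1 q.2.2) <=
     4 * nc (rect_int F q'.1.1 q'.1.2 q'.2.1 q'.2.2)].
have step (q : T) : {q' | rel q q'}.
  apply: cid; have [vq|] := pselect (valid q); last by exists q.
  have [[h1 h2 h3] [h4 h5 h6]] := vq.
  have [|q' [[i1 i2 i3 i4] [i5 i6 i7 i8] i9]] := @quarter F _ _ _ _ h3 h6.
    move=> z /andP[/andP[? ?] /andP[? ?]]; apply: hc.
    by rewrite /in_rect; apply/andP; split; lra.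
  exists q' => _; split=> //; split; split=> //;
    clear -h1 h2 h3 h4 h5 h6 i1 i2 i3 i4 i5 i6 i7 i8; lra.
have [f [f0 fS]] := dependent_choice step ((a, b), (c, d)).
have vf n : valid (f n).
  elim: n => [|n IH]; first by rewrite f0; split; split=> /=.
  by have [] := fS n IH.
have [x hx] : exists x, forall n, (f n).1.1 <= x <= (f n).1.2.
  apply: nested_point => n; first by have [_ []] := fS n (vf n).
    by have [_ []] := fS n (vf n).
  by have [[]] := vf n.
have [y hy] : exists y, forall n, (f n).2.1 <= y <= (f n).2.2.
  apply: nested_point => n; first by have [_ _ []] := fS n (vf n).
    by have [_ _ []] := fS n (vf n).
  by have [_ []] := vf n.
pose D := (b - a) + (d - c).
have hD n : ((f n).1.2 - (f n).1.1) + ((f n).2.2 - (f n).2.1) = D / 2 ^+ n.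
  elim: n => [|n IH]; first by rewrite f0 expr0 divr1.
  have [_ [_ _ ->] [_ _ ->] _] := fS n (vf n).
  by rewrite -mulrDl IH exprS; field; rewrite expf_neq0// pnatr_eq0.
have hI n : nc (rect_int F a b c d) <=
   4 ^+ n * nc (rect_int F (f n).1.1 (f n).1.2 (f n).2.1 (f n).2.2).
  elim: n => [|n IH]; first by rewrite f0 expr0 mul1r.
  rewrite (le_trans IH)// exprSr -mulrA ler_wpM2l ?exprn_ge0//.
  by have [] := fS n (vf n).
have D0 : 0 <= D by rewrite /D; lra.
have [l hl] : cderivable F (x +i* y).
  apply: hF; have := hx 0; have := hy 0; rewrite f0 /in_rect/= => -> ->//.
apply: nc_le0_eq => e e0; rewrite subr0.
have e1 : 0 < e / (4 * D ^+ 2 + 1).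
  by rewrite divr_gt0// ltr_wpDl// mulr_ge0// sqr_ge0.
have [dl dl0 hdl] := hl _ e1.
have [n hn] : exists n : nat, D / 2 ^+ n <= dl.
  have [n hn] : exists n : nat, D / dl <= 2 ^+ n.
    exists (Num.trunc (D / dl)).+1.
    rewrite (le_trans (ltW (truncnS_gt _)))// -natrX ler_nat ltnW//.
    exact: ltn_expl.
  by exists n; rewrite ler_pdivrMr ?exprn_gt0// mulrC -ler_pdivrMr.
rewrite (le_trans (hI n))//.
have [[v1 v2 v3] [v4 v5 v6]] := vf n.
set a' := (f n).1.1 in v1 v2 v3 *; set b' := (f n).1.2 in v1 v2 v3 *.
set c' := (f n).2.1 in v4 v5 v6 *; set d' := (f n).2.2 in v4 v5 v6 *.
have := hD n; have := hx n; have := hy n.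
rewrite -/a' -/b' -/c' -/d' => hyn hxn hDn.
set A := fun z : R[i] => (F (x +i* y) - l * (x +i* y)) + l * z.
have cs : cont_sides F a' b' c' d'.
  split=> t /andP[t1 t2]; split; apply: hc; rewrite /in_rect/=;
    clear -t1 t2 v1 v2 v3 v4 v5 v6; lra.
have hA z : cderivable A z.
  apply: cderivableD; first exact: cderivable_cst.
  by apply: cderivableM; [exact: cderivable_cst|exact: cderivable_id].
have csA : cont_sides A a' b' c' d'.
  by apply: cont_sides_cderivable; split.
have -> : rect_int F a' b' c' d' = rect_int (fun z => F z - A z) a' b' c' d'.
  by rewrite rect_intB// [X in _ - X]rect_int_affine// subr0.
have close u v : a' <= u <= b' -> c' <= v <= d' ->
    nc ((fun z => F z - A z) (u +i* v)) <= e / (4 * D ^+ 2 + 1) * (D / 2 ^+ n).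
  move=> hu hv.
  have nn : nc ((u +i* v) - (x +i* y)) <= D / 2 ^+ n.
    rewrite (le_trans (nc_le_ReIm _))//= -hDn lerD// ler_norml;
      clear -hu hv hxn hyn; lra.
  have -> : F (u +i* v) - A (u +i* v) =
    F (u +i* v) - F (x +i* y) - l * ((u +i* v) - (x +i* y)).
    by rewrite /A; ring.
  rewrite (le_trans (hdl _ (le_trans nn hn)))// ler_wpM2l// ltW//.
have : nc (rect_int (fun z => F z - A z) a' b' c' d') <=
   4 * ((b' - a') + (d' - c')) * (e / (4 * D ^+ 2 + 1) * (D / 2 ^+ n)).
  apply: rect_int_le => //.
    apply: cont_sides_cderivable; split=> t /andP[t1 t2]; split;
      (apply: cderivableB; [apply: hF; rewrite /in_rect/=;
       clear -t1 t2 v1 v2 v3 v4 v5 v6; lra|exact: hA]).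
  by split=> t ht; split; apply: close => //; rewrite lexx ?v3 ?v6.
rewrite hDn => H.
have p4 : (4 : R) ^+ n = 2 ^+ n * 2 ^+ n by rewrite -exprMn; congr (_ ^+ _); ring.
have pn : (2 : R) ^+ n != 0 by rewrite expf_neq0// pnatr_eq0.
have pD : 4 * D ^+ 2 + 1 != 0 by rewrite gt_eqF// ltr_wpDl// mulr_ge0// sqr_ge0.
apply: (@le_trans _ _ (4 * D ^+ 2 * (e / (4 * D ^+ 2 + 1)))).
  rewrite (le_trans (ler_wpM2l _ H)) ?exprn_ge0// p4 le_eqVlt; apply/orP; left.
  by apply/eqP; field; rewrite ?pn ?pD.
rewrite mulrCA ler_piMr ?(ltW e0)// ler_pdivrMr ?mul1r ?lerDl//.
by rewrite ltr_wpDl// mulr_ge0// sqr_ge0.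
Qed.

End Rectangles.

(** * Cauchy's formula on squares and Taylor expansion of entire functions *)

Section Compactness.
Variable R : realType.

(** Continuity and closedness are expressed by the real valued modulus;
    compactness is transported from the product of two real segments. *)
Lemma complex_EVT (K : set R[i]) (M : R) (f : R[i] -> R) :
  (exists z, K z) -> (forall z, K z -> nc z <= M) ->
  (forall z, (forall d : R, 0 < d -> exists2 w, K w & nc (w - z) <= d) -> K z) ->
  (forall z, K z -> forall e : R, 0 < e ->
     exists2 d : R, 0 < d & forall w, nc (w - z) <= d -> `|f w - f z| <= e) ->
  exists2 z, K z & forall w, K w -> f w <= f z.
Proof.
move=> [z0 Kz0] KM Kcl fc.
pose c (p : R * R) : R[i] := p.1 +i* p.2.
pose K' : set (R * R) := [set p | K (c p)].
have dist (p q : R * R) (d : R) : ball p d q -> nc (c q - c p) <= d + d.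
  move=> [h1 h2]; rewrite (le_trans (nc_le_ReIm _))//=.
  by rewrite lerD// distrC ltW.
have K'cl : closed K'.
  move=> p hp; apply: Kcl => d d0.
  have d2 : 0 < d / 2 by rewrite divr_gt0.
  have [q [Kq pq]] := hp _ (nbhsx_ballx p _ d2).
  by exists (c q) => //; rewrite (le_trans (dist _ _ _ pq))// -splitr.
have K'c : compact K'.
  apply: (@subclosed_compact _ _ (`[- M, M] `*` `[- M, M])) => //.
    by apply: compact_setX; exact: segment_compact.
  move=> p /KM pM; split; rewrite /= in_itv/= -ler_norml.
    exact: le_trans (Re_le_nc (c p)) pM.
  exact: le_trans (Im_le_nc (c p)) pM.
have [||p pK' hp] := @compact_EVT_max _ R (f \o c) K' _ K'c.
- by exists (complex.Re z0, complex.Im z0); rewrite /K' /c/=; case: z0 Kz0.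
- apply: continuous_in_subspaceT => p; rewrite inE => Kp.
  apply/cvgrPdist_le => e e0; have [d d0 hd] := fc _ Kp _ e0.
  have d2 : 0 < d / 2 by rewrite divr_gt0.
  apply: (filterS _ (nbhsx_ballx p _ d2)) => q /dist; rewrite -splitr => /hd.
  by rewrite distrC.
- exists (c p); first by rewrite inE in pK'.
  move=> w Kw; have := hp (complex.Re w, complex.Im w); rewrite inE /K'/c/=.
  by case: w Kw => u v Kw /(_ Kw).
Qed.

Lemma ccontinuous_nc (F : R[i] -> R[i]) z : ccontinuous F z ->
  forall e : R, 0 < e ->
     exists2 d : R, 0 < d & forall w, nc (w - z) <= d ->
       `|nc (F w) - nc (F z)| <= e.
Proof.
move=> h e e0; have [d d0 hd] := h _ e0; exists d => // w /hd H.
rewrite (le_trans _ H)// ler_norml ncB_ge andbT lerNl opprB nc_distC.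
exact: ncB_ge.
Qed.

Lemma disc_closed (r : R) (z : R[i]) :
  (forall d : R, 0 < d -> exists2 w, nc w <= r & nc (w - z) <= d) -> nc z <= r.
Proof.
move=> h; apply/ler_addgt0Pr => e e0; have [w wr wz] := h _ e0.
rewrite -[z](subrK w) addrC (le_trans (ncD _ _))// lerD//.
by rewrite nc_distC.
Qed.

Lemma entire_bounded_on_disc (F : R[i] -> R[i]) (r : R) :
  (forall z, ccontinuous F z) ->
  exists2 M, 0 < M & forall z, nc z <= r -> nc (F z) <= M.
Proof.
move=> hF; have [r0|r0] := leP 0 r; last first.
  exists 1 => // z zr; have := le_lt_trans zr r0.
  by rewrite ltNge nc_ge0.
have [|z|z|z _|z zr hz] := @complex_EVT [set z | nc z <= r] r (fun z => nc (F z)).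
- by exists 0; rewrite /mkset nc0.
- by [].
- exact: disc_closed.
- by move=> e e0; exact: ccontinuous_nc.
- exists (nc (F z) + 1); first by rewrite ltr_wpDl ?nc_ge0.
  by move=> w /hz/le_trans; apply; rewrite lerDl.
Qed.

End Compactness.

Section CauchyFormula.
Variable R : realType.
Implicit Types (F G : R[i] -> R[i]) (a b c d x y r : R).

(** Cutting along the lines through the sides of the inner rectangle leaves
    pieces that are either the inner rectangle or covered by Goursat. *)
Lemma rect_int_shrink F a a' b' b c c' d' d :
  a <= a' -> a' <= b' -> b' <= b -> c <= c' -> c' <= d' -> d' <= d ->
  (forall z, in_rect a b c d z ->
     ~~ ((a' < complex.Re z < b') && (c' < complex.Im z < d')) ->
     cderivable F z) ->
  rect_int F a b c d = rect_int F a' b' c' d'.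
Proof.
move=> aa ab bb cc cd dd hF.
have D x y : a <= x <= b -> c <= y <= d ->
    (x <= a') || (b' <= x) || (y <= c') || (d' <= y) -> cderivable F (x +i* y).
  move=> hx hy h; apply: hF; first by rewrite /in_rect/= hx hy.
  by rewrite /= !negb_and -!leNgt -!orbA; rewrite -!orbA in h.
have C x y : a <= x <= b -> c <= y <= d ->
    (x <= a') || (b' <= x) || (y <= c') || (d' <= y) -> ccontinuous F (x +i* y).
  by move=> *; apply: cderivable_ccontinuous; exact: D.
have CS u v s t : a <= u -> u <= v -> v <= b -> c <= s -> s <= t -> t <= d ->
    (u <= a') || (b' <= u) -> (v <= a') || (b' <= v) ->
    (s <= c') || (d' <= s) -> (t <= c') || (d' <= t) ->
    cont_sides F u v s t.
  move=> h1 h2 h3 h4 h5 h6 h7 h8 h9 h10.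
  split=> w /andP[w1 w2]; split; apply: C.
  - by rewrite (le_trans h1 w1) (le_trans w2 h3).
  - by rewrite h4 (le_trans h5 h6).
  - by rewrite -orbA h9 orbT.
  - by rewrite (le_trans h1 w1) (le_trans w2 h3).
  - by rewrite h6 (le_trans h4 h5).
  - by rewrite -orbA h10 orbT.
  - by rewrite h1 (le_trans h2 h3).
  - by rewrite (le_trans h4 w1) (le_trans w2 h6).
  - by rewrite h7.
  - by rewrite h3 (le_trans h1 h2).
  - by rewrite (le_trans h4 w1) (le_trans w2 h6).
  - by rewrite h8.
have ab' := le_trans aa ab; have a'b := le_trans ab bb.
have cd' := le_trans cc cd; have c'd := le_trans cd dd.
have Gz u v s t : a <= u -> u <= v -> v <= b -> c <= s -> s <= t -> t <= d ->
    [|| v <= a', b' <= u, t <= c' | d' <= s] -> rect_int F u v s t = 0.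
  move=> h1 h2 h3 h4 h5 h6 h; apply: goursat => // -[x y].
  rewrite /in_rect/= => /andP[/andP[x1 x2] /andP[y1 y2]]; apply: D.
  - by rewrite (le_trans h1 x1) (le_trans x2 h3).
  - by rewrite (le_trans h4 y1) (le_trans y2 h6).
  - case/or4P: h => h.
    + by rewrite (le_trans x2 h).
    + by rewrite (le_trans h x1) orbT.
    + by rewrite (le_trans y2 h) !orbT.
    + by rewrite (le_trans h y1) !orbT.
have le_ab : a <= b by exact: le_trans ab' bb.
have le_cd : c <= d by exact: le_trans cd' dd.
rewrite (@rect_int_hsplit _ F a a' b c d) ?aa//; first last.
- by move=> y hy; apply: C; rewrite ?lexx// aa.
- by apply: CS; rewrite ?lexx ?aa ?bb ?cc ?dd ?orbT.
rewrite (Gz a a' c d) ?lexx// add0r.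
rewrite (@rect_int_hsplit _ F a' b' b c d) ?ab//; first last.
- by move=> y hy; apply: C; rewrite ?lexx ?orbT// ab'.
- by apply: CS; rewrite ?lexx ?aa ?bb ?cc ?dd ?orbT.
rewrite (Gz b' b c d) ?lexx ?orbT// addr0.
rewrite (@rect_int_vsplit _ F a' b' c c' d) ?cc//; first last.
- move=> x /andP[x1 x2]; apply: C; rewrite ?lexx ?orbT ?cc//.
  by rewrite (le_trans aa x1) (le_trans x2 bb).
- by apply: CS; rewrite ?lexx ?aa ?bb ?cc ?dd ?orbT.
rewrite (Gz a' b' c c') ?lexx ?orbT// add0r.
rewrite (@rect_int_vsplit _ F a' b' c' d' d) ?cd//; first last.
- move=> x /andP[x1 x2]; apply: C; rewrite ?lexx ?orbT ?cd'//.
  by rewrite (le_trans aa x1) (le_trans x2 bb).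
- by apply: CS; rewrite ?lexx ?aa ?bb ?cc ?dd ?orbT.
by rewrite (Gz a' b' d' d) ?lexx ?orbT// addr0.
Qed.

Local Notation square F r := (rect_int F (- r) r (- r) r).

Lemma square_sides (P : R[i] -> Prop) r : 0 <= r ->
  (forall z, r <= nc z -> nc z <= 2 * r -> P z) -> on_sides (- r) r (- r) r P.
Proof.
move=> r0 h; split=> t ht; split; apply: h; first
  [by rewrite (le_trans _ (Re_le_nc _))//= ?normrN ger0_norm
  |by rewrite (le_trans _ (Im_le_nc _))//= ?normrN ger0_norm
  |by rewrite (le_trans (nc_le_ReIm _))//= mulr2n mulrDl mul1r lerD// ?normrN;
   rewrite ?(ger0_norm r0)// ler_norml].
Qed.

Lemma cderivable_inv_sub (w z : R[i]) : z != w -> cderivable (fun u => (u - w)^-1) z.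
Proof.
move=> zw; apply: cderivableV; first by rewrite subr_eq0.
by apply: cderivableB; [exact: cderivable_id|exact: cderivable_cst].
Qed.

Lemma ler_eps_eq0 (z : R[i]) (k : R) : 0 <= k ->
  (forall e, 0 < e -> e <= 1 -> nc z <= k * e) -> z = 0.
Proof.
move=> k0 h; apply: nc_le0_eq => e e0; rewrite subr0.
set e' := Num.min 1 (e / (k + 1)).
have k1 : 0 < k + 1 by rewrite ltr_wpDl.
have e'0 : 0 < e' by rewrite lt_min ltr01 divr_gt0.
rewrite (le_trans (h _ e'0 _)) ?ge_min ?lexx//.
apply: (@le_trans _ _ ((k + 1) * e')); first by rewrite ler_wpM2r ?lerDl ?ltW.
by rewrite mulrC -ler_pdivlMr// ge_min lexx orbT.
Qed.

Lemma nc_le_sub (w z : R[i]) r : 0 < r -> nc w <= r / 2 -> r <= nc z -> r / 2 <= nc (z - w).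
Proof. by move=> r0 hw hz; have := ncB_ge z w; lra. Qed.

(** The difference quotient at [w] has an isolated singularity where it stays
    bounded, hence its integral shrinks to zero with the rectangle around [w]. *)
Lemma cauchy_square F (w : R[i]) r : 0 < r -> nc w <= r / 2 ->
  (forall z, cderivable F z) ->
  square (fun z => F z / (z - w)) r = F w * square (fun z => (z - w)^-1) r.
Proof.
move=> r0 wr hF.
have wz0 z : r <= nc z -> z != w.
  move=> hz; apply/eqP => zw; move: hz; rewrite zw; lra.
pose Q z := (F z - F w) * (z - w)^-1.
have dQ z : z != w -> cderivable Q z.
  move=> zw; apply: cderivableM; last exact: cderivable_inv_sub.
  by apply: cderivableB; [exact: hF|exact: cderivable_cst].
have cs G : (forall z, z != w -> cderivable G z) -> cont_sides G (- r) r (- r) r.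
  move=> hG; apply: cont_sides_cderivable; apply: square_sides; first exact: ltW.
  by move=> z /wz0 zw _; exact: hG.
have I : square Q r = 0.
  have [l hl] := hF w; have [d d0 hd] := hl 1 ltr01.
  have hx := Re_le_nc w; have hy := Im_le_nc w.
  set x := complex.Re w in hx; set y := complex.Im w in hy.
  pose B := nc l + 1.
  have B0 : 0 <= B by rewrite addr_ge0 ?nc_ge0.
  have dr0 : 0 < Num.min (d / 4) (r / 4) by rewrite lt_min !divr_gt0.
  set m := Num.min (d / 4) (r / 4) in dr0.
  have md : m <= d / 4 by rewrite ge_min lexx.
  have mr : m <= r / 4 by rewrite ge_min lexx orbT.
  apply: (@ler_eps_eq0 _ (16 * m * B)); first by rewrite !mulr_ge0// ltW.
  move=> e e0 e1; set h := e * m.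
  have h0 : 0 < h by rewrite mulr_gt0.
  have hm : h <= m by rewrite /h ler_piMl// ltW.
  move: hx hy; rewrite !ler_norml => /andP[x1 x2] /andP[y1 y2].
  rewrite (@rect_int_shrink Q (- r) (x - h) (x + h) r (- r) (y - h) (y + h) r);
    [|lra..|].
    have -> : 16 * m * B * e = 4 * ((x + h - (x - h)) + (y + h - (y - h))) * B.
      by rewrite /h; ring.
    have sd (P : R[i] -> Prop) : (forall z, h <= nc (z - w) -> nc (z - w) <= 2 * h ->
        P z) -> on_sides (x - h) (x + h) (y - h) (y + h) P.
      move=> hP; split=> t ht; split; apply: hP; first
       [by rewrite (le_trans _ (Re_le_nc _))// ReD ReN/= addrAC subrr add0r
           ?normrN gtr0_norm
       |by rewrite (le_trans _ (Im_le_nc _))// ImD ImN/= addrAC subrr add0r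
           ?normrN gtr0_norm
       |by rewrite (le_trans (nc_le_ReIm _))// ReD ReN ImD ImN/= mulr2n mulrDl
         mul1r lerD// ler_norml -/x -/y; lra].
    apply: rect_int_le; [lra|lra| |].
      apply: cont_sides_cderivable; apply: sd => z hz _; apply: dQ.
      by apply/eqP => zw; move: hz; rewrite zw subrr nc0; lra.
    apply: sd => z hz1 hz2.
    have n0 : 0 < nc (z - w) by lra.
    rewrite /Q ncM ncV ler_pdivrMr//.
    have -> : F z - F w = (F z - F w - l * (z - w)) + l * (z - w) by ring.
    rewrite (le_trans (ncD _ _))// /B mulrDl addrC ncM lerD// hd//; lra.
  move=> z _ hz; apply: dQ; apply/eqP => zw; move: hz.
  by rewrite zw -/x -/y; move/negP; apply; apply/andP; split; lra.
have : square (fun z => F z / (z - w) - F w * (z - w)^-1) r = square Q r.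
  by apply: eq_rect_int; split=> t _; split; rewrite /Q mulrBl.
have dV z : z != w -> cderivable (fun u => F w * (u - w)^-1) z.
  by move=> zw; apply: cderivableM; [exact: cderivable_cst|exact: cderivable_inv_sub].
rewrite I rect_intB; [|apply: cs => z zw|exact: cs]; last first.
  by apply: cderivableM; [exact: hF|exact: cderivable_inv_sub].
by rewrite rect_intZ; [move/eqP; rewrite subr_eq0 => /eqP|
  apply: cs => z zw; exact: cderivable_inv_sub].
Qed.

(** On the square of half-side [t], the integrand of the difference is
    [O(t^-2)] while the perimeter is [O(t)]. *)
Lemma square_inv_const (w : R[i]) r : 0 < r -> nc w <= r / 2 ->
  square (fun z => (z - w)^-1) r = square (fun z => z^-1) r.
Proof.
move=> r0 wr.
pose Q z := (z - w)^-1 - (z - 0)^-1.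
have ne u z : nc u <= r / 2 -> r <= nc z -> z != u.
  move=> hu hz; apply/eqP => zu; move: hz; rewrite zu; lra.
have n0 : nc (0 : R[i]) <= r / 2 by rewrite nc0; lra.
have dV u z : nc u <= r / 2 -> r <= nc z -> cderivable (fun v => (v - u)^-1) z.
  by move=> hu hz; apply: cderivable_inv_sub; exact: ne.
have dQ z : r <= nc z -> cderivable Q z.
  by move=> hz; apply: cderivableB; exact: dV.
have cs G t : r <= t -> (forall z, r <= nc z -> cderivable G z) ->
   cont_sides G (- t) t (- t) t.
  move=> rt hG; apply: cont_sides_cderivable; apply: square_sides; first lra.
  by move=> z hz _; apply: hG; exact: le_trans hz.
apply/eqP; rewrite -subr_eq0; apply/eqP.
have -> : square (fun z => z^-1) r = square (fun z => (z - 0)^-1) r.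
  by apply: eq_rect_int; split=> t _; split; rewrite subr0.
rewrite -rect_intB; [|by apply: cs => // z; exact: dV..].
rewrite -/Q; apply: (@ler_eps_eq0 _ 16) => // e e0 e1.
pose t := r / e.
have rt : r <= t by rewrite /t ler_pdivlMr// ler_piMr// ltW.
have t0 : 0 < t by exact: lt_le_trans rt.
rewrite -(@rect_int_shrink Q (- t) (- r) r t (- t) (- r) r t); [|lra..|].
  have -> : 16 * e = 4 * ((t - - t) + (t - - t)) * (e / t).
    by field; rewrite gt_eqF.
  apply: rect_int_le; [lra|lra|exact: cs|].
  apply: square_sides; first exact: ltW.
  move=> z tz _; have rz := le_trans rt tz.
  have z0 : 0 < nc z by exact: lt_le_trans rz.
  have zw := nc_le_sub t0 (_ : nc w <= t / 2) tz.
  have {}zw : t / 2 <= nc (z - w) by apply: zw; lra.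
  have zw0 : 0 < nc (z - w) by lra.
  have -> : Q z = w * (z^-1 * (z - w)^-1).
    have zn : z != 0 by rewrite -nc_gt0.
    have zwn : z - w != 0 by rewrite -nc_gt0.
    by rewrite /Q subr0; field; rewrite zn zwn.
  rewrite !ncM !ncV.
  apply: (@le_trans _ _ (r / 2 * (t^-1 * (t / 2)^-1))).
    apply: ler_pM; rewrite ?nc_ge0// ?mulr_ge0 ?invr_ge0 ?nc_ge0//.
    by apply: ler_pM; rewrite ?invr_ge0 ?nc_ge0// lef_pV2// posrE; lra.
  rewrite le_eqVlt; apply/orP; left; apply/eqP.
  by rewrite /t; field; rewrite ?gt_eqF.
move=> z _; rewrite negb_and !negb_and -!leNgt => h; apply: dQ.
case/orP: h => /orP[] h.
- by rewrite (le_trans _ (Re_le_nc _))// ler_normr lerNr h orbT.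
- by rewrite (le_trans _ (Re_le_nc _))// ler_normr h.
- by rewrite (le_trans _ (Im_le_nc _))// ler_normr lerNr h orbT.
- by rewrite (le_trans _ (Im_le_nc _))// ler_normr h.
Qed.

(** Opposite sides contribute equal multiples of [i] by the integral of a positive
    function. *)
Lemma square_inv_neq0 r : 0 < r -> square (fun z => z^-1) r != 0.
Proof.
move=> r0; pose k x : R := 2 * r / (x ^+ 2 + r ^+ 2).
have hx x : - r <= x -> x <= r -> x ^+ 2 + r ^+ 2 <= 2 * r * r.
  move=> x1 x2; have : 0 <= (r - x) * (r + x) by apply: mulr_ge0; lra.
  by nra.
have p x : 0 < x ^+ 2 + r ^+ 2 by rewrite ltr_wpDl ?sqr_ge0 ?exprn_gt0.
have e1 x : (x +i* - r)^-1 - (x +i* r)^-1 = 'i%C * (k x)%:C.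
  rewrite -[(x +i* - r)^-1]/((x / (x ^+ 2 + (- r) ^+ 2)) -i* (- r / (x ^+ 2 + (- r) ^+ 2))).
  rewrite -[(x +i* r)^-1]/((x / (x ^+ 2 + r ^+ 2)) -i* (r / (x ^+ 2 + r ^+ 2))).
  by rewrite sqrrN /k; simpc; congr (_ +i* _); rewrite -?mulNr; ring.
have e2 y : (r +i* y)^-1 - ((- r) +i* y)^-1 = (k y)%:C.
  rewrite -[(r +i* y)^-1]/((r / (r ^+ 2 + y ^+ 2)) -i* (y / (r ^+ 2 + y ^+ 2))).
  rewrite -[((- r) +i* y)^-1]/((- r / ((- r) ^+ 2 + y ^+ 2)) -i* (y / ((- r) ^+ 2 + y ^+ 2))).
  by rewrite sqrrN /k [r ^+ 2 + _]addrC; simpc; congr (_ +i* _); ring.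
have sk : scontinuous (- r) r (fun x => (k x)%:C).
  have cs : cont_sides (fun z : R[i] => (z - 0)^-1) (- r) r (- r) r.
    apply: cont_sides_cderivable; apply: square_sides; first exact: ltW.
    move=> z hz _; apply: cderivable_inv_sub; rewrite -nc_gt0; lra.
  have [_ _ h1 h2] := cont_sidesS cs.
  rewrite (_ : (fun x => _) =
    fun x => (r +i* x - 0)^-1 - ((- r) +i* x - 0)^-1); first exact: scontinuousB.
  by apply/funext => y; rewrite !subr0 e2.
rewrite /rect_int.
under eq_cint do rewrite e1.
under [X in _ + _ * X]eq_cint do rewrite e2.
rewrite cintZ// -mulrDr mulf_neq0//; first by rewrite eq_complex/= oner_eq0 andbF.
rewrite -mulr2n mulrn_eq0/=.
apply/eqP => /(congr1 (@complex.Re R))/=.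
apply/eqP; rewrite gt_eqF//.
have [ik _] := scontinuous_integrable sk.
have [ic _] := scontinuous_integrable (scontinuous_cst (- r) r (r^-1)%:C).
apply: (@lt_le_trans _ _ (\int[lebesgue_measure]_(x in `[(- r), r]) (r^-1))%R).
  have := cint_cst (r^-1)%:C (_ : - r <= r).
  have rr : - r <= r by lra.
  move=> /(_ rr) /(congr1 (@complex.Re R)); rewrite ReM/= mulr0 subr0 => ->.
  by rewrite mulr_gt0 ?invr_gt0//; lra.
apply: le_Rintegral => // x; rewrite /= in_itv/= => /andP[x1 x2].
rewrite /k ler_pdivlMr// mulrC ler_pdivrMr//.
exact: hx.
Qed.

End CauchyFormula.

Section Taylor.
Variable R : realType.
Implicit Types (F : R[i] -> R[i]) (c : nat -> R[i]).

Local Notation square F r := (rect_int F (- r) r (- r) r).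

Definition trunc c n : {poly R[i]} := \poly_(k < n) c k.

Definition taylor_on F c (r : R) := forall e : R, 0 < e ->
  exists n0, forall n, (n0 <= n)%N -> forall z, nc z <= r ->
    nc (F z - (trunc c n).[z]) <= e.

(** Locally uniform convergence of the Taylor polynomials; this replaces
    infinite series throughout. *)
Definition has_taylor F c := forall r, taylor_on F c r.

Lemma geometric_kernel (w z : R[i]) n : z != 0 -> z - w != 0 ->
  (z - w)^-1 = \sum_(k < n) w ^+ k * z^-1 ^+ k.+1 + (w / z) ^+ n / (z - w).
Proof.
move=> z0 zw; elim: n => [|n IH]; first by rewrite big_ord0 add0r expr0 mul1r.
rewrite big_ord_recr/= -addrA {1}IH; congr (_ + _).
rewrite !exprS !exprMn.
by field; rewrite z0 zw.
Qed.

Lemma rect_int_sum n (G : nat -> R[i] -> R[i]) (l : nat -> R[i]) a b s t :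
  a <= b -> s <= t ->
  (forall k z, z != 0 -> cderivable (G k) z) ->
  on_sides a b s t (fun z => z != 0) ->
  rect_int (fun z => \sum_(k < n) l k * G k z) a b s t =
  \sum_(k < n) l k * rect_int (G k) a b s t.
Proof.
move=> ab st hG [h1 h2].
have cs (H : R[i] -> R[i]) : (forall z, z != 0 -> cderivable H z) ->
    cont_sides H a b s t.
  by move=> hH; apply: cont_sides_cderivable; split=> u hu; split; apply: hH;
    do [by case: (h1 u hu)|by case: (h2 u hu)].
have dS m z : z != 0 -> cderivable (fun z => \sum_(k < m) l k * G k z) z.
  move=> z0; elim: m => [|m IH].
    rewrite (_ : (fun _ => _) = fun=> 0); first exact: cderivable_cst.
    by apply/funext => u; rewrite big_ord0.
  rewrite (_ : (fun _ => _) = fun u => \sum_(k < m) l k * G k u + l m * G m u).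
    apply: cderivableD => //; apply: cderivableM; first exact: cderivable_cst.
    exact: hG.
  by apply/funext => u; rewrite big_ord_recr.
elim: n => [|n IH].
  rewrite big_ord0.
  rewrite (_ : (fun _ => _) = fun z => 0 + 0 * z); first exact: rect_int_affine.
  by apply/funext => z; rewrite big_ord0 mul0r addr0.
rewrite big_ord_recr/= -IH.
rewrite (_ : (fun _ => _) = fun z => \sum_(k < n) l k * G k z + l n * G n z).
  rewrite rect_intD ?rect_intZ//; apply: cs => z z0; do ?exact: dS.
    exact: hG.
  by apply: cderivableM; [exact: cderivable_cst|exact: hG].
by apply/funext => z; rewrite big_ord_recr.
Qed.

Lemma exp2V_small (K e : R) : 0 <= K -> 0 < e ->
  exists n0, forall n, (n0 <= n)%N -> K / 2 ^+ n <= e.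
Proof.
move=> K0 e0; exists (Num.trunc (K / e)).+1 => n hn.
rewrite ler_pdivrMr ?exprn_gt0// mulrC -ler_pdivrMr//.
rewrite (le_trans (ltW (truncnS_gt _)))// -natrX ler_nat.
by rewrite (leq_trans hn)// ltnW// ltn_expl.
Qed.

(** Expand the kernel of Cauchy's formula in a geometric series, whose ratio is at
    most [1/2] on the disc of radius [r / 2]. *)
Lemma taylor_on_half F (r : R) : 0 < r -> (forall z, cderivable F z) ->
  exists c, taylor_on F c (r / 2).
Proof.
move=> r0 hF.
set K := square (fun z => z^-1) r.
have K0 : K != 0 := square_inv_neq0 r0.
pose G k z := F z * z^-1 ^+ k.+1.
have dG k z : z != 0 -> cderivable (G k) z.
  move=> z0; apply: cderivableM; first exact: hF.
  by apply: cderivableX; apply: cderivableV => //; exact: cderivable_id.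
have [M M0 hM] := entire_bounded_on_disc (2 * r)
  (fun z => cderivable_ccontinuous (hF z)).
exists (fun k => K^-1 * square (G k) r) => e e0.
have nK : 0 < nc K by rewrite nc_gt0.
have [n0 hn0] := @exp2V_small (32 * M / nc K) e
  (divr_ge0 (mulr_ge0 (ler0n _ _) (ltW M0)) (ltW nK)) e0.
exists n0 => n /hn0 hn w wr.
have ne z : r <= nc z -> z != 0 /\ z - w != 0.
  by move=> hz; split; [rewrite -nc_gt0; lra|rewrite -nc_gt0;
    have := nc_le_sub r0 wr hz; lra].
have h1 := cauchy_square r0 wr hF.
rewrite (square_inv_const r0 wr) -/K in h1.
pose E z := F z * ((w / z) ^+ n / (z - w)).
have dE z : r <= nc z -> cderivable E z.
  move=> /ne[z0 zw]; apply: cderivableM; first exact: hF.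
  apply: cderivableM; last by apply: cderivable_inv_sub; rewrite -subr_eq0.
  apply: cderivableX; apply: cderivableM; first exact: cderivable_cst.
  by apply: cderivableV => //; exact: cderivable_id.
have rr : - r <= r by lra.
have S : square (fun z => F z / (z - w)) r =
    \sum_(k < n) w ^+ k * square (G k) r + square E r.
  rewrite -(@rect_int_sum n G (fun k => w ^+ k))//; last first.
    by apply: square_sides; [exact: ltW|move=> z /ne[]].
  rewrite -rect_intD; first last.
  - apply: cont_sides_cderivable; apply: square_sides; first exact: ltW.
    by move=> z hz _; exact: dE.
  - apply: cont_sides_cderivable; apply: square_sides; first exact: ltW.
    move=> z /ne[z0 _] _.
    have -> : (fun z => \sum_(k < n) w ^+ k * G k z) =
       (fun z => F z * (\poly_(k < n) w ^+ k).[z^-1] * z^-1).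
      apply/funext => u; rewrite horner_poly mulr_sumr mulr_suml.
      by apply: eq_bigr => k _; rewrite /G exprSr; ring.
    have dV : cderivable (fun z : R[i] => z^-1) z.
      by apply: cderivableV => //; exact: cderivable_id.
    apply: cderivableM => //; apply: cderivableM; first exact: hF.
    have [l hl] := cderivable_horner (\poly_(k < n) w ^+ k) z^-1.
    rewrite (_ : (fun _ => _) = fun z => \sum_(k < n) w ^+ k * z^-1 ^+ k).
      elim: (n) => [|m IH].
        rewrite (_ : (fun _ => _) = fun=> 0); first exact: cderivable_cst.
        by apply/funext => u; rewrite big_ord0.
      rewrite (_ : (fun _ => _) =
        fun u => \sum_(k < m) w ^+ k * u^-1 ^+ k + w ^+ m * u^-1 ^+ m).
        apply: cderivableD => //; apply: cderivableM; first exact: cderivable_cst.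
        exact: cderivableX.
      by apply/funext => u; rewrite big_ord_recr.
    by apply/funext => u; rewrite horner_poly.
  apply: eq_rect_int; apply: square_sides; first exact: ltW.
  move=> z /ne[z0 zw] _; rewrite (geometric_kernel n z0 zw) mulrDr; congr (_ + _).
  by rewrite mulr_sumr; apply: eq_bigr => k _; rewrite /G; ring.
have -> : F w - (trunc (fun k => K^-1 * square (G k) r) n).[w] = K^-1 * square E r.
  rewrite /trunc horner_poly.
  have -> : F w = K^-1 * square (fun z => F z / (z - w)) r.
    by rewrite h1; field.
  rewrite S mulrDr mulr_sumr addrAC -sumrB big1 ?add0r//.
  by move=> k _; ring.
rewrite ncM ncV mulrC.
have IE : nc (square E r) <= 4 * ((r - - r) + (r - - r)) * (M * (2 ^- n * (r / 2)^-1)).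
  apply: rect_int_le => //.
    apply: cont_sides_cderivable; apply: square_sides; first exact: ltW.
    by move=> z hz _; exact: dE.
  apply: square_sides; first exact: ltW.
  move=> z hz hz2; rewrite /E ncM; apply: ler_pM; rewrite ?nc_ge0//; first exact: hM.
  have z0 : 0 < nc z by lra.
  rewrite ncM ncX ncM !ncV; apply: ler_pM; rewrite ?exprn_ge0 ?invr_ge0 ?mulr_ge0
     ?invr_ge0 ?nc_ge0//.
    rewrite -exprVn lerXn2r ?nnegrE ?mulr_ge0 ?invr_ge0 ?nc_ge0//.
    by rewrite ler_pdivrMr//; lra.
  have H := nc_le_sub r0 wr hz.
  by rewrite lef_pV2 ?posrE//; lra.
apply: le_trans hn.
rewrite ler_pdivrMr// (le_trans IE)// le_eqVlt; apply/orP; left; apply/eqP.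
have p2 : (2 : R) ^+ n != 0 by rewrite expf_neq0// pnatr_eq0.
by field; rewrite ?p2 ?gt_eqF.
Qed.

Lemma taylor_onW F c r r' : r' <= r -> taylor_on F c r -> taylor_on F c r'.
Proof.
move=> rr h e e0; have [n0 hn0] := h _ e0; exists n0 => n /hn0 H z zr.
by apply: H; exact: le_trans rr.
Qed.

Lemma coef_trunc c n k : (trunc c n)`_k = if (k < n)%N then c k else 0.
Proof. by rewrite coef_poly. Qed.

(** The truncations are uniformly close to each other, so [poly_cauchy] makes their
    coefficients equal in the limit. *)
Lemma taylor_on_uniq F c c' r : 0 < r -> taylor_on F c r -> taylor_on F c' r ->
  c = c'.
Proof.
move=> r0 h h'; apply/funext => k; apply: nc_le0_eq => e e0.
have e2 : 0 < e * r ^+ k / 2 by rewrite divr_gt0// mulr_gt0// exprn_gt0.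
have [n0 hn] := h _ e2; have [n1 hn'] := h' _ e2.
set n := maxn k.+1 (maxn n0 n1).
have kn : (k < n)%N by rewrite leq_max leqnn.
have nn0 : (n0 <= n)%N by rewrite /n !leq_max leqnn orbT.
have nn1 : (n1 <= n)%N by rewrite /n !leq_max leqnn !orbT.
have := @poly_cauchy _ (trunc c n - trunc c' n) r (e * r ^+ k) k r0.
rewrite coefB !coef_trunc kn ler_pM2r ?exprn_gt0//; apply.
move=> z zr; rewrite hornerD hornerN.
have -> : (trunc c n).[z] - (trunc c' n).[z] =
  (F z - (trunc c' n).[z]) - (F z - (trunc c n).[z]) by ring.
rewrite (le_trans (ncB _ _))// (splitr (e * _)) lerD//.
  by apply: hn' => //; rewrite zr.
by apply: hn => //; rewrite zr.
Qed.

Lemma entire_taylor F : (forall z, cderivable F z) -> exists c, has_taylor F c.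
Proof.
move=> hF; have [c hc] := taylor_on_half (ltr0n _ 2 : (0 : R) < 2) hF.
exists c => r; set r' := Num.max r 1.
have r'1 : 1 <= r' by rewrite le_max lexx orbT.
have r'0 : 0 < 2 * r' by lra.
have [c' hc'] := taylor_on_half r'0 hF.
have e : 2 * r' / 2 = r' by field.
rewrite e in hc'.
have -> : c = c'.
  apply: (@taylor_on_uniq F c c' 1) => //.
    by apply: taylor_onW hc; lra.
  by apply: taylor_onW hc'.
by apply: taylor_onW hc'; rewrite le_max lexx.
Qed.

Lemma cauchy_estimate F c (r M : R) k : has_taylor F c -> 0 < r ->
  (forall z, nc z = r -> nc (F z) <= M) -> nc (c k) * r ^+ k <= M.
Proof.
move=> h r0 hM; apply/ler_addgt0Pr => e e0.
have [n0 hn] := h r _ e0; set n := maxn k.+1 n0.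
have kn : (k < n)%N by rewrite leq_max leqnn.
have := @poly_cauchy _ (trunc c n) r (M + e) k r0.
rewrite coef_trunc kn; apply => z zr.
have -> : (trunc c n).[z] = F z - (F z - (trunc c n).[z]) by ring.
rewrite (le_trans (ncB _ _))// lerD ?hM// hn ?zr//.
by rewrite leq_max leqnn orbT.
Qed.

Lemma geometric_tail c (r C : R) m n (z : R[i]) : 0 < r ->
  (forall k, nc (c k) * r ^+ k <= C) -> nc z <= r / 2 -> (m <= n)%N ->
  nc ((trunc c n).[z] - (trunc c m).[z]) <= 2 * C * (nc z / r) ^+ m.
Proof.
move=> r0 hC zr mn; set x := nc z / r.
have x0 : 0 <= x by rewrite divr_ge0 ?nc_ge0 ?ltW.
have x2 : x <= 2^-1 by rewrite /x ler_pdivrMr// mulrC.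
have C0 : 0 <= C by rewrite (le_trans _ (hC 0))// expr0 mulr1 nc_ge0.
have key d : nc ((trunc c (m + d)).[z] - (trunc c m).[z]) <=
    2 * C * x ^+ m * (1 - 2 ^- d).
  elim: d => [|d IH].
    by rewrite addn0 subrr nc0 expr0 invr1 subrr mulr0.
  have -> : (trunc c (m + d.+1)).[z] - (trunc c m).[z] =
     ((trunc c (m + d)).[z] - (trunc c m).[z]) + c (m + d)%N * z ^+ (m + d).
    by rewrite /trunc !horner_poly addnS big_ord_recr/=; ring.
  rewrite (le_trans (ncD _ _))//.
  have H : nc (c (m + d)%N * z ^+ (m + d)) <= C * (x ^+ m * 2 ^- d).
    have -> : nc (c (m + d)%N * z ^+ (m + d)) =
        nc (c (m + d)%N) * r ^+ (m + d) * x ^+ (m + d).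
      by rewrite ncM ncX -mulrA -exprMn /x mulrCA divff ?gt_eqF// mulr1.
    apply: ler_pM => //; rewrite ?mulr_ge0 ?nc_ge0 ?exprn_ge0 ?(ltW r0)//.
    rewrite exprD ler_wpM2l ?exprn_ge0// -exprVn lerXn2r ?nnegrE//.
  rewrite (le_trans (lerD IH H))// le_eqVlt; apply/orP; left; apply/eqP.
  have p3 : (2 : R) ^+ d != 0 by rewrite expf_neq0// pnatr_eq0.
  by rewrite exprS; field; rewrite ?p3.
rewrite -(subnKC mn) (le_trans (key _))//.
by rewrite ler_piMr// ?gerBl ?invr_ge0 ?exprn_ge0// ?mulr_ge0 ?exprn_ge0.
Qed.

Lemma taylor_tail F c (r C : R) m (z : R[i]) : has_taylor F c -> 0 < r ->
  (forall k, nc (c k) * r ^+ k <= C) -> nc z <= r / 2 ->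
  nc (F z - (trunc c m).[z]) <= 2 * C * (nc z / r) ^+ m.
Proof.
move=> hF r0 hC zr; apply/ler_addgt0Pr => e e0.
have [n0 hn] := hF (r / 2) _ e0; set n := maxn m n0.
have -> : F z - (trunc c m).[z] = (F z - (trunc c n).[z]) +
   ((trunc c n).[z] - (trunc c m).[z]) by ring.
rewrite (le_trans (ncD _ _))// addrC lerD//.
  by apply: (geometric_tail r0 hC zr); rewrite leq_max leqnn.
by apply: hn => //; rewrite leq_max leqnn orbT.
Qed.

Lemma power_series_entire c :
  (forall r : R, 0 < r -> exists C, forall k, nc (c k) * r ^+ k <= C) ->
  exists F, has_taylor F c.
Proof.
move=> hc.
have tail (r : R) : 0 < r -> exists2 C, 0 <= C & forall m n z,
    nc z <= r -> (m <= n)%N ->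
    nc ((trunc c n).[z] - (trunc c m).[z]) <= 2 * C / 2 ^+ m.
  move=> r0; have [|C hC] := hc (2 * r); first by rewrite mulr_gt0.
  exists C; first by rewrite (le_trans _ (hC 0))// expr0 mulr1 nc_ge0.
  move=> m n z zr mn.
  have r2 : 0 < 2 * r by rewrite mulr_gt0.
  have zr2 : nc z <= 2 * r / 2 by rewrite mulrAC divff ?mul1r.
  rewrite (le_trans (geometric_tail r2 hC zr2 mn))//.
  have C0 : 0 <= C by rewrite (le_trans _ (hC 0))// expr0 mulr1 nc_ge0.
  rewrite ler_wpM2l ?mulr_ge0// -exprVn lerXn2r ?nnegrE ?divr_ge0 ?nc_ge0 ?(ltW r2)//.
  by rewrite ler_pdivrMr//; lra.
have cv (z : R[i]) : exists l, forall e : R, 0 < e -> exists N, forall n,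
    (N <= n)%N -> nc ((trunc c n).[z] - l) <= e.
  apply: complex_cauchy => e e0.
  have z1 : 0 < nc z + 1 by rewrite ltr_wpDl ?nc_ge0.
  have [C C0 hC] := tail _ z1.
  have [N hN] := @exp2V_small (4 * C) e (mulr_ge0 (ler0n _ _) C0) e0.
  have zz : nc z <= nc z + 1 by rewrite lerDl.
  exists N => n m Nn Nm.
  have -> : (trunc c n).[z] - (trunc c m).[z] = ((trunc c n).[z] - (trunc c N).[z])
    - ((trunc c m).[z] - (trunc c N).[z]) by ring.
  rewrite (le_trans (ncB _ _))// (le_trans (lerD (hC _ _ _ zz Nn) (hC _ _ _ zz Nm)))//.
  by rewrite (le_trans _ (hN N (leqnn _)))// -mulrDl -mulrDl -natrD.
have [F hF] := choice cv.
exists F => r e e0; set r' := Num.max r 1.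
have r'0 : 0 < r' by rewrite lt_max ltr01 orbT.
have [C C0 hC] := tail _ r'0.
have [N hN] := @exp2V_small (2 * C) e (mulr_ge0 (ler0n _ _) C0) e0.
exists N => n Nn z zr; apply/ler_addgt0Pr => d d0.
have [N' hN'] := hF z _ d0; set m := maxn N' n.
have -> : F z - (trunc c n).[z] = ((trunc c m).[z] - (trunc c n).[z])
   - ((trunc c m).[z] - F z) by ring.
rewrite (le_trans (ncB _ _))// lerD//.
  rewrite (le_trans _ (hN _ Nn))//; apply: hC; last by rewrite leq_max leqnn orbT.
  by rewrite (le_trans zr)// le_max lexx.
by apply: hN'; rewrite leq_max leqnn.
Qed.

End Taylor.

(** * Power series are entire; maximum principle for quotients *)

Section MaxPrinciple.
Variable R : realType.
Implicit Types (F G H g : R[i] -> R[i]) (c : nat -> R[i]).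

(** The Taylor polynomials, recentred at [z0], have locally bounded second order
    remainders by [poly_cauchy], and their first coefficients converge. *)
Lemma has_taylor_cderivable F c : has_taylor F c -> forall z, cderivable F z.
Proof.
move=> hF z0.
pose P n := trunc c n; pose Q n := P n \Po ('X + z0%:P).
have QE n h : (Q n).[h] = (P n).[h + z0].
  by rewrite /Q horner_comp !hornerE.
set r := nc z0 + 1.
have hr h : nc h <= 1 -> nc (h + z0) <= r.
  by move=> h1; rewrite (le_trans (ncD _ _))// addrC lerD.
have [n0 hn0] := hF r 1 ltr01.
have [M M0 hM] := entire_bounded_on_disc r
  (fun z => cderivable_ccontinuous (cderivable_horner (P n0) z)).
pose B := M + 2.
have hB n h : (n0 <= n)%N -> nc h = 1 -> nc (Q n).[h] <= B.
  move=> nn h1; have hh := hr h (ltac:(rewrite h1 lexx//)).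
  rewrite QE.
  have -> : (P n).[h + z0] = (P n0).[h + z0] +
    ((F (h + z0) - (P n0).[h + z0]) - (F (h + z0) - (P n).[h + z0])) by ring.
  rewrite (le_trans (ncD _ _))// lerD ?hM// (le_trans (ncB _ _))//.
  by rewrite (_ : 2 = 1 + 1 :> R)// lerD// hn0.
have B0 : 0 <= B by rewrite /B addr_ge0// ltW.
have [l hl] : exists l, forall e : R, 0 < e -> exists N, forall n, (N <= n)%N ->
     nc ((Q n)`_1 - l) <= e.
  apply: complex_cauchy => e e0.
  have e2 : 0 < e / 2 by rewrite divr_gt0.
  have [N hN] := hF r _ e2; exists N => n m Nn Nm.
  have := @poly_cauchy _ (Q n - Q m) 1 e 1%N ltr01.
  rewrite expr1n mulr1 coefB; apply => h h1.
  have hh := hr h (ltac:(rewrite h1 lexx//)).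
  rewrite hornerD hornerN !QE.
  have -> : (P n).[h + z0] - (P m).[h + z0] =
    (F (h + z0) - (P m).[h + z0]) - (F (h + z0) - (P n).[h + z0]) by ring.
  by rewrite (le_trans (ncB _ _))// (splitr e) lerD// hN.
have key n h : (n0 <= n)%N -> nc h <= 1 / 2 ->
    nc ((Q n).[h] - (Q n).[0] - (Q n)`_1 * h) <= 2 * B * nc h ^+ 2.
  move=> nn hh.
  pose N := maxn 2 (size (Q n)).
  have E : Q n = trunc (fun k => (Q n)`_k) N.
    apply/polyP => k; rewrite coef_trunc; case: ltnP => //.
    by rewrite geq_max => /andP[_ h']; rewrite nth_default.
  have := @geometric_tail _ (fun k => (Q n)`_k) 1 B 2 N h ltr01 _ hh.
  rewrite divr1 -E => H.
  have {H} := H _ (leq_maxl _ _).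
  rewrite /trunc horner_poly !big_ord_recl big_ord0/= expr0 mulr1 expr1 addr0.
  rewrite horner_coef0 opprD addrA; apply => k.
  by apply: poly_cauchy => // z z1; exact: hB.
exists l => e e0; exists (Num.min (1 / 2) (e / (2 * B + 1))).
  by rewrite lt_min !divr_gt0// ltr_wpDl// mulr_ge0.
move=> w; rewrite le_min => /andP[w1 w2]; set h := w - z0 in w1 w2 *.
have lim : nc (F w - F z0 - l * h) <= 2 * B * nc h ^+ 2.
  apply/ler_addgt0Pr => d d0.
  have d3 : 0 < d / 3 by rewrite divr_gt0.
  have [n1 hn1] := hF r _ d3; have [n2 hn2] := hl _ d3.
  set n := maxn n0 (maxn n1 n2).
  have m0 : (n0 <= n)%N by rewrite leq_max leqnn.
  have m1 : (n1 <= n)%N by rewrite /n !leq_max leqnn orbT.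
  have m2 : (n2 <= n)%N by rewrite /n !leq_max leqnn !orbT.
  have h1 : nc h <= 1 by rewrite (le_trans w1)//; lra.
  have -> : F w - F z0 - l * h = ((Q n).[h] - (Q n).[0] - (Q n)`_1 * h) +
    ((F w - (P n).[w]) - (F z0 - (P n).[z0]) + ((Q n)`_1 - l) * h).
    by rewrite !QE add0r subrK; ring.
  rewrite (le_trans (ncD _ _))// lerD ?key//.
  have -> : d = d / 3 + d / 3 + d / 3 by field.
  rewrite (le_trans (ncD _ _))// lerD//.
    rewrite (le_trans (ncB _ _))// lerD// hn1//.
      by rewrite -(subrK z0 w) hr.
    by rewrite -(add0r z0) hr// nc0.
  by rewrite ncM -[d / 3]mulr1; apply: ler_pM; rewrite ?nc_ge0 ?hn2.
rewrite (le_trans lim)// expr2 mulrA ler_wpM2r ?nc_ge0//.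
apply: (@le_trans _ _ ((2 * B + 1) * nc h)).
  by rewrite ler_wpM2r ?nc_ge0// lerDl.
by rewrite mulrC -ler_pdivlMr// ltr_wpDl// mulr_ge0.
Qed.

Lemma taylor_eq0 F c : has_taylor F c -> (forall k, c k = 0) -> forall z, F z = 0.
Proof.
move=> hF c0 z; apply: nc_le0_eq => e e0; rewrite subr0.
have [n hn] := hF (nc z) _ e0.
have := hn n (leqnn _) z (lexx _); rewrite /trunc horner_poly big1 ?subr0//.
by move=> k _; rewrite c0 mul0r.
Qed.

(** At an interior maximum [z0] of [|g / H|], the entire function
    [g(z) H(z0) - g(z0) H(z)] vanishes; either it vanishes identically and the
    quotient is constant, or its leading term at [z0] can be aligned with
    [g(z0)] by moving in a suitable direction, which increases [|g / H|]. *)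
Lemma max_quotient (K : set R[i]) (M A : R) g H :
  (forall z, cderivable g z) -> (forall z, cderivable H z) ->
  (forall z, K z -> nc z <= M) ->
  (forall z, (forall d : R, 0 < d -> exists2 w, K w & nc (w - z) <= d) -> K z) ->
  (forall z, K z -> H z != 0) ->
  (forall z, K z -> nc (g z) <= A * nc (H z) \/
     exists2 d : R, 0 < d & forall w, nc (w - z) <= d -> K w) ->
  (exists2 z, K z & nc (g z) <= A * nc (H z)) ->
  forall z, K z -> nc (g z) <= A * nc (H z).
Proof.
move=> dg dH KM Kcl H0 hK [z1 Kz1 hz1].
have A0 : 0 <= A.
  have Hp : 0 < nc (H z1) by rewrite nc_gt0 H0.
  by rewrite -(ler_pM2r Hp) mul0r (le_trans _ hz1)// nc_ge0.
pose f z := nc (g z / H z).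
have fE z : K z -> (nc (g z) <= A * nc (H z)) = (f z <= A).
  by move=> Kz; rewrite /f ncM ncV ler_pdivrMr// nc_gt0 H0.
have [| | | |z0 Kz0 fz0] := @complex_EVT _ K M f.
- by exists z1.
- by [].
- by [].
- move=> z Kz; apply: ccontinuous_nc; apply: cderivable_ccontinuous.
  by apply: cderivableM => //; apply: cderivableV => //; exact: H0.
suff main : f z0 <= A by move=> z Kz; rewrite fE// (le_trans (fz0 z Kz)).
have [|[dl dl0 hdl]] := hK z0 Kz0; first by rewrite fE.
rewrite fE// in hz1.
have [q0|q0] := eqVneq (g z0) 0; first by rewrite /f q0 mul0r nc0.
set q := g z0 in q0; set h0 := H z0.
have h00 : h0 != 0 by exact: H0.
pose D z := g z * h0 - q * H z.
have dD z : cderivable D z.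
  by apply: cderivableB; apply: cderivableM => //; exact: cderivable_cst.
have [d hd] := entire_taylor (fun z => cderivable_shift (dD (z + z0))).
have [d0|] := pselect (forall k, d k = 0).
  have := taylor_eq0 hd d0 (z1 - z0); rewrite subrK /D => /eqP.
  rewrite subr_eq0 => /eqP E.
  rewrite (le_trans _ hz1)// /f le_eqVlt; apply/orP; left; apply/eqP; congr nc.
  have h1 := H0 _ Kz1.
  by apply/eqP; rewrite eqr_div// mulrC [H z1 * _]mulrC -/q -E mulrC.
move=> /existsNP[k0 /eqP dk0].
have exm : exists k, d k != 0 by exists k0.
set m := ex_minn exm.
have [dm dmin] : d m != 0 /\ forall k, (k < m)%N -> d k = 0.
  rewrite /m; case: ex_minnP => n nn hn; split=> // k kn.
  by apply/eqP; apply/negP => /negP /hn; rewrite leqNgt kn.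
have [C [hC C0]] : exists C, (forall k, nc (d k) * 1 ^+ k <= C) /\ 0 <= C.
  have [C C0 hC] := entire_bounded_on_disc 1
    (fun z => cderivable_ccontinuous (cderivable_shift (dD (z + z0)))).
  exists C; split; last exact: ltW.
  move=> k; apply: (@cauchy_estimate _ (fun u => D (u + z0)) d 1 C k hd ltr01).
  by move=> z z1'; apply: hC; rewrite z1'.
have tail h : nc h <= 1 / 2 -> nc (D (h + z0) - d m * h ^+ m) <= 2 * C * nc h ^+ m.+1.
  move=> hh; have := taylor_tail m.+1 hd ltr01 hC hh.
  rewrite divr1 /trunc horner_poly big_ord_recr/= big1 ?add0r//.
  by move=> k _; rewrite dmin ?mul0r.
have m0 : (0 < m)%N.
  rewrite lt0n; apply/negP => /eqP m0; move/eqP: dm; apply.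
  have := tail 0; rewrite nc0 m0 expr0 mulr1 add0r /D mulrC subrr sub0r ncN expr1 mulr0.
  move=> /(_ (ltac:(lra))) h; apply/eqP; rewrite -nc_eq0 eq_le nc_ge0 andbT//.
exfalso.
set a := q * h0 / d m.
have a0 : a != 0 by rewrite !mulf_neq0// invr_eq0.
pose eta := m.-root a.
have etaE : eta ^+ m = a by rewrite /eta rootCK.
have Hc := cderivable_ccontinuous (dH z0).
have nh : 0 < nc h0 by rewrite nc_gt0.
have nq : 0 < nc q by rewrite nc_gt0.
have e1 : 0 < nc h0 / 8 by rewrite divr_gt0.
have [d1 d10 hd1] := Hc _ e1.
set L := nc eta.
have L0 : 0 <= L by exact: nc_ge0.
pose s := Num.min (1 / (2 * (L + 1))) (Num.min (d1 / (L + 1)) (Num.min (dl / (L + 1))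
   (nc q * nc h0 / (8 * (C + 1) * (L + 1) ^+ m.+1)))).
have Lp : 0 < L + 1 by rewrite ltr_wpDl.
have Cp : 0 < C + 1 by rewrite ltr_wpDl.
have s0 : 0 < s.
  by rewrite !lt_min !divr_gt0 ?mulr_gt0 ?exprn_gt0.
have s1 : s <= 1 / (2 * (L + 1)) by rewrite ge_min lexx.
have s2 : s <= d1 / (L + 1) by rewrite !ge_min lexx orbT.
have s3 : s <= dl / (L + 1) by rewrite !ge_min lexx !orbT.
have s4 : s <= nc q * nc h0 / (8 * (C + 1) * (L + 1) ^+ m.+1).
  by rewrite !ge_min lexx !orbT.
pose h := s%:C * eta.
have nch : nc h = s * L by rewrite ncM nc_real gtr0_norm.
have hL : nc h <= s * (L + 1) by rewrite nch ler_wpM2l ?lerDl// ltW.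
have h1 : nc h <= 1 / 2.
  rewrite (le_trans hL)//; move: s1; rewrite ler_pdivlMr ?mulr_gt0//; lra.
have h2 : nc h <= d1 by rewrite (le_trans hL)// -ler_pdivlMr.
have h3 : nc h <= dl by rewrite (le_trans hL)// -ler_pdivlMr.
have Kz : K (h + z0) by apply: hdl; rewrite addrK.
have := fz0 _ Kz; apply/negP; rewrite -ltNge.
have Hz := H0 _ Kz; set hz := H (h + z0) in Hz *.
have Hzc : nc (hz - h0) <= nc h0 / 8 by apply: hd1; rewrite addrK.
have nhz : nc h0 / 2 <= nc hz.
  have := ncB_ge h0 (h0 - hz); have -> : h0 - (h0 - hz) = hz by ring.
  by rewrite nc_distC; move: Hzc; lra.
set E := D (h + z0) - d m * h ^+ m.
have hE : nc E <= 2 * C * nc h ^+ m.+1 by exact: tail.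
have sm : 0 < s ^+ m by rewrite exprn_gt0.
have hE2 : nc E <= s ^+ m * nc q * nc h0 / 4.
  rewrite (le_trans hE)//.
  apply: (@le_trans _ _ (2 * (C + 1) * (s * (L + 1)) ^+ m.+1)).
    apply: ler_pM; rewrite ?exprn_ge0 ?nc_ge0 ?mulr_ge0//; first lra.
    by rewrite lerXn2r ?nnegrE ?nc_ge0// (le_trans _ hL)// nc_ge0.
  rewrite exprMn exprS.
  have -> : 2 * (C + 1) * (s * s ^+ m * (L + 1) ^+ m.+1) =
     s ^+ m / 4 * (s * (8 * (C + 1) * (L + 1) ^+ m.+1)) by field.
  have -> : s ^+ m * nc q * nc h0 / 4 = s ^+ m / 4 * (nc q * nc h0) by ring.
  apply: ler_wpM2l; first by rewrite divr_ge0// ltW.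
  by rewrite -ler_pdivlMr// !mulr_gt0 ?exprn_gt0.
have gE : g (h + z0) / hz = (q * (1 + s%:C ^+ m) +
   (s%:C ^+ m * q * (h0 - hz) + E) / hz) / h0.
  have -> : g (h + z0) = (D (h + z0) + q * hz) / h0 by rewrite /D -/hz; field.
  have -> : D (h + z0) = s%:C ^+ m * q * h0 + E.
    rewrite /E /h exprMn etaE /a; field.
    by rewrite dm.
  by field; rewrite h00 Hz.
rewrite /f -/hz -/q -/h0 gE !ncM !ncV ltr_pM2r ?invr_gt0//.
have np : nc (1 + s%:C ^+ m) = 1 + s ^+ m.
  have -> : 1 + s%:C ^+ m = (1 + s ^+ m)%:C by rewrite rmorphD rmorphXn.
  by rewrite nc_real ger0_norm// addr_ge0// ltW.
apply: (lt_le_trans _ (ncD_ge _ _)); rewrite ncM np ncM ncV.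
have nE : nc (s%:C ^+ m * q * (h0 - hz) + E) <= s ^+ m * nc q * (nc h0 * 3 / 8).
  rewrite (le_trans (ncD _ _))//.
  have -> : s ^+ m * nc q * (nc h0 * 3 / 8) =
    s ^+ m * nc q * (nc h0 / 8) + s ^+ m * nc q * nc h0 / 4 by field.
  rewrite lerD// !ncM ncX nc_real (gtr0_norm s0) nc_distC.
  by apply: ler_wpM2l => //; rewrite mulr_ge0// ltW.
have : nc (s%:C ^+ m * q * (h0 - hz) + E) / nc hz <= s ^+ m * nc q * (3 / 4).
  have hzp : 0 < nc hz by rewrite nc_gt0.
  rewrite ler_pdivrMr// (le_trans nE)// -[_ * (3 / 4) * _]mulrA.
  apply: ler_wpM2l; first by rewrite mulr_ge0 ?ltW.
  by move: nhz; clear; lra.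
have : 0 < s ^+ m * nc q by rewrite mulr_gt0.
set Y := s ^+ m * nc q; set X := nc _ / nc hz.
have -> : nc q * (1 + s ^+ m) = nc q + Y by rewrite /Y; ring.
lra.
Qed.

End MaxPrinciple.

(** * The Phragmen-Lindelof principle in quadrants *)

Section PhragmenLindelof.
Variable R : realType.
Implicit Types (g : R[i] -> R[i]) (x y : R).

Lemma expR_pow_le (u : R) n : 0 <= u -> (0 < n)%N ->
  (1 + u / n%:R) ^+ n <= expR u.
Proof.
move=> u0 n0; have n0' : (n%:R : R) != 0 by rewrite pnatr_eq0 -lt0n.
have -> : expR u = expR (u / n%:R) ^+ n.
  by rewrite -expRM_natl mulrCA divff ?mulr1.
by rewrite lerXn2r ?nnegrE ?expR_ge0 ?expR_ge1Dx// addr_ge0// divr_ge0.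
Qed.

Lemma expR_pow_ge (u : R) n : 0 <= u -> (0 < n)%N ->
  expR (u - u ^+ 2 / n%:R) <= (1 + u / n%:R) ^+ n.
Proof.
move=> u0 n0; have n0' : (n%:R : R) != 0 by rewrite pnatr_eq0 -lt0n.
set v := u / n%:R.
have v0 : 0 <= v by rewrite divr_ge0.
have -> : u - u ^+ 2 / n%:R = n%:R * (v - v ^+ 2) by rewrite /v; field.
rewrite expRM_natl lerXn2r ?nnegrE ?expR_ge0 ?addr_ge0//.
have h := expR_ge1Dx (- (v - v ^+ 2)).
have p : 0 < 1 - v + v ^+ 2 by nra.
have : (expR (v - v ^+ 2))^-1 >= 1 - v + v ^+ 2.
  by rewrite -expRN; apply: le_trans h; lra.
move=> h'; have e0 := expR_gt0 (v - v ^+ 2).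
have h2 : (1 - v + v ^+ 2) * expR (v - v ^+ 2) <= 1.
  by rewrite -ler_pdivlMr// div1r.
rewrite -(ler_pM2l p) (le_trans h2)//.
have -> : (1 - v + v ^+ 2) * (1 + v) = 1 + v ^+ 3 by ring.
by rewrite lerDl exprn_ge0.
Qed.

Lemma expR1_le4 : expR (1 : R) <= 4.
Proof.
have h := expR_ge1Dx (- (2^-1) : R).
have e : (expR (2^-1 : R))^-1 >= 2^-1 by rewrite -expRN; apply: le_trans h; lra.
have e2 : expR (2^-1 : R) <= 2.
  by move: e; rewrite lef_pV2// ?posrE ?expR_gt0.
have -> : expR (1 : R) = expR (2^-1) ^+ 2.
  by rewrite -expRM_natl; congr expR; field.
have := expR_ge0 (2^-1 : R); nra.
Qed.

Section Quadrant.
Variables (s t : R).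
Hypotheses (s1 : s = 1 \/ s = -1) (t1 : t = 1 \/ t = -1).

Let cx (z : R[i]) := s * complex.Re z.
Let cy (z : R[i]) := t * complex.Im z.

Let fac1 (k : R) : {poly R[i]} := 1 - (Complex 0 (k * t))%:P * 'X.
Let fac2 (k : R) : {poly R[i]} := 1 - (Complex 0 (k * (s * t)))%:P * 'X^2.
Let fac3 : {poly R[i]} := 'X + (Complex 0 t)%:P.

Let fac1E k z : nc (fac1 k).[z] ^+ 2 = (1 + k * cy z) ^+ 2 + (k * cx z) ^+ 2.
Proof.
rewrite /fac1 !hornerE ncE2 /cx /cy; case: z => x y.
rewrite !(ReD, ImD, ReN, ImN, ReM, ImM)/=.
by case: s1 => ->; case: t1 => ->; ring.
Qed.

Let fac2E k z : nc (fac2 k).[z] ^+ 2 =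
  1 + 4 * k * (cx z * cy z) + k ^+ 2 * (cx z ^+ 2 + cy z ^+ 2) ^+ 2.
Proof.
have zz : z ^+ 2 = z * z by rewrite expr2.
rewrite ncE2 /fac2 !hornerE ?zz /cx /cy; case: z zz => x y _.
rewrite !(ReD, ImD, ReN, ImN, ReM, ImM)/=.
by case: s1 => ->; case: t1 => ->; ring.
Qed.

Let fac3E z : nc (fac3).[z] ^+ 2 = cx z ^+ 2 + (1 + cy z) ^+ 2.
Proof.
rewrite /fac3 !hornerE ncE2 /cx /cy; case: z => x y.
rewrite !(ReD, ImD)/=.
by case: s1 => ->; case: t1 => ->; ring.
Qed.

Let ncxy z : nc z ^+ 2 = cx z ^+ 2 + cy z ^+ 2.
Proof. by rewrite ncE2 /cx /cy; case: s1 => ->; case: t1 => ->; ring. Qed.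

Let cx_lip z w : `|cx w - cx z| <= nc (w - z).
Proof.
rewrite /cx -mulrBr normrM; have -> : `|s| = 1.
  by case: s1 => ->; rewrite ?normrN normr1.
by rewrite mul1r -ReN -ReD Re_le_nc.
Qed.

Let cy_lip z w : `|cy w - cy z| <= nc (w - z).
Proof.
rewrite /cy -mulrBr normrM; have -> : `|t| = 1.
  by case: t1 => ->; rewrite ?normrN normr1.
by rewrite mul1r -ImN -ImD Im_le_nc.
Qed.

Let ge_sq (a b : R) : 0 <= b -> a ^+ 2 <= b ^+ 2 -> a <= b.
Proof.
move=> b0; have [a0|a0] := leP 0 a; last by move=> _; exact: le_trans (ltW a0) b0.
by rewrite ler_pXn2r// ?nnegrE.
Qed.

Let sq_le (a b : R) : 0 <= a -> a <= b -> a ^+ 2 <= b ^+ 2.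
Proof. by move=> a0 ab; rewrite lerXn2r// nnegrE// (le_trans a0). Qed.

(** The comparison function [(1 - i tau t z / m)^m (1 - i s t z^2 / r^2)^(4k)
    (z + i t)^L] is a polynomial. Its first factor tends to [exp (- i tau t z)],
    the second one is of modulus at least [1] in the quadrant and at least
    [2^(2k)] on the far sides of the square, and yet tends to [1] at each fixed
    [z] when [k] is of order [r] and [r] grows. *)
Lemma quadrant_growth g (tau C : R) L : (forall z, cderivable g z) ->
  0 <= tau -> 0 <= C ->
  (forall z, nc (g z) <= C * expR (tau * nc z)) ->
  (forall x : R, nc (g x%:C) <= C * (1 + `|x|) ^+ L) ->
  forall z, 0 <= cx z -> 0 <= cy z ->
  nc (g z) <= C * (2 ^+ L + 5) * 16 * (1 + nc z) ^+ L * expR (tau * cy z).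
Proof.
move=> dg tau0 C0 hg hgx z0 x0 y0.
set r : R := 1 + nc z0 + (8 * tau + 4) * nc z0 ^+ 2.
have r1 : 1 <= r.
  by rewrite /r -addrA lerDl addr_ge0 ?nc_ge0// mulr_ge0 ?sqr_ge0//; lra.
have r0 : 0 < r by lra.
have rz : nc z0 <= r.
  rewrite /r addrAC lerDr addr_ge0// mulr_ge0 ?sqr_ge0//; lra.
set k := (Num.trunc (2 * tau * r)).+1.
have kr : 2 * tau * r <= k%:R by rewrite ltW// truncnS_gt.
have kr' : k%:R <= 2 * tau * r + 1.
  have := truncn_le (2 * tau * r); rewrite !mulr_ge0 ?(ltW r0)// => h.
  by rewrite /k -natr1 lerD2r h.
set m := (Num.trunc ((tau * r) ^+ 2)).+1.
have mr : (tau * r) ^+ 2 <= m%:R by rewrite ltW// truncnS_gt.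
have m0 : (0 : R) < m%:R by rewrite ltr0n.
set H : {poly R[i]} := (fac1 (tau / m%:R)) ^+ m * (fac2 (r ^- 2)) ^+ (4 * k) * fac3 ^+ L.
have HE z : nc H.[z] = nc (fac1 (tau / m%:R)).[z] ^+ m *
   nc (fac2 (r ^- 2)).[z] ^+ (4 * k) * nc fac3.[z] ^+ L.
  by rewrite /H !hornerM !horner_exp !ncM !ncX.
pose K := [set z | [/\ 0 <= cx z, cx z <= r, 0 <= cy z & cy z <= r]].
have k0 : 0 <= tau / m%:R by rewrite divr_ge0// ltW.
have low1 z : K z -> 1 + tau / m%:R * cy z <= nc (fac1 (tau / m%:R)).[z].
  move=> [? ? ? ?]; apply: ge_sq; first exact: nc_ge0.
  by rewrite fac1E lerDl sqr_ge0.
have low1' z : K z -> 1 <= nc (fac1 (tau / m%:R)).[z].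
  by move=> Kz; rewrite (le_trans _ (low1 z Kz))// lerDl mulr_ge0//; case: Kz.
have rr0 : 0 <= r ^- 2 by rewrite invr_ge0 exprn_ge0// ltW.
have low2 z : K z -> 1 <= nc (fac2 (r ^- 2)).[z].
  move=> [? ? ? ?]; apply: ge_sq; first exact: nc_ge0.
  rewrite fac2E expr1n -addrA lerDl addr_ge0//.
    by apply: mulr_ge0; [rewrite mulr_ge0|exact: mulr_ge0].
  by rewrite mulr_ge0 ?sqr_ge0.
have low3 z : K z -> 1 <= nc fac3.[z].
  move=> [? ? ? ?]; apply: ge_sq; first exact: nc_ge0.
  by rewrite fac3E expr1n; nra.
have Kcl z : (forall d : R, 0 < d -> exists2 w, K w & nc (w - z) <= d) -> K z.
  move=> hz; have lim (f : R[i] -> R) (b : R) :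
      (forall w, `|f w - f z| <= nc (w - z)) -> (forall w, K w -> f w <= b) -> f z <= b.
    move=> fl fb; apply/ler_addgt0Pr => d d0; have [w Kw wz] := hz _ d0.
    have := le_trans (fl w) wz; rewrite ler_norml => /andP[h _].
    by have := fb w Kw; lra.
  have nl (f : R[i] -> R) : (forall w, `|f w - f z| <= nc (w - z)) ->
      forall w, `|- f w - - f z| <= nc (w - z).
    by move=> h w; rewrite -opprD normrN.
  split.
  - by rewrite -oppr_le0; apply: (lim (fun w => - cx w)) => [|w []];
      [apply: nl => w; exact: cx_lip|rewrite oppr_le0].
  - by apply: (lim cx) => [w|w []]; [exact: cx_lip|].
  - by rewrite -oppr_le0; apply: (lim (fun w => - cy w)) => [|w []];
      [apply: nl => w; exact: cy_lip|rewrite oppr_le0].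
  - by apply: (lim cy) => [w|w []]; [exact: cy_lip|].
set A := C * (2 ^+ L + 5).
have A5 : C * 4 <= A.
  by rewrite ler_wpM2l//; have : (0 : R) <= 2 ^+ L by [rewrite exprn_ge0]; lra.
have bd z : K z -> [\/ cx z = 0, cy z = 0, cx z = r | cy z = r] ->
    nc (g z) <= A * nc H.[z].
  move=> Kz; have [X0 Xr Y0 Yr] := Kz.
  have h1 : 1 <= nc (fac1 (tau / m%:R)).[z] ^+ m by rewrite exprn_ege1// low1'.
  have h2 : 1 <= nc (fac2 (r ^- 2)).[z] ^+ (4 * k) by rewrite exprn_ege1// low2.
  have h3 : 1 <= nc fac3.[z] ^+ L by rewrite exprn_ege1// low3.
  have far : (cx z = r \/ cy z = r) -> nc (g z) <= A * nc H.[z].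
    move=> hr.
    have f2 : 2 <= nc (fac2 (r ^- 2)).[z] ^+ 2.
      rewrite fac2E -addrA (_ : 2 = 1 + 1 :> R)// lerD2l.
      apply: (@le_trans _ _ ((r ^- 2) ^+ 2 * (r ^+ 2) ^+ 2)).
        by rewrite -exprMn mulVf ?expr1n// expf_neq0// gt_eqF.
      rewrite ler_wpDl//.
        by apply: mulr_ge0; [rewrite mulr_ge0|exact: mulr_ge0].
      rewrite ler_wpM2l ?exprn_ge0//.
      rewrite lerXn2r ?nnegrE ?addr_ge0 ?sqr_ge0//.
      by case: hr => ->; rewrite ?lerDl ?lerDr sqr_ge0.
    have z2 : nc z <= 2 * r.
      apply: ge_sq; first by lra.
      by rewrite ncxy; nra.
    rewrite (le_trans (hg z))//.
    apply: (@le_trans _ _ (C * expR k%:R)).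
      by rewrite ler_wpM2l// ler_expR (le_trans _ kr)//; nra.
    apply: (@le_trans _ _ (C * 4 ^+ k)).
      rewrite ler_wpM2l// -[k%:R]mulr1 expRM_natl lerXn2r ?nnegrE ?expR_ge0//.
      exact: expR1_le4.
    apply: (@le_trans _ _ (A * 4 ^+ k)).
      rewrite ler_wpM2r ?exprn_ge0// (le_trans _ A5)//; lra.
    rewrite ler_wpM2l//; first by lra.
    have f4 : 4 ^+ k <= nc (fac2 (r ^- 2)).[z] ^+ (4 * k).
      rewrite exprM lerXn2r ?nnegrE ?exprn_ge0 ?nc_ge0//.
      rewrite (exprM _ 2 2); nra.
    rewrite HE (le_trans f4)// -mulrA mulrCA ler_peMr ?exprn_ge0 ?nc_ge0//.
    by rewrite (le_trans h1)// ler_peMr// (le_trans _ h1).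
  case=> hz; [| |exact: far (or_introl hz)|exact: far (or_intror hz)].
    (* the imaginary half-axis: here only the exponential type is available *)
    rewrite (le_trans (hg z))//.
    have zy : nc z = cy z.
      by apply/eqP; rewrite -(@eqrXn2 _ 2)// ?nc_ge0// ncxy hz expr0n add0r.
    rewrite zy HE.
    have ty : 0 <= tau * cy z by rewrite mulr_ge0.
    have m0n : (0 < m)%N by [].
    have := expR_pow_ge ty m0n.
    have tm : (tau * cy z) ^+ 2 / m%:R <= 1.
      rewrite ler_pdivrMr// mul1r (le_trans _ mr)//.
    by apply: sq_le; [exact: mulr_ge0|exact: ler_wpM2l].
    move=> hh; have hh' : expR (tau * cy z) <= 4 * nc (fac1 (tau / m%:R)).[z] ^+ m.
      apply: (@le_trans _ _ (expR 1 * expR (tau * cy z - (tau * cy z) ^+ 2 / m%:R))).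
        by rewrite -expRD ler_expR; lra.
      apply: ler_pM; rewrite ?expR_ge0 ?expR1_le4//.
      rewrite (le_trans hh)// lerXn2r ?nnegrE ?nc_ge0 ?addr_ge0 ?divr_ge0 ?(ltW m0)//.
      by rewrite (le_trans _ (low1 z Kz))// mulrAC.
    apply: (@le_trans _ _ (C * 4 * nc (fac1 (tau / m%:R)).[z] ^+ m)).
      by rewrite -mulrA ler_wpM2l.
    have a0 : 0 <= nc (fac1 (tau / m%:R)).[z] ^+ m by rewrite exprn_ge0// nc_ge0.
    apply: (le_trans (ler_wpM2r a0 A5)); apply: ler_wpM2l; first by lra.
    by rewrite -mulrA ler_peMr// mulr_ege1.
  (* the real half-axis *)
  have zx : z = (complex.Re z)%:C.
    apply: complex_ext => //=; move: hz; rewrite /cy.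
    by case: t1 => -> /eqP; rewrite ?mulN1r ?mul1r ?oppr_eq0 => /eqP.
  have nx : `|complex.Re z| = cx z.
    rewrite -(ger0_norm X0) /cx normrM.
    by case: s1 => ->; rewrite ?normrN normr1 mul1r.
  have := hgx (complex.Re z); rewrite -zx nx => H1.
  rewrite (le_trans H1)//.
  apply: (@le_trans _ _ (C * (2 ^+ L * nc fac3.[z] ^+ L))).
    rewrite ler_wpM2l// -exprMn lerXn2r ?nnegrE ?mulr_ge0 ?nc_ge0 ?addr_ge0//.
    have : ((1 + cx z) / 2) <= nc fac3.[z].
      apply: ge_sq; first exact: nc_ge0.
      by rewrite fac3E hz; nra.
    by lra.
  rewrite mulrA; apply: ler_pM; rewrite ?mulr_ge0 ?exprn_ge0 ?nc_ge0//.
    by rewrite ler_wpM2l// lerDl.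
  by rewrite HE ler_peMl ?exprn_ge0 ?nc_ge0// mulr_ege1.
have main : forall z, K z -> nc (g z) <= A * nc H.[z].
  apply: (@max_quotient _ K (2 * r) A g (fun z => H.[z])) => //.
  - exact: cderivable_horner.
  - move=> z [X0 Xr Y0 Yr]; apply: ge_sq; first by lra.
    by rewrite ncxy; nra.
  - move=> z Kz; rewrite -nc_gt0 HE !mulr_gt0// exprn_gt0//.
    + exact: lt_le_trans (low1' z Kz).
    + exact: lt_le_trans (low2 z Kz).
    + exact: lt_le_trans (low3 z Kz).
  - move=> z Kz; have [X0 Xr Y0 Yr] := Kz.
    have [e1|n1] := eqVneq (cx z) 0; first by left; apply: bd => //; constructor 1.
    have [e2|n2] := eqVneq (cy z) 0; first by left; apply: bd => //; constructor 2.
    have [e3|n3] := eqVneq (cx z) r; first by left; apply: bd => //; constructor 3.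
    have [e4|n4] := eqVneq (cy z) r; first by left; apply: bd => //; constructor 4.
    right.
    have p1 : 0 < cx z by rewrite lt_def n1.
    have p2 : 0 < cy z by rewrite lt_def n2.
    have p3 : cx z < r by rewrite lt_def eq_sym n3.
    have p4 : cy z < r by rewrite lt_def eq_sym n4.
    exists (Num.min (Num.min (cx z) (cy z)) (Num.min (r - cx z) (r - cy z))).
      by rewrite !lt_min p1 p2 !subr_gt0 p3 p4.
    move=> w; rewrite !le_min => /andP[/andP[w1 w2] /andP[w3 w4]].
    have := cx_lip z w; have := cy_lip z w; rewrite !ler_norml.
    by move=> /andP[u1 u2] /andP[u3 u4]; split;
      clear -w1 w2 w3 w4 u1 u2 u3 u4; lra.
  - exists 0; last by apply: bd; [split|constructor 1]; rewrite /cx /cy/= mulr0// ltW.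
    by split; rewrite /cx /cy/= mulr0// ltW.
have Kz0 : K z0.
  split=> //; rewrite (le_trans _ rz)//; apply: ge_sq; rewrite ?nc_ge0// ncxy.
    by rewrite lerDl sqr_ge0.
  by rewrite lerDr sqr_ge0.
apply: (le_trans (main z0 Kz0)).
have [X0 Xr Y0 Yr] := Kz0.
rewrite -/A -!mulrA; apply: ler_wpM2l; first by lra.
apply: ler_wpM2l; first by rewrite addr_ge0 ?exprn_ge0.
rewrite HE.
have up1 : nc (fac1 (tau / m%:R)).[z0] ^+ m <= 4 * expR (tau * cy z0).
  set u := tau * cy z0 + (tau * cx z0) ^+ 2 / m%:R.
  have tx : (tau * cx z0) ^+ 2 / m%:R <= 1.
    rewrite ler_pdivrMr// mul1r (le_trans _ mr)//.
    by apply: sq_le; [exact: mulr_ge0|exact: ler_wpM2l].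
  have tx0 : 0 <= (tau * cx z0) ^+ 2 / m%:R by rewrite divr_ge0 ?sqr_ge0.
  have u0 : 0 <= u by rewrite addr_ge0// mulr_ge0.
  apply: (@le_trans _ _ ((1 + u / m%:R) ^+ m)).
    rewrite lerXn2r ?nnegrE ?nc_ge0 ?addr_ge0 ?divr_ge0 ?(ltW m0)//.
    apply: ge_sq; first by rewrite addr_ge0 ?divr_ge0// ltW.
    rewrite fac1E.
    have -> : 1 + u / m%:R = (1 + tau / m%:R * cy z0) + (tau / m%:R * cx z0) ^+ 2.
      by rewrite /u; field; rewrite gt_eqF.
    set a := _ * cy z0; set b := (_ * cx z0) ^+ 2.
    have a0 : 0 <= a by rewrite mulr_ge0.
    have b0 : 0 <= b by rewrite sqr_ge0.
    by nra.
  rewrite (le_trans (expR_pow_le u0 _))//.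
  apply: (@le_trans _ _ (expR (1 + tau * cy z0))).
    by rewrite ler_expR /u; lra.
  by rewrite expRD ler_wpM2r ?expR_ge0// expR1_le4.
have up2 : nc (fac2 (r ^- 2)).[z0] ^+ (4 * k) <= 4.
  have k4 : (0 < 4 * k)%N by rewrite muln_gt0.
  set u := (4 * k)%:R * (nc z0 ^+ 2 / r ^+ 2).
  have k4R : ((4 * k)%:R : R) != 0 by rewrite pnatr_eq0 -lt0n.
  have v0 : 0 <= nc z0 ^+ 2 / r ^+ 2 by rewrite divr_ge0// sqr_ge0.
  have u0 : 0 <= u by rewrite mulr_ge0.
  apply: (@le_trans _ _ ((1 + u / (4 * k)%:R) ^+ (4 * k))).
    have -> : u / (4 * k)%:R = nc z0 ^+ 2 / r ^+ 2 by rewrite /u mulrC mulKf.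
    rewrite lerXn2r ?nnegrE ?nc_ge0 ?addr_ge0//.
    apply: ge_sq; first by rewrite addr_ge0.
    rewrite fac2E ncxy.
    have am (a b q : R) : 0 <= q ->
        1 + 4 * q * (a * b) + q ^+ 2 * (a ^+ 2 + b ^+ 2) ^+ 2 <=
        (1 + (a ^+ 2 + b ^+ 2) * q) ^+ 2.
      move=> q0; rewrite -subr_ge0.
      have -> : (1 + (a ^+ 2 + b ^+ 2) * q) ^+ 2 -
          (1 + 4 * q * (a * b) + q ^+ 2 * (a ^+ 2 + b ^+ 2) ^+ 2) =
          2 * q * (a - b) ^+ 2 by ring.
      by rewrite mulr_ge0 ?sqr_ge0// mulr_ge0.
    exact: am.
  rewrite (le_trans (expR_pow_le u0 k4))// (le_trans _ expR1_le4)// ler_expR.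
  rewrite /u mulrA ler_pdivrMr ?exprn_gt0// mul1r natrM.
  have : 4 * k%:R <= (8 * tau + 4) * r by nra.
  have : (8 * tau + 4) * nc z0 ^+ 2 <= r by rewrite /r; have := nc_ge0 z0; lra.
  have : 0 <= nc z0 ^+ 2 by rewrite sqr_ge0.
  set Z := nc z0 ^+ 2; set T := 8 * tau + 4; move=> Z0 h5 h6.
  rewrite (le_trans (ler_wpM2r Z0 h6))// mulrAC expr2.
  by rewrite ler_wpM2r// ltW.
have up3 : nc fac3.[z0] ^+ L <= (1 + nc z0) ^+ L.
  rewrite lerXn2r ?nnegrE ?nc_ge0 ?addr_ge0 ?nc_ge0//.
  apply: ge_sq; first by rewrite addr_ge0 ?nc_ge0.
  rewrite fac3E; have := ncxy z0.
  have : cy z0 <= nc z0.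
    by apply: ge_sq; rewrite ?nc_ge0// ncxy lerDr sqr_ge0.
  by nra.
have -> : 16 * ((1 + nc z0) ^+ L * expR (tau * cy z0)) =
  4 * expR (tau * cy z0) * 4 * (1 + nc z0) ^+ L by ring.
by apply: ler_pM; rewrite ?mulr_ge0 ?exprn_ge0 ?nc_ge0//; apply: ler_pM;
  rewrite ?exprn_ge0 ?nc_ge0.
Qed.

End Quadrant.

(** Polynomial growth on the real axis and exponential type [tau] give growth
    [exp (tau |Im z|)] up to a polynomial factor, uniformly in [Re z]. *)
Lemma phragmen_lindelof g (tau C : R) L : (forall z, cderivable g z) ->
  0 <= tau -> 0 <= C ->
  (forall z, nc (g z) <= C * expR (tau * nc z)) ->
  (forall x : R, nc (g x%:C) <= C * (1 + `|x|) ^+ L) ->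
  forall z, nc (g z) <=
    C * (2 ^+ L + 5) * 16 * (1 + nc z) ^+ L * expR (tau * `|complex.Im z|).
Proof.
move=> dg tau0 C0 hg hgx z.
have sg (u : R) : exists2 s, s = 1 \/ s = -1 & s * u = `|u|.
  have [u0|u0] := leP 0 u; first by exists 1; [left|rewrite mul1r ger0_norm].
  by exists (-1); [right|rewrite mulN1r ltr0_norm].
have [s s1 sE] := sg (complex.Re z); have [t t1 tE] := sg (complex.Im z).
have := @quadrant_growth s t s1 t1 g tau C L dg tau0 C0 hg hgx z.
by rewrite sE tE; apply.
Qed.

End PhragmenLindelof.

(** * Polynomials on an interval via the Joukowski map *)

Section Joukowski.
Variable R : realType.
Implicit Types (P Q B : {poly R[i]}) (z w : R[i]) (x : R).

Definition jouk z : R[i] := (z + z^-1) / 2.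

Lemma joukV z : jouk z^-1 = jouk z.
Proof. by rewrite /jouk invrK addrC. Qed.

Fixpoint cheb_pair k : {poly R[i]} * {poly R[i]} :=
  if k is k'.+1 then
    let: (a, b) := cheb_pair k' in (b, 2 *: ('X * b) - a)
  else (1, 'X).

Definition cheb k := (cheb_pair k).1.

Lemma chebS k : cheb k.+2 = 2 *: ('X * cheb k.+1) - cheb k.
Proof. by rewrite /cheb /=; case: (cheb_pair k). Qed.

Lemma cheb_ind (A : nat -> {poly R[i]} -> Prop) : A 0 1 -> A 1 'X ->
  (forall k, A k (cheb k) -> A k.+1 (cheb k.+1) -> A k.+2 (cheb k.+2)) ->
  forall k, A k (cheb k).
Proof.
move=> h0 h1 hS k; suff : A k (cheb k) /\ A k.+1 (cheb k.+1) by case.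
by elim: k => [|k [IH1 IH2]]; split => //; exact: hS.
Qed.

Lemma cheb_jouk k z : z != 0 -> (cheb k).[jouk z] = (z ^+ k + z^-1 ^+ k) / 2.
Proof.
move=> z0; apply: (@cheb_ind (fun k T => T.[jouk z] = (z ^+ k + z^-1 ^+ k) / 2)) => {k}.
- by rewrite !expr0 hornerE; field.
- by rewrite !expr1 hornerX.
- move=> k IH1 IH2; rewrite chebS hornerD hornerN hornerZ hornerM hornerX IH1 IH2.
  rewrite /jouk !exprS !exprVn; field.
  by rewrite z0 expf_neq0.
Qed.

Lemma cheb_size k : (size (cheb k) <= k.+1)%N /\ (cheb k)`_k != 0.
Proof.
apply: (@cheb_ind (fun k T => (size T <= k.+1)%N /\ T`_k != 0)) => {k}.
- by rewrite size_poly1 coef1 oner_neq0.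
- by rewrite size_polyX coefX oner_neq0.
- move=> k [s1 c1] [s2 c2]; split.
    rewrite chebS (leq_trans (size_polyD _ _))// geq_max size_polyN.
    rewrite (leq_trans s1) ?andbT; last by rewrite ltnS leqW.
    rewrite (leq_trans (size_scale_leq _ _))//.
    by rewrite (leq_trans (size_polyMleq _ _))// size_polyX.
  rewrite chebS coefB coefZ coefXM/= [X in _ - X]nth_default ?(leq_trans s1)//.
  by rewrite subr0 mulf_neq0// pnatr_eq0.
Qed.

Lemma cheb_expansion n Q : (size Q <= n.+1)%N ->
  exists b : nat -> R[i], Q = \sum_(k < n.+1) b k *: cheb k.
Proof.
elim: n Q => [|n IH] Q sQ.
  exists (fun=> Q`_0); rewrite big_ord1 {1}(size1_polyC sQ) alg_polyC//.
have [s c] := cheb_size n.+1.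
set q := Q`_n.+1 / (cheb n.+1)`_n.+1.
have [|b hb] := IH (Q - q *: cheb n.+1).
  apply/leq_sizeP => j nj; rewrite coefB coefZ.
  have [->|jn] := eqVneq j n.+1; first by rewrite /q divfK// subrr.
  have jn2 : (n.+2 <= j)%N by rewrite ltn_neqAle eq_sym jn.
  by rewrite !nth_default ?mulr0 ?subr0//; [exact: leq_trans s jn2|exact: leq_trans sQ jn2].
exists (fun k => if k == n.+1 then q else b k).
rewrite big_ord_recr/= eqxx -[LHS](subrK (q *: cheb n.+1)) hb; congr (_ + _).
by apply: eq_bigr => k _; rewrite ltn_eqF.
Qed.

(** [z^n Q((z + 1/z) / 2)] is a palindromic polynomial whose upper coefficients
    are half the Chebyshev coefficients of [Q]. *)
Lemma jouk_lift n Q : (size Q <= n.+1)%N ->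
  exists (b : nat -> R[i]) B,
  [/\ Q = \sum_(k < n.+1) b k *: cheb k,
      forall z, z != 0 -> B.[z] = z ^+ n * Q.[jouk z] &
      forall k, (0 < k <= n)%N -> B`_(n + k) = b k / 2].
Proof.
move=> /cheb_expansion[b hb].
exists b, (\sum_(k < n.+1) (b k / 2) *: ('X^(n + k) + 'X^(n - k))); split=> //.
  move=> z z0; rewrite {1}hb !horner_sum mulr_sumr; apply: eq_bigr => k _.
  have kn : (k <= n)%N by rewrite -ltnS.
  rewrite !hornerZ hornerD !hornerXn cheb_jouk//; move: (nat_of_ord k) kn => j jn.
  have zn : z ^+ n = z ^+ (n - j) * z ^+ j by rewrite -exprD subnK.
  by rewrite exprD zn exprVn; field; rewrite expf_neq0.
move=> k /andP[k0 kn]; rewrite coef_sum.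
rewrite (bigD1 (Ordinal (_ : k < n.+1)%N))//= coefZ coefD !coefXn eqxx.
have -> : (n + k == n - k)%N = false.
  by apply/negbTE; rewrite neq_ltn; apply/orP; right; lia.
rewrite addr0 mulr1 big1 ?addr0// => i ik.
rewrite coefZ coefD !coefXn eqn_add2l.
have -> : (k == i)%N = false by apply/negbTE; rewrite eq_sym.
have -> : (n + k == n - i)%N = false.
  by apply/negbTE; rewrite neq_ltn; apply/orP; right; lia.
by rewrite addr0 mulr0.
Qed.

(** [poly_cauchy] applied to the lifted polynomial of [jouk_lift]. *)
Lemma cheb_coef_bound n Q (rho G : R) : 0 < rho -> (size Q <= n.+1)%N ->
  (forall z, nc z = rho -> nc Q.[jouk z] <= G) ->
  exists2 b : nat -> R[i], Q = \sum_(k < n.+1) b k *: cheb k &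
    forall k, (0 < k <= n)%N -> nc (b k) * rho ^+ k <= 2 * G.
Proof.
move=> r0 sQ hG; have [b [B [hb hB hBk]]] := jouk_lift sQ.
exists b => // k kn.
have := @poly_cauchy _ B rho (rho ^+ n * G) (n + k) r0.
rewrite hBk// ncM ncV nc_nat => H.
have {}H : nc (b k) / 2 * rho ^+ (n + k) <= rho ^+ n * G.
  apply: H => z zr; rewrite hB; last by rewrite -nc_gt0 zr.
  by rewrite ncM ncX zr ler_wpM2l ?hG// exprn_ge0// ltW.
have rn : 0 < rho ^+ n by rewrite exprn_gt0.
rewrite -(ler_pM2l rn).
by move: H; rewrite exprD; set x := nc _; set y := rho ^+ k; set u := rho ^+ n; lra.
Qed.

Lemma jouk_circle x : -1 <= x <= 1 ->
  exists2 z, nc z = 1 & jouk z = x%:C.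
Proof.
move=> /andP[x1 x2].
have h : 0 <= 1 - x ^+ 2 by nra.
exists (x +i* Num.sqrt (1 - x ^+ 2)).
  apply/eqP; rewrite -(@eqrXn2 _ 2)// ?nc_ge0// ncE2/= sqr_sqrtr// expr1n.
  by rewrite addrC subrK.
have e : (x +i* Num.sqrt (1 - x ^+ 2))^-1 = x -i* Num.sqrt (1 - x ^+ 2).
  rewrite -[LHS]/((x / (x ^+ 2 + Num.sqrt (1 - x ^+ 2) ^+ 2)) -i*
   (Num.sqrt (1 - x ^+ 2) / (x ^+ 2 + Num.sqrt (1 - x ^+ 2) ^+ 2))).
  by rewrite sqr_sqrtr// addrC subrK !divr1.
have {}e : (x +i* Num.sqrt (1 - x ^+ 2)) + (x +i* Num.sqrt (1 - x ^+ 2))^-1 =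
    x%:C + x%:C.
  by rewrite e; apply: complex_ext; rewrite ?ReD ?ImD/= ?subrr ?addr0.
by rewrite /jouk e; field.
Qed.

Lemma unit_circleV z : nc z = 1 -> z^-1 = (complex.Re z) -i* (complex.Im z).
Proof.
case: z => a b z1.
have : nc (a +i* b) ^+ 2 = 1 by rewrite z1 expr1n.
rewrite ncE2/= => E.
have -> : (a +i* b)^-1 = (a / (a ^+ 2 + b ^+ 2)) -i* (b / (a ^+ 2 + b ^+ 2)) by [].
by rewrite E !divr1.
Qed.

Lemma jouk_unit z : nc z = 1 -> jouk z = (complex.Re z)%:C.
Proof.
move=> z1.
have e : z + z^-1 = (complex.Re z)%:C + (complex.Re z)%:C.
  by rewrite (unit_circleV z1); apply: complex_ext;
    rewrite ?ReD ?ImD/= ?subrr ?addr0.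
by rewrite /jouk e; field.
Qed.

Lemma cheb_le1 k x : -1 <= x <= 1 -> nc (cheb k).[x%:C] <= 1.
Proof.
move=> /jouk_circle[z z1 <-].
have z0 : z != 0 by rewrite -nc_gt0 z1.
rewrite cheb_jouk// ncM ncV nc_nat ler_pdivrMr// mul1r.
by rewrite (le_trans (ncD _ _))// !ncX ncV z1 invr1 expr1n.
Qed.

Lemma poly_max_disc B (W : R) : (forall z, nc z = 1 -> nc B.[z] <= W) ->
  forall z, nc z <= 1 -> nc B.[z] <= W.
Proof.
move=> hW z z1.
have -> : W = W * nc (1 : R[i]) by rewrite nc1 mulr1.
apply: (@max_quotient _ [set z | nc z <= 1] 1 W (fun z => B.[z]) (fun=> 1)) => //.
- by move=> u; exact: cderivable_horner.
- by move=> u; exact: cderivable_cst.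
- by move=> u; exact: disc_closed.
- move=> u; rewrite /mkset le_eqVlt => /orP[/eqP u1|u1].
    by left; rewrite nc1 mulr1 hW.
  right; exists (1 - nc u); first by rewrite subr_gt0.
  move=> w wu; rewrite /mkset -[w](subrK u) (le_trans (ncD _ _))//; lra.
- by exists 1; rewrite /mkset nc1// mulr1 hW// nc1.
Qed.

(** The two preimages are inverse to each other, so one of them is in the closed
    disc. *)
Lemma jouk_surj z : exists2 w, w != 0 /\ nc w <= 1 & jouk w = z.
Proof.
pose d := sqrtC (z ^+ 2 - 1).
have dE : d ^+ 2 = z ^+ 2 - 1 by rewrite sqrtCK.
pose w := z + d.
have wE : w * (z - d) = 1.
  have -> : w * (z - d) = z ^+ 2 - d ^+ 2 by rewrite /w; ring.
  by rewrite dE; ring.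
have w0 : w != 0.
  by apply/eqP => w0; move/eqP: wE; rewrite w0 mul0r eq_sym oner_eq0.
have wV : w^-1 = z - d by apply: (mulfI w0); rewrite wE divff.
have jw : jouk w = z.
  by rewrite /jouk wV /w; field.
have [h|h] := leP (nc w) 1; first by exists w.
exists w^-1; last by rewrite joukV.
by split; [rewrite invr_eq0|rewrite ncV invf_le1 ?ltW// (lt_trans ltr01)].
Qed.

(** On the circle of radius [1/u > 1] the lifted polynomial is controlled by the
    maximum principle, and [z] is the Joukowski image of such a circle for
    [u - 1/u <= 2 |z|], so that [u <= 1 + |z| + |z|^2 <= exp (|z| + |z|^2)]. *)
Lemma bernstein_walsh n P (W : R) : (size P <= n.+1)%N ->
  (forall x, -1 <= x <= 1 -> nc P.[x%:C] <= W) ->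
  forall z, nc P.[z] <= W * expR (n%:R * (nc z + nc z ^+ 2)).
Proof.
move=> sP hW z.
have W0 : 0 <= W by rewrite (le_trans _ (hW 0 _)) ?nc_ge0//; lra.
have [w [w0 w1] <-] := jouk_surj z.
have [b [B [_ hB _]]] := jouk_lift sP.
have Bw : nc B.[w] <= W.
  apply: (poly_max_disc _ w1) => u u1.
  have u0 : u != 0 by rewrite -nc_gt0 u1.
  rewrite hB// ncM ncX u1 expr1n mul1r jouk_unit// hW//.
  by rewrite -ler_norml -u1 Re_le_nc.
have nw : 0 < nc w by rewrite nc_gt0.
set s := nc (jouk w); have s0 : 0 <= s by exact: nc_ge0.
set u := (nc w)^-1.
have u1 : 1 <= u by rewrite /u invf_ge1.
have us : u - u^-1 <= 2 * s.
  have := ncB_ge w^-1 (- w); rewrite ncN opprK ncV -/u {1}/u invrK.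
  move/le_trans; apply; rewrite /s /jouk ncM ncV nc_nat addrC.
  by rewrite mulrCA divff ?mulr1// pnatr_eq0.
have ub : u <= expR (s + s ^+ 2).
  apply: le_trans (expR_ge1Dx _).
  have u0 : 0 < u by lra.
  rewrite leNgt; apply/negP => hu.
  have : u ^+ 2 - 1 <= 2 * s * u.
    have -> : u ^+ 2 - 1 = (u - u^-1) * u by field; rewrite gt_eqF.
    by rewrite ler_pM2r.
  by nra.
have -> : nc P.[jouk w] = nc B.[w] * u ^+ n.
  by rewrite hB// ncM ncX mulrAC /u -exprMn divff ?gt_eqF// expr1n mul1r.
apply: ler_pM; rewrite ?nc_ge0// ?exprn_ge0 ?(le_trans ler01)//.
by rewrite expRM_natl lerXn2r ?nnegrE ?expR_ge0 ?(le_trans ler01).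
Qed.

(** The lifted polynomial [z^n Q((z + 1/z) / 2)] satisfies
    [B(z) = z^(2n) B(1/z)]; hence it is bounded by [16 W] in the [1/n]-neighbourhood
    of the unit circle, and Cauchy's estimates give a Lipschitz constant of
    order [n W]. *)
Lemma circle_lipschitz n Q (W : R) : (0 < n)%N -> (size Q <= n.+1)%N ->
  (forall x, -1 <= x <= 1 -> nc Q.[x%:C] <= W) ->
  forall z w, nc z = 1 -> nc w = 1 -> nc (w - z) <= (2 * n%:R)^-1 ->
  nc Q.[(complex.Re z)%:C] - nc Q.[(complex.Re w)%:C] <= 32 * W * n%:R * nc (w - z).
Proof.
move=> n0 sQ hW z w z1 w1 zw.
have nR : (0 : R) < n%:R by rewrite ltr0n.
have W0 : 0 <= W by rewrite (le_trans _ (hW 0 _)) ?nc_ge0//; lra.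
have [b [B [_ hB _]]] := jouk_lift sQ.
have Bc u : nc u = 1 -> nc B.[u] = nc Q.[(complex.Re u)%:C].
  move=> u1; have u0 : u != 0 by rewrite -nc_gt0 u1.
  by rewrite hB// ncM ncX u1 expr1n mul1r jouk_unit.
have Bd u : nc u <= 1 -> nc B.[u] <= W.
  apply: poly_max_disc => v v1; rewrite Bc// hW//.
  by rewrite -ler_norml -v1 Re_le_nc.
have Bn u : nc u <= 1 + n%:R^-1 -> nc B.[u] <= 16 * W.
  move=> hu; have [u1|u1] := leP (nc u) 1.
    by rewrite (le_trans (Bd _ u1))// ler_peMl//; lra.
  have u0 : u != 0 by rewrite -nc_gt0; lra.
  have -> : B.[u] = u ^+ n * u ^+ n * B.[u^-1].
    rewrite !hB ?invr_eq0// joukV exprVn mulrA mulfK//.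
    by rewrite expf_neq0.
  rewrite !ncM !ncX; apply: ler_pM; rewrite ?nc_ge0 ?mulr_ge0 ?exprn_ge0 ?nc_ge0//.
    have h : nc u ^+ n <= 4.
      rewrite (le_trans _ (expR1_le4 R))//.
      rewrite (le_trans _ (expR_pow_le ler01 n0))//.
      by rewrite lerXn2r ?nnegrE ?nc_ge0 ?addr_ge0 ?invr_ge0 ?(ltW nR)// div1r.
    have h0 : 0 <= nc u ^+ n by rewrite exprn_ge0// nc_ge0.
    by nra.
  by apply: Bd; rewrite ncV invf_le1 ?ltW//; lra.
pose C := B \Po ('X + z%:P).
have CE h : C.[h] = B.[h + z] by rewrite /C horner_comp !hornerE.
have rV : 0 < (n%:R : R)^-1 by rewrite invr_gt0.
have hC k : nc C`_k * n%:R^-1 ^+ k <= 16 * W.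
  apply: poly_cauchy => // h hh; rewrite CE; apply: Bn.
  by rewrite (le_trans (ncD _ _))// hh z1 addrC.
rewrite -(Bc _ z1) -(Bc _ w1).
rewrite (le_trans (ncB_ge _ _))// nc_distC.
have hzw : nc (w - z) <= n%:R^-1 / 2 by rewrite -invfM mulrC.
pose m := maxn 1 (size C).
have E : C = trunc (fun k => C`_k) m.
  apply/polyP => k; rewrite coef_trunc; case: ltnP => //.
  by rewrite geq_max => /andP[_ h']; rewrite nth_default.
have := geometric_tail rV hC hzw (leq_maxl 1 (size C)).
rewrite -/m -E CE subrK /trunc horner_poly big_ord1 expr0 mulr1.
rewrite -horner_coef0 CE add0r expr1 invrK => H.
rewrite (le_trans H)// le_eqVlt; apply/orP; left; apply/eqP; ring.
Qed.

End Joukowski.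

(** * A weighted Nikolskii inequality on an interval *)

Local Arguments Normc.normc : simpl never.

Section Nikolskii.
Variable R : realType.
Implicit Types (P Q : {poly R[i]}) (x u v : R).

Lemma lipschitz1 (f df : R -> R) : (forall x, is_derive x 1 f (df x)) ->
  (forall x, `|df x| <= 1) -> forall a b, `|f a - f b| <= `|a - b|.
Proof.
move=> hf hd a b; wlog ab : a b / a <= b.
  move=> H; have [/H//|/ltW/H h] := leP a b.
  by rewrite distrC [leRHS]distrC.
have cf : {within `[a, b], continuous f}.
  apply: derivable_within_continuous => x _.
  by have [] := hf x.
have [c _ E] := MVT_segment ab (fun x _ => hf x) cf.
by rewrite distrC E normrM [in X in _ <= X]distrC ler_piMl.
Qed.

Lemma cos_lipschitz (a b : R) : `|cos a - cos b| <= `|a - b|.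
Proof.
apply: (@lipschitz1 cos (fun x => - sin x)) => x.
by rewrite normrN sin_max.
Qed.

Lemma sin_lipschitz (a b : R) : `|sin a - sin b| <= `|a - b|.
Proof. by apply: (@lipschitz1 sin cos) => x; exact: cos_max. Qed.

Lemma sin_ge_half (d : R) : 0 <= d <= 1 / 2 -> d / 2 <= sin d.
Proof.
move=> /andP[d0 d2].
have cf : {within `[0, d], continuous (@sin R)}.
  by apply: derivable_within_continuous => x _; exact: derivable_sin.
have [c] := MVT_segment d0 (fun x _ => is_derive_sin x) cf.
rewrite in_itv/= => /andP[c0 cd]; rewrite sin0 !subr0 => ->.
rewrite mulrC ler_wpM2r//.
have := cos_lipschitz c 0; rewrite cos0 subr0 (ger0_norm c0) ler_norml.
by move=> /andP[h _]; lra.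
Qed.

Definition cis (t : R) : R[i] := cos t +i* sin t.

Lemma nc_cis t : nc (cis t) = 1.
Proof.
by apply/eqP; rewrite -(@eqrXn2 _ 2)// ?nc_ge0// ncE2/= cos2Dsin2 expr1n.
Qed.

Lemma cis_lipschitz t s : nc (cis t - cis s) <= 2 * `|t - s|.
Proof.
rewrite (le_trans (nc_le_ReIm _))//= mulr2n mulrDl mul1r.
by rewrite lerD// ?cos_lipschitz ?sin_lipschitz.
Qed.

Lemma size_weighted n r (A : R) P : (size P <= n.+1)%N ->
  (size ((P \Po (A%:C *: 'X)) * (1 - 'X^2) ^+ r)%R <= (n + 2 * r).+1)%N.
Proof.
move=> sP; rewrite (leq_trans (size_polyMleq _ _))//.
have s1 : (size (P \Po (A%:C *: 'X)) <= n.+1)%N.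
  rewrite (leq_trans (size_comp_poly_leq _ _))// ltnS.
  have : (size (A%:C *: 'X : {poly R[i]}) <= 2)%N.
    by rewrite (leq_trans (size_scale_leq _ _))// size_polyX.
  move=> h; rewrite -[leqRHS]muln1; apply: leq_mul.
    by case: (size P) sP.
  by case: (size _) h.
have s2 : (size ((1 - 'X^2 : {poly R[i]}) ^+ r) <= (2 * r).+1)%N.
  have h : (size (1 - 'X^2 : {poly R[i]})).-1 = 2.
    by rewrite -opprB size_polyN -polyC1 size_XnsubC.
  have := size_exp (1 - 'X^2 : {poly R[i]}) r; rewrite h.
  by case: (size _) => //= k ->.
by rewrite -subn1 (leq_trans (leq_sub2r 1 (leq_add s1 s2)))// addSn addnS subn1.
Qed.

Lemma poly_attains_max Q : exists2 x0 : R, -1 <= x0 <= 1 &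
  forall x, -1 <= x <= 1 -> nc Q.[x%:C] <= nc Q.[x0%:C].
Proof.
pose K := [set z : R[i] | nc z <= 1 /\ complex.Im z = 0].
have [| | | |z [z1 zi] hz] := @complex_EVT _ K 1 (fun z => nc Q.[z]).
- by exists 0; split; rewrite ?nc0.
- by move=> z [].
- move=> z h; split.
    by apply: disc_closed => d /h[w [w1 _] wz]; exists w.
  apply/eqP; rewrite -normr_eq0 eq_le normr_ge0 andbT.
  apply/ler_addgt0Pr => d d0; have [w [_ wi] wz] := h _ d0.
  rewrite add0r -normrN -[- _]add0r -wi -ImN -ImD.
  exact: le_trans (Im_le_nc _) wz.
- move=> z _; apply: ccontinuous_nc; apply: cderivable_ccontinuous.
  exact: cderivable_horner.
have zE : z = (complex.Re z)%:C by apply: complex_ext.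
exists (complex.Re z).
  by rewrite -ler_norml (le_trans (Re_le_nc z)).
move=> x; rewrite -ler_norml => hx; rewrite -zE.
by apply: hz; split; rewrite ?nc_real.
Qed.

(** [I] bounds the integral of [|P|^p] over [[-A, A]] from above, tested on
    constant minorants only, so that no integral is involved. *)
Definition minorant_bound P (p A I : R) := forall u v l : R,
  - A <= u -> u < v -> v <= A -> 0 <= l ->
  (forall x, u <= x <= v -> l <= nc P.[x%:C] `^ p) -> (v - u) * l <= I.

(** With [x = A cos t], the weight [(1 - (x/A)^2)^r = (sin t)^(2r)] raised to the
    power [p] is at most [sin t], the density of [dx / A] with respect to [dt].
    By [circle_lipschitz] the weighted polynomial stays above half of its maximum
    on an interval of [t] of length of order [1/(n + 2r)]; over the corresponding
    interval of [x] the integral of [|P|^p] is bounded below. *)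
Lemma nikolskii (p A I : R) r n P : 0 < p -> 1 <= (2 * r)%:R * p -> 0 < A ->
  (0 < n + 2 * r)%N -> (size P <= n.+1)%N ->
  minorant_bound P p A I -> forall x, - A <= x <= A ->
  (nc P.[x%:C] * (1 - (x / A) ^+ 2) ^+ r) `^ p <=
  2 `^ p * 512 * (n + 2 * r)%:R / A * I.
Proof.
move=> p0 rp A0 N0 sP hI.
have [N NE] : exists N, N = (n + 2 * r)%N by exists (n + 2 * r)%N.
rewrite -NE in N0 *.
have [K KE] : exists K : R, K = 512 by exists 512.
rewrite -KE; have K0 : 0 <= K by rewrite KE ler0n.
have Kp : 0 < K by rewrite KE ltr0n.
have NR : (0 : R) < N%:R by rewrite ltr0n.
have N1 : (1 : R) <= N%:R by rewrite ler1n.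
pose Q := (P \Po (A%:C *: 'X)) * (1 - 'X^2) ^+ r.
have sQ : (size Q <= N.+1)%N by rewrite NE; exact: size_weighted.
have QE x : -1 <= x <= 1 -> nc Q.[x%:C] = nc P.[(A * x)%:C] * (1 - x ^+ 2) ^+ r.
  move=> hx; rewrite /Q hornerM ncM horner_comp hornerZ hornerX -rmorphM/=.
  congr (_ * _); rewrite horner_exp ncX hornerD hornerN hornerXn hornerC.
  have -> : 1 - x%:C ^+ 2 = (1 - x ^+ 2)%:C by rewrite rmorphB rmorphXn.
  by rewrite nc_real ger0_norm//; nra.
have [x0 hx0 hmax] := poly_attains_max Q.
have [W WE] : exists W, W = nc Q.[x0%:C] by exists (nc Q.[x0%:C]).
rewrite -WE in hmax.
have W0 : 0 <= W by rewrite WE nc_ge0.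
suff main : W `^ p <= 2 `^ p * K * N%:R / A * I.
  move=> x hx; have hxA : -1 <= x / A <= 1.
    by rewrite ler_pdivlMr// ler_pdivrMr// mulN1r mul1r.
  have := hmax _ hxA; rewrite QE// (mulrC A) divfK ?gt_eqF// => h.
  apply: le_trans main; apply: ge0_ler_powR; rewrite ?nnegrE//; first exact: ltW.
  rewrite mulr_ge0 ?nc_ge0 ?exprn_ge0//.
  by have /andP[? ?] := hxA; nra.
have I0 : 0 <= I.
  have := hI (- A) A 0; rewrite mulr0; apply=> //; first by rewrite -subr_gt0; lra.
  by move=> x _; exact: powR_ge0.
have [W00|Wn0] := eqVneq W 0.
  rewrite W00 powR0; last by rewrite gt_eqF.
  by rewrite !mulr_ge0 ?powR_ge0 ?invr_ge0 ?(ltW A0).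
have Wp : 0 < W by rewrite lt_def Wn0.
pose d : R := (K / 2 * N%:R)^-1.
have d0 : 0 < d by rewrite invr_gt0 mulr_gt0// divr_gt0.
have d1 : d <= 1 / 256.
  rewrite ler_pdivlMr; last by lra.
  rewrite mulrC ler_pdivrMr; first by rewrite KE; lra.
  by rewrite KE; lra.
have pi2 := @pi_ge2 R.
pose t0 := acos x0.
have [t00 t0E] := acos_def hx0.
rewrite -/t0 in t00 t0E.
have [m hm mt] : exists2 m, 0 <= m - d /\ m + d <= pi & m - d <= t0 <= m + d.
  move/andP: t00 => [t1 t2].
  have [h|h] := leP (t0 + 2 * d) pi.
    by exists (t0 + d); clear -t1 t2 h d0 d1 pi2; lra.
  by exists (t0 - d); clear -t1 t2 h d0 d1 pi2; lra.
have [m1 m2] := hm.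
have sm : 0 < sin m by apply: sin_gt0_pi; clear -m1 m2 d0; lra.
have lenE : cos (m - d) - cos (m + d) = 2 * sin m * sin d.
  by rewrite cosB cosD; ring.
have sd := sin_ge_half (_ : 0 <= d <= 1 / 2).
have {}sd : d / 2 <= sin d by apply: sd; lra.
pose l := (W / 2) `^ p / (2 * sin m).
have l0 : 0 <= l by rewrite divr_ge0 ?powR_ge0// mulr_ge0// ltW.
have key : (A * cos (m - d) - A * cos (m + d)) * l <= I.
  apply: (hI (A * cos (m + d)) (A * cos (m - d)) l) => //.
  - by rewrite -mulN1r mulrC ler_wpM2l ?(ltW A0)// cos_geN1.
  - by rewrite ltr_pM2l// -subr_gt0 lenE !mulr_gt0//; lra.
  - by rewrite ler_piMr ?(ltW A0)// cos_le1.
  move=> y /andP[y1 y2].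
  pose x := y / A.
  have yE : y = A * x by rewrite /x mulrC divfK// gt_eqF.
  have x1 : cos (m + d) <= x by rewrite /x ler_pdivlMr// mulrC.
  have x2 : x <= cos (m - d) by rewrite /x ler_pdivrMr// mulrC.
  have hx : -1 <= x <= 1.
    by rewrite (le_trans (cos_geN1 _) x1) (le_trans x2 (cos_le1 _)).
  have [/andP[s0 spi] sE] := acos_def hx; set s := acos x in s0 spi sE.
  have hs : m - d <= s <= m + d.
    apply/andP; split; rewrite leNgt; apply/negP => hh.
      move: x2; rewrite -sE leNgt; move/negP; apply.
      by rewrite ltr_cos// in_itv/=; clear -s0 spi hh m1 m2 d0; lra.
    move: x1; rewrite -sE leNgt; move/negP; apply.
    by rewrite ltr_cos// in_itv/=; clear -s0 spi hh m1 m2 d0; lra.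
  have st : nc (cis s - cis t0) <= (64 * N%:R)^-1.
    rewrite (le_trans (cis_lipschitz _ _))//.
    have -> : (64 * N%:R)^-1 = 2 * (2 * d) by rewrite /d KE; field; rewrite gt_eqF.
    rewrite ler_wpM2l// ler_norml; clear -hs mt; lra.
  have QW : W / 2 <= nc Q.[x%:C].
    have := @circle_lipschitz _ N Q W N0 sQ hmax (cis t0) (cis s)
      (nc_cis _) (nc_cis _).
    rewrite /= t0E sE -WE => H.
    have st2 : nc (cis s - cis t0) <= (2 * N%:R)^-1.
      apply: (le_trans st); rewrite lef_pV2 ?posrE ?mulr_gt0//; lra.
    have {}H := H st2.
    have : 32 * W * N%:R * nc (cis s - cis t0) <= 32 * W * N%:R * (64 * N%:R)^-1.
      by rewrite ler_wpM2l// !mulr_ge0// ltW.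
    have -> : 32 * W * N%:R * (64 * N%:R)^-1 = W / 2 by field; rewrite gt_eqF.
    by move: H; clear; lra.
  have S0 : 0 <= sin s by apply: sin_ge0_pi; rewrite s0 spi.
  have S1 : sin s <= 1 by exact: sin_le1.
  rewrite QE// -yE in QW.
  have e1 : 1 - x ^+ 2 = sin s ^+ 2 by rewrite sin2cos2 sE.
  rewrite e1 -exprM in QW.
  have Sm : sin s <= 2 * sin m.
    have -> : 2 * sin m = 2 * sin m * (1 - cos (m - s)) + (sin s + sin (2 * m - s)).
      have -> : s = m - (m - s) by ring.
      have -> : 2 * m - (m - (m - s)) = m + (m - s) by ring.
      have -> : m - (m - (m - s)) = m - s by ring.
      by rewrite (sinB m (m - s)) (sinD m (m - s)); ring.
    have : 0 <= sin (2 * m - s).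
      by apply: sin_ge0_pi; clear -hs m1 m2 d0; lra.
    have : 0 <= 2 * sin m * (1 - cos (m - s)).
      by rewrite mulr_ge0 ?subr_ge0 ?cos_le1// mulr_ge0// ltW.
    clear; lra.
  rewrite /l ler_pdivrMr ?mulr_gt0//.
  apply: (@le_trans _ _ ((nc P.[y%:C] * sin s ^+ (2 * r)) `^ p)).
    apply: ge0_ler_powR; rewrite ?nnegrE// ?mulr_ge0 ?nc_ge0 ?exprn_ge0//.
    by rewrite ltW.
  rewrite powRM ?nc_ge0 ?exprn_ge0// ler_wpM2l ?powR_ge0//.
  apply: le_trans Sm.
  rewrite -powR_mulrn// -powRrM.
  have [->|Sn0] := eqVneq (sin s) 0; first by rewrite powR0// gt_eqF// (lt_le_trans ltr01 rp).
  rewrite -[leRHS]powRr1//.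
  by apply: ger_powR => //; rewrite lt_def Sn0 S0 S1.
have {key} : A * sin d * (W / 2) `^ p <= I.
  apply: le_trans key; rewrite le_eqVlt; apply/orP; left; apply/eqP.
  by rewrite -mulrBr lenE /l; field; rewrite gt_eqF.
have -> : (W / 2) `^ p = W `^ p / 2 `^ p.
  by rewrite powRM ?invr_ge0// -{1}[2^-1]powR_inv1// -powRrM mulN1r powRN.
have p2 : 0 < (2 : R) `^ p by rewrite powR_gt0.
have Wpp : 0 <= W `^ p by exact: powR_ge0.
move=> h.
have h2 : A * (d / 2) * (W `^ p / 2 `^ p) <= I.
  apply: le_trans h; rewrite ler_wpM2r ?divr_ge0 ?powR_ge0//.
  by rewrite ler_wpM2l// ltW.
have -> : W `^ p = 2 `^ p * K * N%:R / A * (A * (d / 2) * (W `^ p / 2 `^ p)).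
  by rewrite /d KE; field; rewrite ?gt_eqF.
by rewrite ler_wpM2l// !mulr_ge0 ?invr_ge0 ?powR_ge0 ?(ltW A0).
Qed.

End Nikolskii.

(** * Polynomial approximation of entire functions of smaller type *)

Section EntireApproximation.
Variable R : realType.
Implicit Types (g : R[i] -> R[i]) (P : {poly R[i]}).

Lemma poly_exp_bounded (k : R) (M : nat) : 0 < k ->
  exists2 D : R, 0 <= D & forall n : nat, (1 + n%:R) ^+ M * expR (- (k * n%:R)) <= D.
Proof.
move=> k0; pose c : R := Num.min 1 (k / M.+1%:R).
have c0 : 0 < c by rewrite lt_min ltr01 divr_gt0.
exists (c ^- M); first by rewrite invr_ge0 exprn_ge0// ltW.
move=> n; rewrite expRN ler_pdivrMr ?expR_gt0//.
rewrite mulrC ler_pdivlMr ?exprn_gt0// -exprMn.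
have h : (1 + n%:R) * c <= expR (k / M.+1%:R * n%:R).
  apply: le_trans (expR_ge1Dx _); rewrite mulrDl mul1r lerD//.
    by rewrite ge_min lexx.
  by rewrite mulrC ler_wpM2r// ge_min lexx orbT.
have h0 : 0 <= (1 + n%:R) * c by rewrite mulr_ge0 ?addr_ge0// ltW.
apply: (@le_trans _ _ (expR (k / M.+1%:R * n%:R) ^+ M)).
  by rewrite lerXn2r ?nnegrE ?expR_ge0.
rewrite -expRM_natl ler_expR.
have -> : M%:R * (k / M.+1%:R * n%:R) = (M%:R / M.+1%:R) * (k * n%:R) by ring.
rewrite ler_piMl ?mulr_ge0 ?(ltW k0)//.
by rewrite ler_pdivrMr// mul1r ler_nat.
Qed.

Lemma im_jouk (rho : R) (z : R[i]) : 1 <= rho -> nc z = rho ->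
  `|complex.Im (jouk z)| <= (rho - rho^-1) / 2.
Proof.
move=> r1 zr; have r0 : 0 < rho by lra.
have E : rho ^+ 2 = complex.Re z ^+ 2 + complex.Im z ^+ 2 by rewrite -zr ncE2.
have zi := Im_le_nc z; rewrite zr in zi.
have e2 : jouk z = (2^-1)%:C * (z + z^-1).
  by rewrite /jouk mulrC fmorphV rmorph_nat.
have iV : complex.Im z^-1 = - complex.Im z / rho ^+ 2.
  by rewrite E; case: z {zr E zi e2} => x y /=; rewrite mulNr.
rewrite e2 ImM /= mul0r addr0 ImD iV normrM ger0_norm ?invr_ge0//.
rewrite mulrC ler_pM2r ?invr_gt0//.
have -> : complex.Im z + - complex.Im z / rho ^+ 2 =
    complex.Im z * (1 - rho ^- 2) by ring.
rewrite normrM.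
have h : 0 <= 1 - rho ^- 2.
  by rewrite subr_ge0 invf_le1 ?exprn_gt0// exprn_ege1.
rewrite [X in _ * X]ger0_norm//.
apply: (le_trans (ler_wpM2r h zi)); rewrite le_eqVlt; apply/orP; left; apply/eqP.
by field; rewrite gt_eqF.
Qed.

Lemma nc_jouk_le (rho : R) (z : R[i]) : 1 <= rho -> nc z = rho ->
  nc (jouk z) <= rho.
Proof.
move=> r1 zr; rewrite /jouk ncM ncV nc_nat ler_pdivrMr//.
rewrite (le_trans (ncD _ _))// ncV zr mulr2n mulrDr mulr1 lerD//.
by apply: (@le_trans _ _ 1) => //; rewrite invf_le1//; lra.
Qed.

(** By [exp (- s) >= 1 - s], so that [exp s <= 1 / (1 - s)]. *)
Lemma sinh_le (s : R) : 0 < s -> s < 1 ->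
  (expR s - (expR s)^-1) / 2 <= s / (1 - s).
Proof.
move=> s0 s1.
have h1 := expR_ge1Dx (- s).
have h2 : expR s <= (1 - s)^-1.
  by rewrite -[leLHS]invrK lef_pV2 ?posrE ?invr_gt0 ?expR_gt0 -?expRN//; lra.
rewrite -expRN.
apply: (@le_trans _ _ (((1 - s)^-1 - (1 - s)) / 2)).
  by rewrite ler_pM2r// lerB.
have q : 0 < 1 - s by lra.
rewrite -subr_ge0.
have -> : s / (1 - s) - ((1 - s)^-1 - (1 - s)) / 2 = s ^+ 2 / (2 * (1 - s)).
  by field; rewrite gt_eqF.
by rewrite divr_ge0 ?sqr_ge0// mulr_ge0// ltW.
Qed.

Lemma geometric_sum_le (rho G : R) (b : nat -> R[i]) (t : R) n m : 1 < rho ->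
  -1 <= t <= 1 -> 0 <= G ->
  (forall k, (0 < k <= m)%N -> nc (b k) * rho ^+ k <= G) ->
  (n <= m)%N ->
  nc (\sum_(n.+1 <= k < m.+1) (b k *: cheb R k).[t%:C]) <=
  G / rho ^+ n / (rho - 1).
Proof.
move=> r1 ht G0 hb nm; have r0 : 0 < rho by lra.
have q : 0 < rho - 1 by lra.
suff H j : (n + j <= m)%N ->
    nc (\sum_(n.+1 <= k < (n + j).+1) (b k *: cheb R k).[t%:C]) <=
    (G / rho ^+ n - G / rho ^+ (n + j)) / (rho - 1).
  have := H (m - n)%N; rewrite subnKC// => /(_ (leqnn _)) h.
  apply: (le_trans h); rewrite ler_pM2r ?invr_gt0// gerBl.
  by rewrite divr_ge0// exprn_ge0// ltW.
elim: j => [|j IH] hj.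
  by rewrite addn0 big_geq// nc0 subrr mul0r.
rewrite addnS big_nat_recr/= ?ltnS ?leq_addr//.
have hj' : (n + j <= m)%N by rewrite (leq_trans _ hj)// addnS.
rewrite (le_trans (ncD _ _))// (le_trans (lerD (IH hj') (_ : _ <= G / rho ^+ (n + j).+1)))//.
  rewrite hornerZ ncM ler_pdivlMr ?exprn_gt0//.
  have := hb (n + j).+1; rewrite -addnS hj addnS/= => /(_ isT) h.
  apply: le_trans h; rewrite mulrAC ler_piMr ?mulr_ge0 ?nc_ge0 ?exprn_ge0 ?(ltW r0)//.
  exact: cheb_le1.
rewrite le_eqVlt; apply/orP; left; apply/eqP.
rewrite exprS; field.
by rewrite !gt_eqF ?exprn_gt0.
Qed.

(** On the circle [|z| = e^s] the Joukowski image of [A z] has imaginary part at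
    most [A sinh s], where [g] is of order [exp (tau A sinh s)]; so the Chebyshev
    coefficients of [g(A x)] beyond the [n]-th decay like
    [exp (tau A sinh s - s n)], and with [A] close to [n / sigma] the exponent is
    negative, of order [n], when [s] is small since [sinh s / s] tends to [1]. *)
Lemma entire_poly_approx g (tau sigma C Ca : R) L m (a : nat -> R) :
  (forall z, cderivable g z) -> 0 < tau -> tau < sigma -> 0 <= C ->
  (forall z, nc (g z) <= C * expR (tau * nc z)) ->
  (forall x : R, nc (g x%:C) <= C * (1 + `|x|) ^+ L) ->
  (forall n, (1 <= n)%N -> 0 < a n) ->
  (forall n, (1 <= n)%N -> `|a n - n%:R| <= Ca) ->
  exists D, forall n, (1 <= n)%N -> exists2 P : {poly R[i]},
    (size P <= n.+1)%N & forall x : R, - (a n / sigma) <= x <= a n / sigma ->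
    nc (g x%:C - P.[x%:C]) * (1 + n%:R) ^+ m <= D.
Proof.
move=> dg tau0 ts C0 hg hgx a0 ha.
have sg0 : 0 < sigma by exact: lt_trans ts.
have Ca0 : 0 <= Ca by rewrite (le_trans _ (ha 1 _)).
have [c hc] := entire_taylor dg.
pose q := tau / sigma.
have q0 : 0 < q by rewrite divr_gt0.
have q1 : q < 1 by rewrite ltr_pdivrMr// mul1r.
pose s : R := (1 - q) / 2.
have s0 : 0 < s by rewrite /s; lra.
have s1 : s < 1 by rewrite /s; lra.
pose k := s - q * (s / (1 - s)).
have k0 : 0 < k.
  have s1' : 0 < 1 - s by lra.
  have -> : k = s * (1 - q - s) / (1 - s) by rewrite /k; field; rewrite gt_eqF.
  by rewrite divr_gt0// mulr_gt0//; rewrite /s; lra.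
pose rho := expR s.
have rho1 : 1 < rho by rewrite expR_gt1.
have rho0 : 0 < rho by lra.
pose sh := (rho - rho^-1) / 2.
have shs : sh <= s / (1 - s) by exact: sinh_le.
have sh0 : 0 <= sh.
  by rewrite divr_ge0// subr_ge0 (@le_trans _ _ 1)// ?invf_le1// ltW.
pose C1 := C * (2 ^+ L + 5) * 16.
have C10 : 0 <= C1.
  by rewrite mulr_ge0 ?ler0n// mulr_ge0// addr_ge0 ?exprn_ge0 ?ler0n.
pose B := 1 + (1 + Ca) / sigma * rho.
have B0 : 0 <= B by rewrite addr_ge0// mulr_ge0 ?divr_ge0 ?addr_ge0 ?(ltW rho0) ?(ltW sg0).
pose E := C1 * B ^+ L * expR (q * Ca * sh).
have E0 : 0 <= E by rewrite !mulr_ge0 ?exprn_ge0 ?expR_ge0.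
have [D D0 hD] := poly_exp_bounded (L + m) k0.
pose F := 1 + 2 * (E + 1) / (rho - 1).
exists (F * D) => n n1.
set A := a n / sigma.
have A0 : 0 < A by rewrite divr_gt0// a0.
have an : a n <= n%:R + Ca by have := ha n n1; rewrite ler_norml => /andP[_]; lra.
have nR1 : 1 <= n%:R :> R by rewrite ler1n.
have An : 1 + A * rho <= (1 + n%:R) * B.
  have h : A <= (1 + n%:R) * ((1 + Ca) / sigma).
    by rewrite mulrA /A ler_pM2r ?invr_gt0//; nra.
  rewrite /B mulrDr mulr1 mulrA; apply: lerD; first by rewrite lerDl.
  by rewrite ler_pM2r.
have tA : tau * (A * sh) <= (s - k) * n%:R + q * Ca * sh.
  have -> : tau * (A * sh) = q * a n * sh by rewrite /A /q; field; rewrite gt_eqF.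
  apply: (@le_trans _ _ (q * (n%:R + Ca) * sh)).
    by rewrite ler_wpM2r// ler_pM2l.
  rewrite mulrDr mulrDl lerD2r.
  have -> : (s - k) * n%:R = q * n%:R * (s / (1 - s)) by rewrite /k; ring.
  by rewrite ler_pM2l// mulr_gt0//; lra.
pose eta := expR (- (k * n%:R)).
have eta0 : 0 < eta by exact: expR_gt0.
have eta1 : eta <= 1.
  by rewrite -expR0 ler_expR oppr_le0 mulr_ge0 ?(ltW k0).
have [m0 hm0] := hc (A * rho) _ eta0.
set M := maxn n m0.
have Mn : (n <= M)%N by rewrite leq_max leqnn.
have hS z : nc z <= A * rho -> nc (g z - (trunc c M).[z]) <= eta.
  by move=> hz; apply: hm0 => //; rewrite leq_max leqnn orbT.
pose Q := trunc c M \Po (A%:C *: 'X).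
have QE z : Q.[z] = (trunc c M).[A%:C * z].
  by rewrite horner_comp hornerZ hornerX.
have sQ : (size Q <= M.+1)%N.
  rewrite (leq_trans (size_comp_poly_leq _ _))// ltnS -[leqRHS]muln1.
  apply: leq_mul.
    by rewrite (leq_trans (leq_pred _))// size_poly.
  have : (size (A%:C *: 'X : {poly R[i]}) <= 2)%N.
    by rewrite (leq_trans (size_scale_leq _ _))// size_polyX.
  by case: (size _).
pose G := C1 * ((1 + n%:R) * B) ^+ L * expR ((s - k) * n%:R + q * Ca * sh).
have G0 : 0 <= G.
  by rewrite !mulr_ge0 ?exprn_ge0 ?expR_ge0// mulr_ge0// addr_ge0.
have hQ z : nc z = rho -> nc Q.[jouk z] <= G + eta.
  move=> zr; rewrite QE; set w := A%:C * jouk z.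
  have wA : nc w <= A * rho.
    rewrite /w ncM nc_real gtr0_norm// ler_pM2l//.
    by apply: nc_jouk_le => //; exact: ltW.
  have -> : (trunc c M).[w] = g w - (g w - (trunc c M).[w]) by ring.
  rewrite (le_trans (ncB _ _))// lerD ?hS//.
  rewrite (le_trans (phragmen_lindelof dg (ltW tau0) C0 hg hgx w))//.
  rewrite -/C1 /G; apply: ler_pM; rewrite ?mulr_ge0 ?exprn_ge0 ?expR_ge0//.
  - by rewrite addr_ge0 ?nc_ge0.
  - have NB0 : 0 <= (1 + n%:R) * B by rewrite mulr_ge0.
    have w0 : 0 <= 1 + nc w by rewrite addr_ge0 ?nc_ge0.
    rewrite ler_wpM2l// lerXn2r ?nnegrE//.
    by apply: (@le_trans _ _ (1 + A * rho)) => //; rewrite lerD2l.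
  - rewrite ler_expR (le_trans _ tA)// ler_pM2l//.
    rewrite /w ImM/= mul0r addr0 normrM gtr0_norm// ler_pM2l//.
    by apply: im_jouk => //; exact: ltW.
have [b Qb hb] := cheb_coef_bound rho0 sQ hQ.
exists ((\sum_(j < n.+1) b j *: cheb R j) \Po ((A^-1)%:C *: 'X)).
  rewrite (leq_trans (size_comp_poly_leq _ _))// ltnS -[leqRHS]muln1.
  apply: leq_mul; last first.
    have : (size ((A^-1)%:C *: 'X : {poly R[i]}) <= 2)%N.
      by rewrite (leq_trans (size_scale_leq _ _))// size_polyX.
    by case: (size _).
  have : (size (\sum_(j < n.+1) b j *: cheb R j)%R <= n.+1)%N.
    rewrite (leq_trans (size_sum _ _ _))//; apply/bigmax_leqP => j _.
    rewrite (leq_trans (size_scale_leq _ _))//.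
    by rewrite (leq_trans (cheb_size R j).1).
  by case: (size _).
move=> x hx; pose t := x / A.
have ht : -1 <= t <= 1 by rewrite ler_pdivlMr// ler_pdivrMr// mulN1r mul1r.
have xE : x%:C = A%:C * t%:C by rewrite -rmorphM/= /t mulrC divfK// gt_eqF.
rewrite horner_comp hornerZ hornerX -rmorphM/= [A^-1 * x]mulrC -/t.
have -> : g x%:C - (\sum_(j < n.+1) b j *: cheb R j).[t%:C] =
   (g x%:C - (trunc c M).[x%:C]) +
   \sum_(n.+1 <= j < M.+1) (b j *: cheb R j).[t%:C].
  have -> : (trunc c M).[x%:C] = (\sum_(j < M.+1) b j *: cheb R j).[t%:C].
    by rewrite -Qb QE -xE.
  rewrite !horner_sum -(big_mkord xpredT (fun j => (b j *: cheb R j).[t%:C])).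
  rewrite -(big_mkord xpredT (fun j => (b j *: cheb R j).[t%:C])).
  rewrite [X in _ = _ - X + _](@big_cat_nat _ _ _ n.+1)//=.
  by ring.
have xA : nc x%:C <= A * rho.
  rewrite nc_real ler_norml; have h : A <= A * rho by rewrite ler_peMr ?(ltW A0)// ltW.
  by move/andP: hx => [? ?]; rewrite -/A in h *; lra.
have GE2 : 0 <= 2 * (G + eta) by rewrite mulr_ge0// addr_ge0// ltW.
have T := geometric_sum_le rho1 ht GE2 hb Mn.
have rn : rho ^+ n = expR (s * n%:R) by rewrite /rho -expRM_natl mulrC.
have N1 : 1 <= (1 + n%:R) ^+ L :> R by rewrite exprn_ege1// lerDl.
have GT : 2 * (G + eta) / rho ^+ n / (rho - 1) <=
   2 * (E + 1) / (rho - 1) * ((1 + n%:R) ^+ L * eta).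
  have -> : 2 * (E + 1) / (rho - 1) * ((1 + n%:R) ^+ L * eta) =
     2 * (((E + 1) * (1 + n%:R) ^+ L) * eta) / (rho - 1) by ring.
  rewrite ler_pM2r ?invr_gt0; last by lra.
  rewrite -mulrA ler_pM2l// mulrDl.
  have e1 : G / rho ^+ n = E * (1 + n%:R) ^+ L * eta.
    rewrite rn -expRN /G /E exprMn /eta.
    have -> : (s - k) * n%:R + q * Ca * sh =
       q * Ca * sh + s * n%:R + - (k * n%:R) by ring.
    have ee : expR (q * Ca * sh + s * n%:R + - (k * n%:R)) * expR (- (s * n%:R)) =
        expR (q * Ca * sh) * expR (- (k * n%:R)) by rewrite -!expRD; congr expR; ring.
    by rewrite -mulrA ee; ring.
  rewrite e1 mulrDl mul1r mulrDl lerD2l.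
  apply: (@le_trans _ _ eta); last by rewrite ler_peMl ?(ltW eta0).
  by rewrite ler_pdivrMr ?exprn_gt0// ler_peMr ?(ltW eta0)// exprn_ege1// ltW.
apply: (@le_trans _ _ (F * ((1 + n%:R) ^+ L * eta) * (1 + n%:R) ^+ m)).
  rewrite ler_wpM2r ?exprn_ge0 ?addr_ge0//.
  rewrite (le_trans (ncD _ _))// /F mulrDl mul1r; apply: lerD.
    by rewrite (le_trans (hS _ xA))// ler_peMl// ltW.
  exact: le_trans T GT.
have r10 : 0 <= rho - 1 by rewrite subr_ge0 ltW.
have F0 : 0 <= F by rewrite /F addr_ge0// divr_ge0// mulr_ge0// addr_ge0.
by rewrite -mulrA ler_wpM2l// mulrAC -exprD hD.
Qed.


Lemma powR_add1_le (p u : R) : 0 < p -> 0 <= u ->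
  (u + 1) `^ p <= 2 `^ p * (u `^ p + 1).
Proof.
move=> p0 u0; have [u1|u1] := leP u 1.
  apply: (@le_trans _ _ (2 `^ p)).
    by apply: ge0_ler_powR; rewrite ?nnegrE ?(ltW p0) ?addr_ge0//; lra.
  by rewrite ler_peMr ?powR_ge0// lerDr powR_ge0.
apply: (@le_trans _ _ ((2 * u) `^ p)).
  by apply: ge0_ler_powR; rewrite ?nnegrE ?(ltW p0) ?addr_ge0 ?mulr_ge0//; lra.
by rewrite powRM// ler_wpM2l ?powR_ge0// lerDl.
Qed.

(** On [[-2A, 2A]] the function agrees up to [1] with a Taylor polynomial of degree
    [O(A)], to which the Nikolskii inequality applies. *)
Lemma growth_on_line g (tau C B p : R) q : (forall z, cderivable g z) ->
  0 <= tau -> 0 <= C -> 0 < p -> 0 <= B ->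
  (forall z, nc (g z) <= C * expR (tau * nc z)) ->
  (forall A u v l : R, 1 <= A -> - A <= u -> u < v -> v <= A -> 0 <= l ->
    (forall x, u <= x <= v -> l <= nc (g x%:C) `^ p) ->
    (v - u) * l <= B * (1 + A) ^+ q) ->
  exists2 C', 0 <= C' & exists L, forall x : R, nc (g x%:C) <= C' * (1 + `|x|) ^+ L.
Proof.
move=> dg tau0 C0 p0 B0 hg hI.
have [c hc] := entire_taylor dg.
pose r := (Num.trunc p^-1).+1.
have rp : 1 <= (2 * r)%:R * p.
  have h : p^-1 <= r%:R by rewrite ltW// truncnS_gt.
  rewrite -ler_pdivrMr// div1r (le_trans h)// ler_nat; lia.
pose N0 := (Num.trunc (2 * C)).+1.
have hN0 : 2 * C <= 2 ^+ N0.
  rewrite (le_trans (ltW (truncnS_gt _)))// -natrX ler_nat ltnW//.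
  exact: ltn_expl.
have [K KE] : exists K : R, K = 512 by exists 512.
have K0 : 0 <= K by rewrite KE ler0n.
pose c34 : R := (3 / 4) ^+ r.
have c0 : 0 < c34 by rewrite exprn_gt0// divr_gt0.
pose q1 : R := 2 `^ p.
have q10 : 0 <= q1 by exact: powR_ge0.
pose D : R := q1 * K * (8 * tau + 2 + N0%:R + (2 * r)%:R) * (q1 * (4 + B * 2 ^+ q)).
have D0 : 0 <= D.
  rewrite !mulr_ge0 ?addr_ge0 ?mulr_ge0 ?exprn_ge0//.
pose L := (Num.trunc (q.+2%:R / p)).+1.
have Lp : q.+2%:R / p <= L%:R by rewrite ltW// truncnS_gt.
pose C' := (1 + D) `^ p^-1 / c34 * 2 ^+ L + 1.
have C'0 : 0 <= (1 + D) `^ p^-1 / c34 * 2 ^+ L.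
  by rewrite mulr_ge0 ?exprn_ge0// divr_ge0 ?powR_ge0// ltW.
exists C'; first by rewrite addr_ge0.
exists L => x; pose A : R := 1 + `|x|.
have A1 : 1 <= A by rewrite lerDl.
have A0 : 0 < A by lra.
pose k := (Num.trunc (4 * tau * A)).+1.
have kA : 4 * tau * A <= k%:R by rewrite ltW// truncnS_gt.
have kA' : k%:R <= 4 * tau * A + 1.
  have := truncn_le (4 * tau * A); rewrite mulr_ge0 ?mulr_ge0 ?(ltW A0)// => h.
  by rewrite /k -natr1 lerD2r h.
pose N := (2 * k + N0)%N.
have r4 : 0 < 4 * A by rewrite mulr_gt0.
have hcoef j : nc (c j) * (4 * A) ^+ j <= C * expR k%:R.
  apply: (@cauchy_estimate _ g c (4 * A) (C * expR k%:R) j hc r4) => z zr; rewrite (le_trans (hg z))// ler_wpM2l//.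
  by rewrite ler_expR (le_trans _ kA)// zr; lra.
have hS z : nc z <= 2 * A -> nc (g z - (trunc c N).[z]) <= 1.
  move=> hz; have hz2 : nc z <= 4 * A / 2 by rewrite (le_trans hz)//; lra.
  rewrite (le_trans (taylor_tail N hc r4 hcoef hz2))//.
  have e1 : expR (k%:R : R) <= 4 ^+ k.
    by rewrite -[k%:R]mulr1 expRM_natl lerXn2r ?nnegrE ?expR_ge0// expR1_le4.
  apply: (@le_trans _ _ (2 * (C * 4 ^+ k) * 2^-1 ^+ N)).
    apply: ler_pM; rewrite ?mulr_ge0 ?expR_ge0 ?exprn_ge0 ?divr_ge0 ?nc_ge0 ?(ltW r4)//.
      by rewrite ler_pM2l// ler_wpM2l.
    rewrite lerXn2r ?nnegrE ?divr_ge0 ?nc_ge0 ?(ltW r4)//.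
    by rewrite ler_pdivrMr//; lra.
  rewrite exprVn ler_pdivrMr ?exprn_gt0// mul1r /N exprD exprM.
  have -> : (2 : R) ^+ 2 = 4 by rewrite expr2; ring.
  rewrite mulrA mulrC ler_wpM2l ?exprn_ge0//.
have sS : (size (trunc c N) <= N.+1)%N by rewrite (leq_trans (size_poly _ _)).
pose I := q1 * (4 * A + B * (1 + 2 * A) ^+ q).
have I0 : 0 <= I.
  rewrite mulr_ge0// addr_ge0// mulr_ge0 ?exprn_ge0 ?addr_ge0 ?(ltW A0) ?mulr_ge0//.
  exact: ltW.
have mI : minorant_bound (trunc c N) p (2 * A) I.
  move=> u v l hu uv hv l0 hl.
  have key y : u <= y <= v -> l <= q1 * (nc (g y%:C) `^ p + 1).
    move=> /[dup] hy /andP[y1 y2]; rewrite (le_trans (hl y hy))//.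
    apply: le_trans (powR_add1_le p0 (nc_ge0 _)).
    apply: ge0_ler_powR; rewrite ?nnegrE ?nc_ge0 ?addr_ge0 ?nc_ge0 ?(ltW p0)//.
    have -> : (trunc c N).[y%:C] = g y%:C - (g y%:C - (trunc c N).[y%:C]) by ring.
    rewrite (le_trans (ncB _ _))// lerD2l hS// nc_real ler_norml; lra.
  have q1p : 0 < q1 by rewrite powR_gt0.
  have vu : 0 < v - u by rewrite subr_gt0.
  have vu4 : v - u <= 4 * A by lra.
  have [lq|lq] := leP l q1.
    apply: (@le_trans _ _ (4 * A * q1)); first by apply: ler_pM => //; exact: ltW.
    rewrite /I [leRHS]mulrC ler_wpM2r// lerDl mulr_ge0 ?exprn_ge0 ?addr_ge0//.
    by rewrite mulr_ge0// ltW.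
  have A2 : 1 <= 2 * A by lra.
  have l0' : 0 <= l / q1 - 1 by rewrite subr_ge0 ler_pdivlMr// mul1r ltW.
  have := @hI (2 * A) u v (l / q1 - 1) A2 hu uv hv l0'.
  have hh y : u <= y <= v -> l / q1 - 1 <= nc (g y%:C) `^ p.
    by move=> /key h; rewrite lerBlDr ler_pdivrMr// mulrC.
  move=> /(_ hh) H.
  have -> : (v - u) * l = q1 * ((v - u) + (v - u) * (l / q1 - 1)).
    by field; rewrite gt_eqF.
  by rewrite /I ler_wpM2l// lerD.
have A20 : 0 < 2 * A by rewrite mulr_gt0.
have Nr0 : (0 < N + 2 * r)%N by rewrite addn_gt0 muln_gt0 orbT.
have hx : - (2 * A) <= x <= 2 * A.
  by have := ler_norm x; have := ler_norm (- x); rewrite normrN /A; lra.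
have := @nikolskii _ p (2 * A) I r N _ p0 rp A20 Nr0 sS mI x hx.
set w := nc _; rewrite -KE -/q1 => H.
have w0 : 0 <= w by exact: nc_ge0.
have xA : (3 / 4) <= 1 - (x / (2 * A)) ^+ 2.
  have h : `|x / (2 * A)| <= 1 / 2.
    rewrite normrM normfV (gtr0_norm A20) ler_pdivrMr// /A; lra.
  have : (x / (2 * A)) ^+ 2 <= (1 / 2) ^+ 2.
    by rewrite -real_normK ?num_real// lerXn2r ?nnegrE.
  by rewrite !expr2; lra.
have wl : w * c34 <= w * (1 - (x / (2 * A)) ^+ 2) ^+ r.
  have h34 : 0 <= 3 / 4 :> R by rewrite divr_ge0.
  by rewrite ler_wpM2l// lerXn2r ?nnegrE// (le_trans h34).
have H2 : (w * c34) `^ p <= D * (1 + A) ^+ q.+2.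
  apply: (@le_trans _ _ ((w * (1 - (x / (2 * A)) ^+ 2) ^+ r) `^ p)).
    apply: ge0_ler_powR; rewrite ?nnegrE ?(ltW p0)//; first by rewrite mulr_ge0// ltW.
    by rewrite (le_trans _ wl)// mulr_ge0// ltW.
  apply: (le_trans H).
  have NA : (N + 2 * r)%:R <= (8 * tau + 2 + N0%:R + (2 * r)%:R) * A.
    have e : (N + 2 * r)%:R = 2 * k%:R + N0%:R + (2 * r)%:R :> R.
      by rewrite /N !natrD natrM.
    have h1 : N0%:R <= N0%:R * A by rewrite ler_peMr.
    have h2 : (2 * r)%:R <= (2 * r)%:R * A by rewrite ler_peMr.
    by rewrite e; move: h1 h2 kA' A1; clear; lra.
  have IA : I <= (q1 * (4 + B * 2 ^+ q)) * (1 + A) ^+ q.+1.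
    rewrite /I -mulrA ler_wpM2l// (mulrDl 4 (B * 2 ^+ q)); apply: lerD.
      rewrite ler_wpM2l//.
      have h : 1 <= (1 + A) ^+ q by rewrite exprn_ege1// lerDl ltW.
      by rewrite exprS; nra.
    rewrite -mulrA ler_wpM2l//.
    apply: (@le_trans _ _ ((2 * (1 + A)) ^+ q)).
      by rewrite lerXn2r ?nnegrE ?addr_ge0 ?mulr_ge0 ?addr_ge0 ?(ltW A0)//; lra.
    rewrite exprMn ler_wpM2l ?exprn_ge0// exprS ler_peMl ?exprn_ge0 ?addr_ge0 ?(ltW A0)//.
    by rewrite lerDl ltW.
  have step : q1 * K * (N + 2 * r)%:R / (2 * A) * I <=
     q1 * K * (8 * tau + 2 + N0%:R + (2 * r)%:R) *
     ((q1 * (4 + B * 2 ^+ q)) * (1 + A) ^+ q.+1).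
    apply: ler_pM => //.
      by rewrite divr_ge0 ?mulr_ge0 ?(ltW A0).
    rewrite -[_ / (2 * A)]mulrA ler_wpM2l ?mulr_ge0//.
    rewrite ler_pdivrMr// (le_trans NA)// ler_wpM2l ?addr_ge0 ?mulr_ge0//.
    lra.
  apply: (le_trans step); rewrite /D -!mulrA.
  do 4![rewrite ler_wpM2l ?addr_ge0 ?mulr_ge0 ?exprn_ge0//].
  rewrite ler_wpM2l ?addr_ge0 ?mulr_ge0 ?exprn_ge0//.
  by rewrite [leRHS]exprS ler_peMl ?exprn_ge0 ?addr_ge0 ?(ltW A0)// lerDl ltW.
have H3 : w * c34 <= (1 + D) `^ p^-1 * (1 + A) ^+ L.
  have wc0 : 0 <= w * c34 by rewrite mulr_ge0// ltW.
  have pV : 0 <= p^-1 by rewrite invr_ge0 ltW.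
  have AA : 0 <= 1 + A by rewrite addr_ge0// ltW.
  have -> : w * c34 = ((w * c34) `^ p) `^ p^-1 by rewrite -powRrM divff ?gt_eqF ?powRr1.
  apply: (@le_trans _ _ (((1 + D) * (1 + A) ^+ q.+2) `^ p^-1)).
    have E0 : 0 <= (1 + A) ^+ q.+2 by rewrite exprn_ge0.
    have D1 : 0 <= 1 + D by rewrite addr_ge0.
    apply: ge0_ler_powR; rewrite ?nnegrE ?powR_ge0//; first exact: mulr_ge0.
    by apply: (le_trans H2); apply: ler_wpM2r => //; rewrite lerDr.
  rewrite powRM ?exprn_ge0 ?addr_ge0// ler_wpM2l ?powR_ge0//.
  rewrite -!powR_mulrn// -powRrM; apply: ler_powR => //.
  by rewrite lerDl ltW.
have w1 : nc (g x%:C) <= w + 1.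
  have -> : g x%:C = (trunc c N).[x%:C] + (g x%:C - (trunc c N).[x%:C]) by ring.
  rewrite (le_trans (ncD _ _))// lerD2l hS// nc_real ler_norml; lra.
rewrite (le_trans w1)// /C' mulrDl mul1r; apply: lerD; last by rewrite exprn_ege1// lerDl.
rewrite -ler_pdivlMr// in H3; rewrite (le_trans H3)//.
rewrite mulrAC -!mulrA ler_wpM2l ?powR_ge0// ler_wpM2l ?invr_ge0 ?(ltW c0)//.
rewrite -exprMn lerXn2r ?nnegrE ?addr_ge0 ?mulr_ge0 ?addr_ge0 ?(ltW A0)// /A.
by have := normr_ge0 x; lra.
Qed.

End EntireApproximation.

(** * Normal families of polynomials *)

Section NormalFamily.
Variable R : realType.

(** Tychonoff gives a cluster point of the coefficient sequences; finitely many
    coefficients can be approximated simultaneously at arbitrarily late indices,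
    which is all that the diagonal subsequence has to provide. *)
Lemma coefficient_subsequence (s : nat -> nat -> R[i]) (b : nat -> R) :
  (forall m j, nc (s m j) <= b j) ->
  exists c : nat -> R[i], exists psi : nat -> nat, forall M, (M <= psi M)%N /\
    forall j, (j <= M)%N -> nc (s (psi M) j - c j) <= M.+1%:R^-1.
Proof.
move=> sb.
pose F m (i : nat * bool) : R :=
  if i.2 then complex.Re (s m i.1) else complex.Im (s m i.1).
pose Ks (i : nat * bool) : set R := `[- b i.1, b i.1]%classic.
pose T (i : nat * bool) : topologicalType := R.
have cK := @tychonoff (nat * bool)%type T Ks (fun i => @segment_compact R _ _).
have [|c [_ cl]] := cK (F @ \oo) _.
  by exists 0 => // m _ i; rewrite /Ks/= in_itv/= -ler_norml /F;
    case: (i.2); rewrite (le_trans _ (sb m i.1)) ?Re_le_nc ?Im_le_nc.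
have near_c (M : nat) (e : R) : 0 < e -> nbhs c
    [set f | forall j, (j <= M)%N -> forall t, `|(f (j, t) : R) - c (j, t)| < e].
  move=> e0; have one i : nbhs c [set f | `|(f i : R) - c i| < e].
    apply: (@proj_continuous _ T i c [set y : R | `|y - c i| < e]).
    apply/nbhs_normP; exists e => //= y /=; by rewrite distrC.
  elim: M => [|M IH].
    apply: filterS (filterI (one (0, true)) (one (0, false))) => f [/= h1 h2] j.
    by rewrite leqn0 => /eqP -> [].
  apply: filterS (filterI IH (filterI (one (M.+1, true)) (one (M.+1, false)))).
  move=> f [h0 [/= h1 h2]] j; rewrite leq_eqVlt => /orP[/eqP -> []//|].
  by rewrite ltnS => /h0.
pose cc j : R[i] := c (j, true) +i* c (j, false).
have ext M : exists m, (M <= m)%N /\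
    forall j, (j <= M)%N -> nc (s m j - cc j) <= M.+1%:R^-1.
  have e0 : 0 < (M.+1%:R : R)^-1 / 2 by rewrite divr_gt0// invr_gt0.
  have [|f [[m Mm <-] hf]] := cl (F @` [set m | (M <= m)%N]) _ _ (near_c M _ e0).
    by exists M => // m Mm /=; exists m.
  exists m; split=> // j jM; rewrite (le_trans (nc_le_ReIm _))//.
  rewrite ReD ImD ReN ImN/=.
  have := hf j jM true; have := hf j jM false; rewrite /F/= => h1 h2.
  by rewrite (splitr (_^-1)) lerD// ltW.
have [psi hpsi] := choice ext.
by exists cc, psi.
Qed.

Lemma polynomial_tail (Q : {poly R[i]}) (r C : R) J z : 0 < r ->
  (forall k, nc Q`_k * r ^+ k <= C) -> nc z <= r / 2 ->
  nc (Q.[z] - (trunc (fun k => Q`_k) J).[z]) <= 2 * C * (nc z / r) ^+ J.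
Proof.
move=> r0 hC hz; pose N := maxn J (size Q).
have E : Q = trunc (fun k => Q`_k) N.
  apply/polyP => k; rewrite coef_trunc; case: ltnP => //.
  by rewrite geq_max => /andP[_ h']; rewrite nth_default.
by rewrite {1}E; apply: geometric_tail => //; rewrite leq_maxl.
Qed.

(** Multiplying by [(1 - (x / A m)^2)^k] turns the weighted bound into a plain one
    without changing the limit. By [bernstein_walsh] the products are at most
    [W exp ((sigma + e) (|z| + |z|^2 / A m))] for large [m]: this makes the
    coefficient sequences bounded, so that a subsequence converges locally
    uniformly, and passes to the limit as exponential type [sigma]. *)
Lemma polynomial_compactness (sigma W : R) (k : nat) (nu : nat -> nat)
    (A : nat -> R) (P : nat -> {poly R[i]}) :
  0 < sigma -> (forall m, 1 <= A m) ->
  (forall e, 0 < e -> exists m0, forall m, (m0 <= m)%N ->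
     (nu m)%:R <= (sigma + e) * A m) ->
  (forall B, exists m0, forall m, (m0 <= m)%N -> B <= A m) ->
  (forall m, (size (P m) <= (nu m).+1)%N) ->
  (forall m x, - A m <= x <= A m ->
     nc (P m).[x%:C] * (1 - (x / A m) ^+ 2) ^+ k <= W) ->
  exists G : R[i] -> R[i], exists psi : nat -> nat,
   [/\ forall M, (M <= psi M)%N, B_space sigma G &
    forall x : R, forall e : R, 0 < e -> exists M0, forall M, (M0 <= M)%N ->
      nc ((P (psi M)).[x%:C] - G x%:C) <= e].
Proof.
move=> sg0 A1 hnu hA sP hW.
have A0 m : 0 < A m by exact: lt_le_trans (A1 m).
have W0 : 0 <= W.
  rewrite (le_trans _ (hW 0 0 _)) ?mul0r ?expr0n/= ?subr0 ?expr1n ?mulr1 ?nc_ge0//.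
  by rewrite oppr_le0 (ltW (A0 _)).
pose T m := (P m \Po ((A m)%:C *: 'X)) * (1 - 'X^2) ^+ k.
have sT m : (size (T m) <= (nu m + 2 * k).+1)%N by exact: size_weighted.
have TE m z : (T m).[z] = (P m).[(A m)%:C * z] * (1 - z ^+ 2) ^+ k.
  by rewrite /T hornerM horner_comp hornerZ hornerX horner_exp !hornerE.
have TW m x : -1 <= x <= 1 -> nc (T m).[x%:C] <= W.
  move=> hx; rewrite TE ncM -rmorphM/=.
  have -> : (1 - x%:C ^+ 2) ^+ k = ((1 - x ^+ 2) ^+ k)%:C.
    by rewrite rmorphXn rmorphB rmorphXn.
  have x2 : 0 <= 1 - x ^+ 2 by move/andP: hx => [? ?]; nra.
  rewrite nc_real ger0_norm ?exprn_ge0//.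
  have := hW m (A m * x); rewrite mulrC -mulrA divff ?gt_eqF// mulr1 [x * _]mulrC.
  by apply; have := A0 m; move/andP: hx => [? ?]; nra.
pose S m := T m \Po ((A m)^-1%:C *: 'X).
have SE m z : (S m).[z] = (T m).[(A m)^-1%:C * z].
  by rewrite /S horner_comp hornerZ hornerX.
have hN e : 0 < e -> exists m0, forall m, (m0 <= m)%N ->
    (nu m + 2 * k)%:R <= (sigma + e) * A m.
  move=> e0; have e2 : 0 < e / 2 by rewrite divr_gt0.
  have [m1 h1] := hnu _ e2; have [m2 h2] := hA ((2 * k)%:R / (e / 2)).
  exists (maxn m1 m2) => m; rewrite geq_max => /andP[/h1 u1 /h2].
  rewrite ler_pdivrMr// natrD => u2.
  have -> : (sigma + e) * A m = (sigma + e / 2) * A m + A m * (e / 2) by field.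
  exact: lerD.
have SW e : 0 < e -> exists m0, forall m, (m0 <= m)%N -> forall z,
    nc (S m).[z] <= W * expR ((sigma + e) * (nc z + nc z ^+ 2 / A m)).
  move=> e0; have [m0 h0] := hN _ e0; exists m0 => m /h0 h z.
  rewrite SE (le_trans (bernstein_walsh (sT m) (TW m) _))// ler_wpM2l// ler_expR.
  rewrite ncM nc_real (gtr0_norm (_ : 0 < (A m)^-1)) ?invr_gt0//.
  have -> : (sigma + e) * (nc z + nc z ^+ 2 / A m) =
     (sigma + e) * A m * ((A m)^-1 * nc z + ((A m)^-1 * nc z) ^+ 2).
    by field; rewrite gt_eqF.
  by rewrite ler_wpM2r// addr_ge0 ?sqr_ge0// mulr_ge0 ?nc_ge0// invr_ge0 ltW.
have [m0 hm0] := SW 1 ltr01.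
pose Wb (r : R) := W * expR ((sigma + 1) * (r + r ^+ 2)).
have hWb m z : nc (S (m + m0)%N).[z] <= Wb (nc z).
  rewrite (le_trans (hm0 _ (leq_addl _ _) z))// ler_wpM2l// ler_expR.
  rewrite ler_wpM2l ?addr_ge0 ?(ltW sg0)// lerD2l ler_pdivrMr//.
  by rewrite ler_peMr ?sqr_ge0.
have coefS m j r : 0 < r -> nc (S (m + m0)%N)`_j * r ^+ j <= Wb r.
  by move=> r0; apply: poly_cauchy => // z <-; exact: hWb.
have [c [psi hpsi]] := @coefficient_subsequence (fun m j => (S (m + m0)%N)`_j)
  (fun=> Wb 1) (fun m j => ltac:(by have := coefS m j 1 ltr01;
     rewrite expr1n mulr1)).
have coefc j r : 0 < r -> nc (c j) * r ^+ j <= Wb r.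
  move=> r0; apply/ler_addgt0Pr => e e0.
  have e1 : 0 < e / r ^+ j by rewrite divr_gt0 ?exprn_gt0.
  pose M := maxn j (Num.trunc (e / r ^+ j)^-1).+1.
  have [_ h] := hpsi M; have {h} := h j (leq_maxl _ _).
  have ME : M.+1%:R^-1 <= e / r ^+ j.
    rewrite -[leRHS]invrK lef_pV2 ?posrE ?invr_gt0//.
    rewrite (le_trans (ltW (truncnS_gt _)))// ler_nat.
    by rewrite (leq_trans (leq_maxr j _)).
  move=> /le_trans /(_ ME) H.
  have -> : c j = (S (psi M + m0)%N)`_j - ((S (psi M + m0)%N)`_j - c j) by ring.
  apply: (@le_trans _ _ ((nc (S (psi M + m0)%N)`_j + e / r ^+ j) * r ^+ j)).
    rewrite ler_wpM2r ?exprn_ge0 ?(ltW r0)// (le_trans (ncB _ _))//.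
    by rewrite lerD2l.
  by rewrite mulrDl divfK ?gt_eqF ?exprn_gt0// lerD2r; exact: coefS.
have [G hG] : exists G, has_taylor G c.
  by apply: power_series_entire => r r0; exists (Wb r) => j; exact: coefc.
have dG := has_taylor_cderivable hG.
have lim z e : 0 < e -> exists M0, forall M, (M0 <= M)%N ->
    nc ((S (psi M + m0)%N).[z] - G z) <= e.
  move=> e0; pose r := 2 * nc z + 1.
  have z0 := nc_ge0 z.
  have r0 : 0 < r by rewrite /r; lra.
  have zr : nc z <= r / 2 by rewrite /r; lra.
  have Wb0 : 0 <= Wb r by rewrite mulr_ge0 ?expR_ge0.
  have e4 : 0 < e / 4 by rewrite divr_gt0.
  have [J hJ] := @exp2V_small _ (2 * Wb r) _ (mulr_ge0 (ler0n _ 2) Wb0) e4.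
  have {}hJ := hJ J (leqnn _).
  have half : 2 * Wb r * (nc z / r) ^+ J <= e / 4.
    apply: le_trans hJ; rewrite ler_wpM2l ?mulr_ge0// -exprVn.
    rewrite lerXn2r ?nnegrE ?divr_ge0 ?nc_ge0 ?(ltW r0)//.
    by rewrite ler_pdivrMr//; lra.
  pose B := J%:R * (1 + nc z) ^+ J.
  have B0 : 0 <= B by rewrite mulr_ge0 ?exprn_ge0 ?addr_ge0.
  exists (maxn J (Num.trunc (B / (e / 4))).+1) => M.
  rewrite geq_max => /andP[JM MB].
  set Sm := S _.
  have h1 := polynomial_tail J r0 (fun j => coefS (psi M) j r r0) zr.
  have h2 := taylor_tail J hG r0 (fun j => coefc j r r0) zr.
  have h3 : nc ((trunc (fun j => Sm`_j) J).[z] - (trunc c J).[z]) <= e / 4.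
    rewrite /trunc !horner_poly -sumrB (le_trans (nc_sum _ _ _))//.
    apply: (@le_trans _ _ (\sum_(j < J) (M.+1%:R^-1 * (1 + nc z) ^+ J))).
      apply: ler_sum => j _; rewrite -mulrBl ncM ncX.
      have jM : (j <= M)%N by rewrite (leq_trans _ JM)// ltnW.
      apply: ler_pM; rewrite ?nc_ge0 ?exprn_ge0//; first by have [_ ->] := hpsi M.
      apply: (@le_trans _ _ ((1 + nc z) ^+ j)).
        by rewrite lerXn2r ?nnegrE ?addr_ge0// lerDr.
      by apply: ler_weXn2l; [rewrite lerDl|rewrite ltnW].
    rewrite sumr_const card_ord -[_ *+ J]mulr_natr mulrAC -mulrA -/B.
    rewrite mulrC ler_pdivrMr// [leRHS]mulrC -ler_pdivrMr// (le_trans (ltW (truncnS_gt _)))// ler_nat.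
    by rewrite (leq_trans MB).
  have -> : Sm.[z] - G z = (Sm.[z] - (trunc (fun j => Sm`_j) J).[z]) +
    ((trunc (fun j => Sm`_j) J).[z] - (trunc c J).[z]) - (G z - (trunc c J).[z]).
    by ring.
  rewrite (le_trans (ncB _ _))//.
  have := le_trans (ncD (Sm.[z] - (trunc (fun j => Sm`_j) J).[z])
    ((trunc (fun j => Sm`_j) J).[z] - (trunc c J).[z]))
    (lerD (le_trans h1 half) h3).
  have := le_trans h2 half.
  lra.
have psiM M : (M <= psi M + m0)%N by rewrite (leq_trans (hpsi M).1)// leq_addr.
exists G, (fun M => psi M + m0)%N; split=> //.
- split; first by apply/entireP.
  move=> e e0; exists (W * expR 1) => z.
  rewrite -mulrA -expRD; apply/ler_addgt0Pr => d d0.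
  have [M1 h1] := lim z _ d0; have [m1 h2] := SW _ e0.
  have [m2 h3] := hA ((sigma + e) * nc z ^+ 2).
  pose M := maxn M1 (maxn m1 m2).
  have H1 := h1 M (leq_maxl _ _).
  have H2 := h2 (psi M + m0)%N
    (leq_trans (leq_trans (leq_maxl m1 m2) (leq_maxr M1 _)) (psiM M)) z.
  have H3 := h3 (psi M + m0)%N
    (leq_trans (leq_trans (leq_maxr m1 m2) (leq_maxr M1 _)) (psiM M)).
  have -> : G z = (S (psi M + m0)%N).[z] - ((S (psi M + m0)%N).[z] - G z) by ring.
  rewrite (le_trans (ncB _ _))// lerD// (le_trans H2)// ler_wpM2l// ler_expR.
  rewrite mulrDr addrC lerD2r mulrA ler_pdivrMr// mul1r//.
- move=> x e e0.
  have e2 : 0 < e / 2 by rewrite divr_gt0.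
  have [M1 h1] := lim x%:C _ e2.
  pose Wx := Wb (nc x%:C).
  have Wx0 : 0 <= Wx by rewrite mulr_ge0 ?expR_ge0.
  (* the weight at [x] is at least [1 - k (x / A)^2] *)
  pose q := k%:R * x ^+ 2.
  have q0 : 0 <= q by rewrite mulr_ge0 ?sqr_ge0.
  have [m1 h2] := hA (2 * q + `|x| + 4 * q * Wx / e).
  exists (maxn M1 m1) => M; rewrite geq_max => /andP[MM1 Mm1].
  set m := (psi M + m0)%N.
  have H2 : 2 * q + `|x| + 4 * q * Wx / e <= A m.
    by apply: h2; rewrite (leq_trans Mm1).
  have H1 := h1 M MM1.
  have t0 : 0 <= 4 * q * Wx / e.
    by apply: divr_ge0 (ltW e0); apply: mulr_ge0 => //; apply: mulr_ge0.
  have xA : `|x| <= A m by have := normr_ge0 x; lra.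
  pose w := (1 - (x / A m) ^+ 2) ^+ k.
  have x1 : `|x / A m| <= 1.
    by rewrite normrM normfV (gtr0_norm (A0 m)) ler_pdivrMr// mul1r.
  have y0 : 0 <= (x / A m) ^+ 2 by exact: sqr_ge0.
  have y1 : (x / A m) ^+ 2 <= 1.
    by rewrite -real_normK ?num_real// expr_le1.
  have w1 : 1 - q / A m <= w.
    apply: (@le_trans _ _ (1 - k%:R * (x / A m) ^+ 2)).
      rewrite lerD2l lerN2 /q -mulrA ler_wpM2l// expr_div_n ler_wpM2l ?sqr_ge0//.
      by rewrite lef_pV2 ?posrE ?exprn_gt0// expr2 ler_peMr// ltW.
    rewrite /w; elim: (k) => [|j IH]; first by rewrite mul0r subr0 expr0.
    rewrite (exprS _ j).
    have y2 : 0 <= 1 - (x / A m) ^+ 2 by rewrite subr_ge0.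
    apply: le_trans (ler_wpM2l y2 IH); rewrite -natr1.
    set y := (x / A m) ^+ 2.
    have -> : (1 - y) * (1 - j%:R * y) = 1 - (j%:R + 1) * y + j%:R * y ^+ 2 by ring.
    by rewrite lerDl mulr_ge0 ?sqr_ge0.
  have qA : q / A m <= 1 / 2.
    by rewrite ler_pdivrMr//; have := normr_ge0 x; lra.
  have qW : q / A m * (2 * Wx) <= e / 2.
    rewrite mulrAC ler_pdivrMr//.
    have : 4 * q * Wx / e <= A m by have := normr_ge0 x; lra.
    by rewrite ler_pdivrMr//; lra.
  have SP : (S m).[x%:C] = (P m).[x%:C] * w%:C.
    rewrite SE TE -!rmorphM/=; congr (_ * _).
      by rewrite mulrA divff ?gt_eqF// mul1r.
    by rewrite /w rmorphXn rmorphB rmorphXn/= [x / _]mulrC.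
  have w0 : 1 / 2 <= w by lra.
  have wle : w <= 1 by rewrite /w exprn_ile1 ?subr_ge0 ?gerBl.
  have SWx : nc (S m).[x%:C] <= Wx by exact: hWb.
  have PS : nc ((P m).[x%:C] - (S m).[x%:C]) <= e / 2.
    have wp : 0 < w by lra.
    have -> : (P m).[x%:C] - (S m).[x%:C] = (P m).[x%:C] * (1 - w)%:C.
      by rewrite SP rmorphB/=; ring.
    have w2 : 0 <= 1 - w by lra.
    rewrite ncM nc_real (ger0_norm w2).
    have Pb : nc (P m).[x%:C] <= 2 * Wx.
      have : nc (P m).[x%:C] * w <= Wx.
        by move: SWx; rewrite SP ncM nc_real (gtr0_norm wp).
      have := nc_ge0 (P m).[x%:C]; nra.
    apply: le_trans qW; rewrite mulrC; apply: ler_pM; rewrite ?nc_ge0//; lra.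
  have -> : (P m).[x%:C] - G x%:C =
    ((P m).[x%:C] - (S m).[x%:C]) + ((S m).[x%:C] - G x%:C) by ring.
  by rewrite (le_trans (ncD _ _))// (splitr e) lerD.
Qed.

End NormalFamily.

(** * Lebesgue norms of complex valued functions *)

Section Measure.
Variable R : realType.
Implicit Types (f g : R -> R[i]) (r l : R) (Om : set R).

Local Notation LS := (lebesgue_space R).
Local Notation mu := (@completed_lebesgue_measure R).
Local Notation lmf := (@lebesgue_measurable_fun R).

Lemma borel_lebesgue_measurable (A : set R) :
  measurable (A : set (measurableTypeR R)) -> measurable (A : set LS).
Proof. exact: sub_caratheodory. Qed.

Lemma borel_fun_lebesgue_measurable (h : R -> R) :
  measurable_fun [set: measurableTypeR R] (h : measurableTypeR R -> R) ->
  measurable_fun [set: LS] (h : LS -> R).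
Proof.
move=> mh _ Y mY; apply: borel_lebesgue_measurable.
by apply: mh.
Qed.

Lemma itv_lebesgue_measurable (i : interval R) : measurable ([set` i] : set LS).
Proof. by apply: borel_lebesgue_measurable; exact: measurable_itv. Qed.

Lemma completed_measure_itv (u v : R) : u <= v ->
  mu (`[u, v]%classic : set LS) = (v - u)%:E.
Proof.
move=> uv; have := @lebesgue_measure_itv R `[u, v].
have -> : lebesgue_measure `[u, v]%classic = mu (`[u, v]%classic : set LS) by [].
move=> ->/=; rewrite lte_fin; case: ltP => // vu.
by have -> : u = v by [apply/le_anti; rewrite uv]; rewrite subrr.
Qed.

Lemma completed_measureT_gt0 : (0 < mu ([set: R] : set LS))%E.
Proof.
apply: (@lt_le_trans _ _ (mu (`[0, 1]%classic : set LS))).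
  by rewrite completed_measure_itv// subr0 lte_fin.
by apply: le_measure => //; rewrite inE;
  [exact: itv_lebesgue_measurable|exact: measurableT].
Qed.

Lemma lmf_nc f : lmf f -> measurable_fun [set: LS] ((fun x => nc (f x)) : LS -> R).
Proof.
move=> [mr mi].
have -> : (fun x => nc (f x)) =
    (fun x => ((complex.Re (f x)) ^+ 2 + (complex.Im (f x)) ^+ 2) `^ 2^-1).
  by apply/funext => x; rewrite powR12_sqrt ?addr_ge0 ?sqr_ge0//;
    case: (f x).
apply: (measurableT_comp (measurable_powR _)).
by apply: measurable_funD; apply: measurable_funX.
Qed.

Lemma lmf_nc_powR r f : lmf f ->
  measurable_fun [set: LS] ((fun x => nc (f x) `^ r) : LS -> R).
Proof. by move=> /lmf_nc mf; apply: (measurableT_comp (measurable_powR _)). Qed.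

Lemma lmfB f g : lmf f -> lmf g -> lmf (fun x => f x - g x).
Proof.
move=> [fr fi] [gr gi]; split.
  rewrite (_ : (fun x => _) = (fun x => complex.Re (f x) - complex.Re (g x))).
    exact: measurable_funB.
  by apply/funext => x; rewrite ReD ReN.
rewrite (_ : (fun x => _) = (fun x => complex.Im (f x) - complex.Im (g x))).
  exact: measurable_funB.
by apply/funext => x; rewrite ImD ImN.
Qed.

Lemma lmfN f : lmf f -> lmf (fun x => - f x).
Proof.
move=> [fr fi]; split.
  rewrite (_ : (fun x => _) = (fun x => - complex.Re (f x))).
    exact: measurable_funN.
  by apply/funext => x; rewrite ReN.
rewrite (_ : (fun x => _) = (fun x => - complex.Im (f x))).
  exact: measurable_funN.
by apply/funext => x; rewrite ImN.
Qed.

Lemma lmfD f g : lmf f -> lmf g -> lmf (fun x => f x + g x).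
Proof.
move=> mf /lmfN mg.
rewrite (_ : (fun x => _) = (fun x => f x - - g x)); first exact: lmfB.
by apply/funext => x; rewrite opprK.
Qed.

Definition power_integral r Om f : \bar R :=
  (\int[mu]_(x in (Om : set LS)) (nc (f x) `^ r)%:E)%E.

(** The form of an [L_p] bound in which no root is taken, so that the estimates
    below are additive for finite exponents and pointwise for [+oo]. *)
Definition Lp_le (p : \bar R) Om f l : Prop :=
  match p with
  | r%:E => (power_integral r Om f <= (l `^ r)%:E)%E
  | _ => \forall x \ae mu, (Om : set LS) x -> nc (f x) <= l
  end.

Lemma Lp_normP p Om f l : (0 < p)%E -> 0 <= l ->
  (Lp_norm p Om f <= l%:E)%E <-> Lp_le p Om f l.
Proof.
case: p => [r|_|//]; rewrite /Lp_norm.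
- rewrite lte_fin => r0 l0 /=.
  have E : ('N[mu]_r%:E[(fun x : R => (nc (f x))%:E) \_ Om] `^ r)%E =
      power_integral r Om f.
    rewrite poweR_Lnorm ?gt_eqF// /power_integral [RHS]integral_mkcond.
    apply: eq_integral => x _; rewrite /patch; case: ifP => _.
      by rewrite /= ger0_norm ?nc_ge0.
    by rewrite /= normr0 powR0 ?gt_eqF.
  rewrite -E; set L := 'N[mu]_ _ [_]%E; have L0 : (0 <= L)%E by exact: Lnorm_ge0.
  split=> h.
    rewrite -poweR_EFin; apply: gt0_ler_poweR; rewrite ?(ltW r0)//.
      by rewrite in_itv/= L0 leey.
    by rewrite in_itv/= lee_fin l0 leey.
  have -> : L = ((L `^ r) `^ r^-1)%E by rewrite -poweRrM divff ?gt_eqF// poweRe1.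
  have -> : l%:E = ((l%:E `^ r) `^ r^-1)%E.
    by rewrite -poweRrM divff ?gt_eqF// poweRe1// lee_fin.
  apply: gt0_ler_poweR; rewrite ?invr_ge0 ?(ltW r0)//.
  - by rewrite in_itv/= poweR_ge0 leey.
  - by rewrite in_itv/= lee_fin powR_ge0 leey.
- move=> l0; rewrite unlock completed_measureT_gt0 /=.
  split=> [/ess_supP|] h.
    apply: filterS h => x /=; rewrite /patch => + xO.
    by rewrite mem_set//= lee_fin ger0_norm ?nc_ge0.
  apply/ess_supP; apply: filterS h => x /=.
  rewrite /patch; case: ifPn => [/set_mem xO /(_ xO)|_ _].
    by rewrite /= lee_fin ger0_norm ?nc_ge0.
  by rewrite /= normr0 lee_fin.
Qed.

End Measure.

Section NonnegativeIntegral.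
Context d (T : measurableType d) (R : realType) (mu : {measure set T -> \bar R}).
Implicit Types (u v w : T -> R) (D : set T).

Lemma ge0_integral_subset D D' u : measurable D -> measurable D' ->
  measurable_fun setT u -> (forall x, 0 <= u x) -> D `<=` D' ->
  (\int[mu]_(x in D) (u x)%:E <= \int[mu]_(x in D') (u x)%:E)%E.
Proof.
move=> mD mD' mu0 u0 DD; apply: ge0_subset_integral => //.
  by apply: measurable_funTS; apply/measurable_EFinP.
by move=> x _; rewrite lee_fin.
Qed.

Lemma ge0_integral_le_affine D u v w a b : measurable D ->
  measurable_fun setT u -> measurable_fun setT v -> measurable_fun setT w ->
  0 <= a -> 0 <= b -> (forall x, 0 <= u x) -> (forall x, 0 <= v x) ->
  (forall x, 0 <= w x) -> (forall x, w x <= a * u x + b * v x) ->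
  (\int[mu]_(x in D) (w x)%:E <=
   a%:E * \int[mu]_(x in D) (u x)%:E + b%:E * \int[mu]_(x in D) (v x)%:E)%E.
Proof.
move=> mD mu0 mv mw a0 b0 u0 v0 w0 h.
have mE k : measurable_fun setT k -> measurable_fun D (EFin \o k).
  by move=> mk; apply: measurable_funTS; apply/measurable_EFinP.
rewrite -!ge0_integralZl//; try by [exact: mE|move=> x _; rewrite lee_fin].
rewrite -ge0_integralD//.
- apply: ge0_le_integral => //.
  + by move=> x _; rewrite lee_fin.
  + exact: mE.
  + by apply: emeasurable_funD; apply: measurable_funeM; exact: mE.
  + by move=> x _; rewrite -!EFinM -EFinD lee_fin.
- by move=> x _; rewrite mule_ge0// lee_fin.
- by apply: measurable_funeM; exact: mE.
- by move=> x _; rewrite mule_ge0// lee_fin.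
- by apply: measurable_funeM; exact: mE.
Qed.

Lemma ge0_integral_le_cst D u e : measurable D -> measurable_fun setT u ->
  (forall x, 0 <= u x) -> (forall x, D x -> u x <= e) ->
  (\int[mu]_(x in D) (u x)%:E <= e%:E * mu D)%E.
Proof.
move=> mD mu0 u0 ue; rewrite -integral_cst//; apply: ge0_le_integral => //.
- by move=> x _; rewrite lee_fin.
- by apply: measurable_funTS; apply/measurable_EFinP.
Qed.

Lemma cst_le_ge0_integral D u e : measurable D -> measurable_fun setT u ->
  0 <= e -> (forall x, D x -> e <= u x) ->
  (e%:E * mu D <= \int[mu]_(x in D) (u x)%:E)%E.
Proof.
move=> mD mu0 e0 ue; rewrite -integral_cst//; apply: ge0_le_integral => //.
- by apply: measurable_funTS; apply/measurable_EFinP.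
Qed.

End NonnegativeIntegral.

Section LpBounds.
Variable R : realType.
Implicit Types (f g : R -> R[i]) (r l : R) (Om : set R).

Local Notation LS := (lebesgue_space R).
Local Notation mu := (@completed_lebesgue_measure R).
Local Notation lmf := (@lebesgue_measurable_fun R).

Lemma ccontinuous_lmf (g : R[i] -> R[i]) : (forall z, ccontinuous g z) ->
  lmf (fun x => g x%:C).
Proof.
have cont (h : R -> R) : (forall x e, 0 < e -> exists2 d : R, 0 < d &
    forall y, `|y - x| <= d -> `|h y - h x| <= e) -> continuous h.
  move=> ch x; apply/cvgrPdist_le => e e0; have [d d0 hd] := ch x e e0.
  apply/nbhs_ballP; exists d => // y /=; rewrite /ball/= => xy.
  by rewrite distrC hd// distrC ltW.
move=> cg; split; apply: borel_fun_lebesgue_measurable;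
  apply: continuous_measurable_fun; apply: cont => x e e0;
  have [d d0 hd] := cg x%:C e e0; exists d => // y yx;
  have := hd y%:C; rewrite -rmorphB nc_real => /(_ yx); apply: le_trans.
  by rewrite -ReN -ReD Re_le_nc.
by rewrite -ImN -ImD Im_le_nc.
Qed.

Lemma cderivable_lmf (g : R[i] -> R[i]) : (forall z, cderivable g z) ->
  lmf (fun x => g x%:C).
Proof. by move=> dg; apply: ccontinuous_lmf => z; exact: cderivable_ccontinuous. Qed.

Lemma poly_lmf (P : {poly R[i]}) : lmf (fun x => P.[x%:C]).
Proof.
apply: (@cderivable_lmf (fun z => P.[z])) => z; exact: cderivable_horner.
Qed.

Lemma power_integral_ge0 r Om f : (0 <= power_integral r Om f)%E.
Proof. by apply: integral_ge0 => x _; rewrite lee_fin powR_ge0. Qed.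

Lemma power_integral_subset r (Om Om' : set R) f :
  measurable (Om : set LS) -> measurable (Om' : set LS) -> lmf f ->
  Om `<=` Om' -> (power_integral r Om f <= power_integral r Om' f)%E.
Proof.
move=> mO mO' mf OO.
exact: (ge0_integral_subset _ mO mO' (lmf_nc_powR r mf) (fun=> powR_ge0 _ _) OO).
Qed.

(** Compare [b] with [d a]. This replaces Minkowski's inequality and is valid
    for all positive exponents. *)
Lemma powR_add_le r d (a b : R) : 0 < r -> 0 < d -> 0 <= a -> 0 <= b ->
  (a + b) `^ r <= (1 + d) `^ r * a `^ r + (1 + d^-1) `^ r * b `^ r.
Proof.
move=> r0 d0 a0 b0; have di : 0 < d^-1 by rewrite invr_gt0.
have p1 : 0 <= 1 + d by lra.
have p2 : 0 <= 1 + d^-1 by lra.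
rewrite -!powRM//.
have [ba|ab] := leP b (d * a).
  rewrite (le_trans _ (_ : ((1 + d) * a) `^ r <= _)) ?lerDl ?powR_ge0//.
  apply: ge0_ler_powR; rewrite ?nnegrE ?(ltW r0) ?addr_ge0 ?mulr_ge0//.
  by rewrite mulrDl mul1r lerD2l.
rewrite (le_trans _ (_ : ((1 + d^-1) * b) `^ r <= _)) ?lerDr ?powR_ge0//.
apply: ge0_ler_powR; rewrite ?nnegrE ?(ltW r0) ?addr_ge0 ?mulr_ge0//.
rewrite mulrDl mul1r [a + b]addrC lerD2l mulrC ler_pdivlMr// mulrC.
exact: ltW.
Qed.

Lemma power_integralD r d Om f g : 0 < r -> 0 < d ->
  measurable (Om : set LS) -> lmf f -> lmf g ->
  (power_integral r Om (fun x => f x + g x)%R <=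
   ((1 + d) `^ r)%R%:E * power_integral r Om f +
   ((1 + d^-1) `^ r)%R%:E * power_integral r Om g)%E.
Proof.
move=> r0 d0 mO mf mg.
apply: (ge0_integral_le_affine _ mO (lmf_nc_powR r mf) (lmf_nc_powR r mg)
  (lmf_nc_powR r (lmfD mf mg)) (powR_ge0 _ _) (powR_ge0 _ _)
  (fun=> powR_ge0 _ _) (fun=> powR_ge0 _ _) (fun=> powR_ge0 _ _)) => x.
apply: le_trans (powR_add_le r0 d0 (nc_ge0 _) (nc_ge0 _)).
by apply: ge0_ler_powR; rewrite ?nnegrE ?(ltW r0) ?addr_ge0 ?nc_ge0// ncD.
Qed.

Lemma power_integral_bounded r A e f : 0 < r -> 0 <= A -> 0 <= e -> lmf f ->
  (forall x, - A <= x <= A -> nc (f x) <= e) ->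
  (power_integral r (`[- A, A]%classic)%R f <= (e `^ r * (2 * A))%R%:E)%E.
Proof.
move=> r0 A0 e0 mf hf; rewrite EFinM.
have -> : (2 * A)%:E = mu (`[- A, A]%classic : set LS).
  rewrite completed_measure_itv; last by lra.
  by rewrite opprK mulrDl mul1r.
apply: (ge0_integral_le_cst _ (@itv_lebesgue_measurable R _) (lmf_nc_powR r mf)
  (fun=> powR_ge0 _ _)) => x /=; rewrite in_itv/= => xA.
by apply: ge0_ler_powR; rewrite ?nnegrE ?(ltW r0) ?nc_ge0// hf.
Qed.

Lemma interval_minorant r A I f (u v l : R) : lmf f ->
  (power_integral r (`[- A, A]%classic)%R f <= I%:E)%E -> - A <= u -> u < v -> v <= A ->
  0 <= l -> (forall x, u <= x <= v -> l <= nc (f x) `^ r) -> (v - u) * l <= I.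
Proof.
move=> mf hI Au uv vA l0 hl; rewrite -lee_fin; apply: le_trans hI.
have muv := @itv_lebesgue_measurable R `[u, v].
apply: le_trans (power_integral_subset r muv (@itv_lebesgue_measurable R _) mf _).
  rewrite mulrC EFinM -completed_measure_itv ?(ltW uv)//.
  apply: (cst_le_ge0_integral _ muv (lmf_nc_powR r mf) l0) => x /=.
  by rewrite in_itv/= => /hl.
by apply: subset_itv; rewrite bnd_simp.
Qed.

Lemma ae_interval_point (u v : R) (P : R -> Prop) : u < v ->
  (\forall x \ae mu, P x) -> exists2 x, u <= x <= v & P x.
Proof.
move=> uv [M [mM M0 sM]]; apply: contrapT => h.
have : (mu (`[u, v]%classic : set LS) <= mu M)%E.
  apply: le_measure; rewrite ?inE//; first exact: itv_lebesgue_measurable.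
  move=> x /=; rewrite in_itv/= => xuv; apply: sM => /= Px.
  by apply: h; exists x.
rewrite completed_measure_itv ?(ltW uv)//.
have -> : mu M = 0%E by [].
by rewrite lee_fin subr_le0 leNgt uv.
Qed.

Lemma ae_continuous_le A l (g : R[i] -> R[i]) : 0 < A ->
  (forall z, ccontinuous g z) ->
  (\forall x \ae mu, (`[- A, A]%classic : set R) x -> nc (g x%:C) <= l) ->
  forall x, - A <= x <= A -> nc (g x%:C) <= l.
Proof.
move=> A0 cg hl x xA; apply/ler_addgt0Pr => e e0.
have [d d0 hd] := cg x%:C e e0.
have key y : `|y - x| <= d -> - A <= y <= A -> nc (g y%:C) <= l ->
    nc (g x%:C) <= l + e.
  move=> yd yA gy.
  have -> : g x%:C = g y%:C - (g y%:C - g x%:C) by ring.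
  rewrite (le_trans (ncB _ _))// lerD// hd// -rmorphB nc_real//.
pose m := Num.min d A.
have m0 : 0 < m by rewrite lt_min d0.
have md : m <= d by rewrite ge_min lexx.
have mA : m <= A by rewrite ge_min lexx orbT.
have [x0|x0] := lerP 0 x.
  have [] := @ae_interval_point (x - m) x _ _ hl; first by move: m0; clear; lra.
  move=> y yx; rewrite /= in_itv/= => hy; move/andP: xA yx => [h1 h2] /andP[h3 h4].
  have yA : - A <= y <= A by apply/andP; split; clear -h1 h2 h3 h4 mA x0; lra.
  apply: (key y) (yA) (hy yA).
  by rewrite ler_norml; apply/andP; split; clear -h3 h4 md d0; lra.
have [] := @ae_interval_point x (x + m) _ _ hl; first by move: m0; clear; lra.
move=> y yx; rewrite /= in_itv/= => hy; move/andP: xA yx => [h1 h2] /andP[h3 h4].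
have yA : - A <= y <= A by apply/andP; split; clear -h1 h2 h3 h4 mA x0; lra.
apply: (key y) (yA) (hy yA).
by rewrite ler_norml; apply/andP; split; clear -h3 h4 md d0; lra.
Qed.

Lemma Lp_le_subset p (Om Om' : set R) f l :
  measurable (Om : set LS) -> measurable (Om' : set LS) -> lmf f ->
  Om `<=` Om' -> Lp_le p Om' f l -> Lp_le p Om f l.
Proof.
move=> mO mO' mf OO; case: p => [r||] /=; first by apply: le_trans;
  exact: power_integral_subset.
all: by apply: filterS => x /= h /OO; exact: h.
Qed.

Lemma Lp_leN p Om f l : Lp_le p Om f l -> Lp_le p Om (fun x => - f x) l.
Proof.
case: p => [r||] /=.
- apply: le_trans; rewrite /power_integral le_eqVlt; apply/orP; left; apply/eqP.
  by apply: eq_integral => x _; rewrite ncN.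
all: by apply: filterS => x /= h /h; rewrite ncN.
Qed.

Lemma Lp_leD p l1 l2 : (0 < p)%E -> 0 <= l1 -> 0 <= l2 ->
  exists2 l, 0 <= l & forall Om f g, measurable (Om : set LS) -> lmf f -> lmf g ->
    Lp_le p Om f l1 -> Lp_le p Om g l2 -> Lp_le p Om (fun x => f x + g x) l.
Proof.
case: p => [r|_|//]; last first.
  move=> l10 l20; exists (l1 + l2); first exact: addr_ge0.
  move=> Om f g mO mf mg /= h1 h2; apply: filterS2 h1 h2 => x h1 h2 xO.
  by rewrite (le_trans (ncD _ _))// lerD// ?h1 ?h2.
rewrite lte_fin => r0 l10 l20.
pose S : R := (1 + 1) `^ r * l1 `^ r + (1 + 1^-1) `^ r * l2 `^ r.
have S0 : 0 <= S by rewrite addr_ge0 ?mulr_ge0 ?powR_ge0.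
exists (S `^ r^-1); first exact: powR_ge0.
move=> Om f g mO mf mg /= h1 h2.
rewrite -powRrM mulVf ?gt_eqF// powRr1//.
apply: le_trans (power_integralD r0 ltr01 mO mf mg) _.
rewrite EFinD !EFinM; apply: leeD; apply: lee_wpmul2l => //.
all: by rewrite lee_fin powR_ge0.
Qed.

(** For finite exponents this is [powR_add_le] with [d] so small that
    [(1 + d) l1] stays below [l]; it takes the place of the triangle inequality
    for all exponents at once. *)
Lemma Lp_le_perturb p l1 l : (0 < p)%E -> 0 <= l1 -> l1 < l ->
  exists2 d, 0 < d & forall Om f g, measurable (Om : set LS) -> lmf f -> lmf g ->
    Lp_le p Om f l1 -> Lp_le p Om g d -> Lp_le p Om (fun x => f x + g x) l.
Proof.
case: p => [r|_|//]; last first.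
  move=> l10 ll; exists (l - l1); first by rewrite subr_gt0.
  move=> Om f g mO mf mg /= h1 h2; apply: filterS2 h1 h2 => x h1 h2 xO.
  rewrite (le_trans (ncD _ _))//; have := h1 xO; have := h2 xO; lra.
rewrite lte_fin => r0 l10 ll.
pose d : R := (l - l1) / 2 / (l1 + 1).
have d0 : 0 < d by rewrite !divr_gt0 ?subr_gt0// ltr_wpDl.
pose l2 : R := (l1 + l) / 2.
have l20 : 0 <= l2 by rewrite /l2; lra.
have dl : (1 + d) * l1 <= l2.
  have : d * l1 <= (l - l1) / 2.
    rewrite /d mulrAC ler_pdivrMr; last lra.
    by rewrite ler_wpM2l//; lra.
  by rewrite /l2; lra.
pose c : R := l `^ r - l2 `^ r.
have c0 : 0 < c.
  rewrite subr_gt0; apply: gt0_ltr_powR; rewrite ?nnegrE//; rewrite /l2; lra.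
have di : 0 < 1 + d^-1 by rewrite addr_gt0 ?invr_gt0.
exists (c `^ r^-1 / (1 + d^-1)); first by rewrite divr_gt0 ?powR_gt0.
move=> Om f g mO mf mg /= h1 h2.
apply: le_trans (power_integralD r0 d0 mO mf mg) _.
have -> : l `^ r = l2 `^ r + c by rewrite /c; lra.
rewrite EFinD; apply: leeD.
  apply: (@le_trans _ _ (((1 + d) `^ r)%:E * (l1 `^ r)%:E)%E).
    by apply: lee_wpmul2l; rewrite // lee_fin powR_ge0.
  rewrite -EFinM lee_fin -powRM//; last lra.
  by apply: ge0_ler_powR; rewrite ?nnegrE ?(ltW r0)// mulr_ge0//; lra.
apply: (@le_trans _ _
    (((1 + d^-1) `^ r)%:E * ((c `^ r^-1 / (1 + d^-1)) `^ r)%:E)%E).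
  by apply: lee_wpmul2l; rewrite // lee_fin powR_ge0.
rewrite -EFinM lee_fin -powRM ?divr_ge0 ?powR_ge0 ?(ltW di)//.
by rewrite mulrC divfK ?gt_eqF// -powRrM mulVf ?gt_eqF// powRr1// ltW.
Qed.

(** The dependence of the norm of a bounded function on the length of the
    interval is polynomial, hence negligible against arbitrary powers. *)
Lemma Lp_le_bounded p : (0 < p)%E -> exists m : nat, forall A e l f, 1 <= A ->
  0 <= e -> lmf f -> (forall x, - A <= x <= A -> nc (f x) <= e) ->
  e * (2 * A) ^+ m <= l -> Lp_le p `[- A, A] f l.
Proof.
case: p => [r|_|//]; last first.
  exists 0%N => A e l f A1 e0 mf hf /=; rewrite expr0 mulr1 => el.
  by apply: aeW => x /=; rewrite in_itv/= => /hf /le_trans; apply.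
rewrite lte_fin => r0; exists (Num.trunc r^-1).+1 => A e l f A1 e0 mf hf el /=.
have A0 : 0 <= A by lra.
apply: le_trans (power_integral_bounded r0 A0 e0 mf hf) _.
rewrite lee_fin.
have A2 : 0 <= 2 * A by lra.
have -> : 2 * A = ((2 * A) `^ r^-1) `^ r by rewrite -powRrM mulVf ?gt_eqF// powRr1.
rewrite -powRM ?powR_ge0//.
have el0 : 0 <= e * (2 * A) ^+ (Num.trunc r^-1).+1 by rewrite mulr_ge0 ?exprn_ge0.
apply: ge0_ler_powR; rewrite ?nnegrE ?(ltW r0)// ?mulr_ge0 ?powR_ge0//.
  exact: le_trans el.
apply: le_trans el; rewrite ler_wpM2l// -powR_mulrn//.
apply: ler_powR; first lra.
by rewrite ltW// truncnS_gt.
Qed.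

(** In [nikolskii] the degree enters through [(n + 2k) / A] only, which is at most
    [c] here. For the exponent [+oo] continuity turns the bound almost everywhere
    into a bound everywhere, and the weight is trivial. *)
Lemma Lp_le_weighted p : (0 < p)%E -> exists k : nat, forall c l, 0 <= l ->
  exists W, forall A n (P : {poly R[i]}), 0 < A -> (0 < n + 2 * k)%N ->
    (n + 2 * k)%:R <= c * A -> (size P <= n.+1)%N ->
    Lp_le p `[- A, A] (fun x => P.[x%:C]) l ->
    forall x, - A <= x <= A -> nc P.[x%:C] * (1 - (x / A) ^+ 2) ^+ k <= W.
Proof.
case: p => [r|_|//]; last first.
  exists 0%N => c l l0; exists l => A n P A0 N0 hN sP /= hl x xA.
  rewrite expr0 mulr1; apply: (@ae_continuous_le A l (fun z => P.[z])) => //.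
  by move=> z; apply: cderivable_ccontinuous; exact: cderivable_horner.
rewrite lte_fin => r0.
pose k := (Num.trunc r^-1).+1; exists k => c l l0.
have rk : 1 <= (2 * k)%:R * r.
  have h : r^-1 <= k%:R by rewrite ltW// truncnS_gt.
  rewrite -ler_pdivrMr// div1r (le_trans h)// ler_nat; lia.
have [K KE] : exists K : R, K = 2 `^ r * 512 by exists (2 `^ r * 512).
have K0 : 0 <= K by rewrite KE mulr_ge0 ?powR_ge0 ?ler0n.
exists ((K * c * l `^ r) `^ r^-1) => A n P A0 N0 hN sP /= hl x xA.
have mb : minorant_bound P r A (l `^ r).
  by move=> u v m Au uv vA m0 hm; apply: (interval_minorant (poly_lmf P) hl Au).
have := nikolskii r0 rk A0 N0 sP mb xA; rewrite -KE.
set Y := nc _ * _ => hY.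
have Y0 : 0 <= Y.
  have xA1 : 0 <= 1 - (x / A) ^+ 2.
    rewrite subr_ge0 expr_div_n ler_pdivrMr ?exprn_gt0// mul1r.
    by move/andP: xA => [? ?]; nra.
  by rewrite mulr_ge0 ?nc_ge0 ?exprn_ge0.
have {}hY : Y `^ r <= K * c * l `^ r.
  apply: le_trans hY _; rewrite ler_wpM2r ?powR_ge0// -mulrA ler_wpM2l//.
  by rewrite ler_pdivrMr.
have -> : Y = (Y `^ r) `^ r^-1 by rewrite -powRrM divff ?gt_eqF// powRr1.
apply: ge0_ler_powR; rewrite ?nnegrE ?powR_ge0 ?invr_ge0 ?(ltW r0)//.
exact: le_trans (powR_ge0 _ _) hY.
Qed.

End LpBounds.

Lemma cvg_powR {R : realType} {T} (F : set_system T) {FF : Filter F} (u : T -> R)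
    (a r : R) : 0 < r -> (forall x, 0 <= u x) -> 0 <= a ->
  u x @[x --> F] --> a -> u x `^ r @[x --> F] --> a `^ r.
Proof.
move=> r0 u0; rewrite le_eqVlt => /orP[/eqP <- uF|a0 uF]; last first.
  have ca : {for a, continuous (fun b : R => b `^ r)}.
    apply: differentiable_continuous; apply/derivable1_diffP.
    by apply: derivable_powR; rewrite in_itv/= a0.
  exact: (@cvg_comp _ _ _ u (fun b : R => b `^ r) _ _ _ uF ca).
rewrite powR0 ?gt_eqF//; apply/cvgrPdist_le => e e0.
have e1 : 0 < e `^ r^-1 by exact: powR_gt0.
move/cvgrPdist_le: uF => /(_ _ e1); apply: filterS => x.
rewrite !sub0r !normrN !ger0_norm ?powR_ge0// => ux.
have -> : e = (e `^ r^-1) `^ r by rewrite -powRrM mulVf ?gt_eqF// powRr1// ltW.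
by apply: ge0_ler_powR; rewrite ?nnegrE ?(ltW r0)// powR_ge0.
Qed.

Lemma cvg_seq_le {R : realType} (u : nat -> R) (a : R) :
  (forall e : R, 0 < e -> exists M0, forall M, (M0 <= M)%N -> `|u M - a| <= e) ->
  u n @[n --> \oo] --> a.
Proof.
move=> h; apply/cvgrPdist_le => e /h[M0 hM]; exists M0 => // M /= /hM.
by rewrite distrC.
Qed.

Section Fatou.
Context d (T : measurableType d) (R : realType) (mu : {measure set T -> \bar R}).

(** The domains may grow with [n], as long as they absorb every point. *)
Lemma fatou_bound (D : nat -> set T) (u : nat -> T -> R) (v : T -> R) (L : \bar R) :
  (forall n, measurable (D n)) -> (forall n, measurable_fun setT (u n)) ->
  (forall n x, 0 <= u n x) -> (forall x, u n x @[n --> \oo] --> v x) ->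
  (forall x, \forall n \near \oo, D n x) ->
  (forall n, (\int[mu]_(x in D n) (u n x)%:E <= L)%E) ->
  (\int[mu]_x (v x)%:E <= L)%E.
Proof.
move=> mD mu0 u0 uv hD hL.
pose h n : T -> \bar R := (EFin \o u n) \_ (D n).
have h0 n x : (0 <= h n x)%E.
  by rewrite /h/= /patch; case: ifP => _ //; rewrite lee_fin.
have mh n : measurable_fun setT (h n).
  apply/(measurable_restrictT _ (mD n)).1.
  by apply: measurable_funTS; apply/measurable_EFinP.
have hv x : h n x @[n --> \oo] --> (v x)%:E.
  apply: (@cvg_trans _ ((u n x)%:E @[n --> \oo])).
    apply: near_eq_cvg; near=> n; rewrite /h patchE mem_set//.
    by near: n; exact: hD.
  by apply: cvg_EFin; [exact: nearW|exact: uv].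
have -> : (\int[mu]_x (v x)%:E)%E = (\int[mu]_x limn_einf (h^~ x))%E.
  by apply: eq_integral => x _; rewrite (cvg_limn_einf_sup (hv x)).1.
apply: le_trans (fatou mu measurableT mh (fun n x _ => h0 n x)) _.
rewrite limn_einf_lim; apply: lime_le; first exact: is_cvg_einfs.
apply: nearW => n; apply: le_trans (hL n).
rewrite integral_mkcond; apply: ereal_inf_lbound.
by exists n => /=.
Unshelve. all: by end_near. Qed.

(** Fatou's lemma for [K f + K g n - w n] turns convergence of the integrals of
    the majorants into convergence of the integrals of [w n] to zero. *)
Lemma dominated_small (f : T -> R) (g w : nat -> T -> R) (K I c e : R) :
  0 <= K -> K * c <= e / 2 -> 0 < e -> measurable_fun setT f ->
  (forall n, measurable_fun setT (g n)) -> (forall n, measurable_fun setT (w n)) ->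
  (forall x, 0 <= f x) -> (forall n x, 0 <= g n x) -> (forall n x, 0 <= w n x) ->
  (forall n x, w n x <= K * f x + K * g n x) ->
  (forall x, g n x @[n --> \oo] --> f x) -> (forall x, w n x @[n --> \oo] --> 0) ->
  (\int[mu]_x (f x)%:E = I%:E)%E -> (forall n, \int[mu]_x (g n x)%:E <= (I + c)%:E)%E ->
  exists n, (\int[mu]_x (w n x)%:E <= e%:E)%E.
Proof.
move=> K0 Kc e0 mf mg mw f0 g0 w0 wu gf wl fI gI; apply: contrapT => no.
pose u n x : R := K * f x + K * g n x.
have u0 n x : 0 <= u n x by exact: le_trans (wu n x).
have mKu n : measurable_fun setT (u n).
  by apply: measurable_funD; apply: measurable_funM.
have intu n : (\int[mu]_x (u n x)%:E <= (K * (I + I) + e / 2)%:E)%E.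
  have := ge0_integral_le_affine mu measurableT mf (mg n) (mKu n) K0 K0 f0 (g0 n)
    (u0 n) (fun x => lexx _).
  move=> /le_trans; apply; rewrite fI.
  apply: (@le_trans _ _ (K%:E * I%:E + K%:E * (I + c)%:E)%E).
    by apply: leeD => //; apply: lee_wpmul2l; rewrite ?lee_fin.
  by rewrite -!EFinM -EFinD lee_fin !mulrDr; lra.
have intuw n : (\int[mu]_x (u n x - w n x)%:E <= (K * (I + I) - e / 2)%:E)%E.
  have E : (\int[mu]_x (u n x)%:E =
      \int[mu]_x (u n x - w n x)%:E + \int[mu]_x (w n x)%:E)%E.
    rewrite -ge0_integralD//.
    - by apply: eq_integral => x _; rewrite -EFinD subrK.
    - by move=> x _; rewrite lee_fin subr_ge0.
    - by apply/measurable_EFinP; exact: measurable_funB.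
    - by move=> x _; rewrite lee_fin.
    - exact/measurable_EFinP.
  have intw : (e%:E <= \int[mu]_x (w n x)%:E)%E.
    by apply/ltW; rewrite ltNge; apply/negP => hw; apply: no; exists n.
  have le1 : (\int[mu]_x (u n x - w n x)%:E + e%:E <= (K * (I + I) + e / 2)%:E)%E.
    by apply: le_trans (intu n); rewrite E; apply: leeD.
  have -> : K * (I + I) - e / 2 = K * (I + I) + e / 2 - e by lra.
  by rewrite EFinB leeBrDr.
have lim x : u n x - w n x @[n --> \oo] --> K * f x + K * f x.
  rewrite -[X in _ --> X]subr0; apply: cvgB => //; apply: cvgD; first exact: cvg_cst.
  by apply: cvgM => //; exact: cvg_cst.
have : (\int[mu]_x (K * f x + K * f x)%:E <= (K * (I + I) - e / 2)%:E)%E.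
  apply: (fatou_bound (fun=> measurableT) (fun n => measurable_funB (mKu n) (mw n))
    _ lim _ intuw) => [n x|x]; first by rewrite subr_ge0.
  exact: nearW.
have -> : (\int[mu]_x (K * f x + K * f x)%:E)%E = (K * (I + I))%:E.
  transitivity (\int[mu]_x ((2 * K)%:E * (f x)%:E))%E.
    by apply: eq_integral => x _; rewrite -EFinM; congr EFin; ring.
  rewrite ge0_integralZl//.
  - by rewrite fI -EFinM; congr EFin; ring.
  - exact/measurable_EFinP.
  - by move=> x _; rewrite lee_fin.
  - by rewrite lee_fin mulr_ge0.
by rewrite lee_fin; lra.
Qed.

End Fatou.

Section LpLimits.
Variable R : realType.
Implicit Types (f g : R -> R[i]) (r l : R) (Om : set R).

Local Notation LS := (lebesgue_space R).
Local Notation mu := (@completed_lebesgue_measure R).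
Local Notation lmf := (@lebesgue_measurable_fun R).

Lemma nc_seq_cvg (F : nat -> R[i]) z :
  (forall e : R, 0 < e -> exists M0, forall M, (M0 <= M)%N -> nc (F M - z) <= e) ->
  nc (F n) @[n --> \oo] --> nc z.
Proof.
move=> h; apply: cvg_seq_le => e /h[M0 hM]; exists M0 => M /hM; apply: le_trans.
by rewrite ler_norml; have := ncB_ge (F M) z; have := ncB_ge z (F M);
  rewrite [nc (z - _)]nc_distC => h1 h2; apply/andP; split; lra.
Qed.

(** Extended by zero outside the intervals, the functions still converge at every
    point, so Fatou's lemma applies; for [+oo] a countable union of null sets is
    null. *)
Lemma Lp_le_limit p l (A : nat -> R) (F : nat -> R -> R[i]) f : (0 < p)%E ->
  (forall M, lmf (F M)) -> (forall M, Lp_le p `[- A M, A M] (F M) l) ->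
  (forall B, exists M0, forall M, (M0 <= M)%N -> B <= A M) ->
  (forall x e, 0 < e -> exists M0, forall M, (M0 <= M)%N ->
     nc (F M x - f x) <= e) ->
  Lp_le p [set: R] f l.
Proof.
move=> p0 mF hF hA hf.
have inA x : exists M0, forall M, (M0 <= M)%N -> `[- A M, A M]%classic x.
  have [M0 h] := hA `|x|; exists M0 => M /h; rewrite /= in_itv/= ler_norml.
  by move/andP => [? ?]; apply/andP; split; lra.
case: p p0 hF => [r|_|//]; last first.
  move=> /= hF; have := ae_foralln hF; apply: filterS => x h _.
  apply/ler_addgt0Pr => e e0; have [M0 hM] := hf x e e0; have [M1 hM1] := inA x.
  have := h (maxn M0 M1) (hM1 _ (leq_maxr _ _)) => h1.
  have h2 := hM _ (leq_maxl M0 M1).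
  have -> : f x = F (maxn M0 M1) x - (F (maxn M0 M1) x - f x) by ring.
  by rewrite (le_trans (ncB _ _))// lerD.
rewrite lte_fin => r0 /= hF.
apply: (fatou_bound (fun M => @itv_lebesgue_measurable R `[- A M, A M])
  (fun M => lmf_nc_powR r (mF M)) (fun M x => powR_ge0 _ _) _ _ hF) => x.
  apply: cvg_powR => //; first by move=> n; exact: nc_ge0.
    exact: nc_ge0.
  by apply: nc_seq_cvg; exact: hf.
by have [M0 h] := inA x; exists M0.
Qed.

(** The completed measure restricts to the Borel measure, as the push-forward by
    the identity; this gives access to integration by substitution. *)
Lemma completed_integralE (G : R -> R) : continuous G -> (forall x, 0 <= G x) ->
  (\int[mu]_x (G x)%:E = \int[@lebesgue_measure R]_x (G x)%:E)%E.
Proof.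
move=> cG G0; pose phi : LS -> measurableTypeR R := fun x => x.
have mphi : measurable_fun [set: LS] phi.
  by move=> _ Y mY; rewrite setTI; exact: borel_lebesgue_measurable.
have := @ge0_integral_pushforward _ _ _ _ R phi mphi mu setT (EFin \o G)
  measurableT.
rewrite preimage_setT => <-; last 2 first.
- by apply/measurable_EFinP; exact: continuous_measurable_fun.
- by move=> y _; rewrite lee_fin.
by apply: eq_measure_integral => A mA _.
Qed.

Lemma power_integral_dilation r (h : R[i] -> R[i]) (rho : R) : 0 < r ->
  (forall z, ccontinuous h z) -> 0 < rho ->
  power_integral r [set: R] (fun x => h x%:C) =
  (rho%:E * power_integral r [set: R] (fun x => h (rho * x)%:C))%E.
Proof.
move=> r0 ch rho0.
pose G x : R := nc (h x%:C) `^ r.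
have G0 x : 0 <= G x by exact: powR_ge0.
have cG : continuous G.
  move=> x; apply: cvg_powR => //; [by move=> y; exact: nc_ge0|exact: nc_ge0|].
  apply/cvgrPdist_le => e e0; have [d d0 hd] := ch x%:C e e0.
  apply/nbhs_ballP; exists d => // y /=; rewrite /ball/= => xy.
  have := hd y%:C; rewrite -rmorphB nc_real distrC => /(_ (ltW xy)).
  rewrite ler_norml; have := ncB_ge (h x%:C) (h y%:C).
  have := ncB_ge (h y%:C) (h x%:C); rewrite [nc (h x%:C - _)]nc_distC => h1 h2 h3.
  by apply/andP; split; lra.
have cS : continuous (fun x : R => rho * x).
  by move=> x; apply: cvgM; [exact: cvg_cst|exact: cvg_id].
have cGS : continuous (fun x => G (rho * x)).
  by move=> x; apply: (@continuous_comp _ _ _ (fun x : R => rho * x) G); [exact: cS|exact: cG].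
rewrite /power_integral -[LHS]/(\int[mu]_x (G x)%:E)%E.
rewrite -[X in (_ * X)%E]/(\int[mu]_x (G (rho * x))%:E)%E.
rewrite !completed_integralE//.
have dF (x : R) : is_derive x (1 : R) (fun y : R => rho * y : R) rho.
  by apply: is_derive_eq; rewrite /GRing.scale/= mulr1.
have dE : (fun x : R => rho * x)^`()%classic = cst rho.
  by apply/funext => x; rewrite derive1E derive_val.
rewrite (@increasing_ge0_integration_by_substitutionT R (fun x => rho * x) G)//.
- rewrite dE -ge0_integralZl//.
  + by apply: eq_integral => x _; rewrite /= EFinM muleC.
  + by apply/measurable_EFinP; exact: continuous_measurable_fun.
  + by move=> x _; rewrite lee_fin.
  + by rewrite lee_fin ltW.
- by move=> x y xy; rewrite ltr_pM2l.
- by rewrite dE; exact: cst_continuous.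
- by rewrite dE; exact: is_cvg_cst.
- by rewrite dE; exact: is_cvg_cst.
- exact: (gt0_cvgMrNy rho0 cvg_id).
- exact: (gt0_cvgMry rho0 cvg_id).
Qed.

(** Dilating by [1 / (1 + eta / (n + 1))] multiplies the integral of [|h|^r] by
    a factor close to [1] and converges pointwise to [h], which is what
    [dominated_small] asks for. *)
Lemma dilation_close r (h : R[i] -> R[i]) (L : R) : 0 < r ->
  (forall z, ccontinuous h z) ->
  (power_integral r [set: R] (fun x => h x%:C) <= L%:E)%E ->
  forall e : R, 0 < e -> exists2 rho : R, 0 < rho < 1 &
    (power_integral r [set: R] (fun x => (h x%:C - h (rho * x)%:C)%R) <= e%:E)%E.
Proof.
move=> r0 ch hL e e0.
have mh : lmf (fun x => h x%:C) by exact: ccontinuous_lmf.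
have [I IE] : exists I : R, power_integral r [set: R] (fun x => h x%:C) = I%:E.
  exists (fine (power_integral r [set: R] (fun x => h x%:C))); rewrite fineK//.
  by rewrite ge0_fin_numE ?power_integral_ge0// (le_lt_trans hL)// ltry.
have I0 : 0 <= I by rewrite -lee_fin -IE power_integral_ge0.
have [K KE] : exists K : R, K = (1 + 1) `^ r by exists ((1 + 1) `^ r).
have K0 : 0 < K by rewrite KE powR_gt0.
pose eta : R := e / 2 / (K * (I + 1)).
have eta0 : 0 < eta by rewrite !divr_gt0// mulr_gt0// ltr_wpDl.
have etaI : K * (eta * I) <= e / 2.
  rewrite /eta mulrAC mulrA ler_pdivrMr; last by rewrite mulr_gt0// ltr_wpDl.
  rewrite [K * _]mulrC -mulrA ler_wpM2l//; first by rewrite divr_ge0 ?(ltW e0).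
  by rewrite [I * K]mulrC ler_wpM2l ?(ltW K0)//; lra.
pose s n : R := 1 + eta / n.+1%:R.
have s1 n : 1 < s n by rewrite ltrDl divr_gt0.
have s0 n : 0 < s n by exact: lt_trans (s1 n).
pose H n (x : R) := h ((s n)^-1 * x)%:C.
have cH n (z : R[i]) : ccontinuous (fun z => h ((s n)^-1%:C * z)) z.
  move=> d d0; have [d1 d10 hd] := ch ((s n)^-1%:C * z) d d0.
  exists d1 => // w wz; apply: hd; rewrite -mulrBr ncM nc_real.
  rewrite ger0_norm ?invr_ge0 ?(ltW (s0 n))//.
  rewrite (le_trans _ wz)// ler_piMl ?nc_ge0//.
  by rewrite invf_le1// ltW.
have mH n : lmf (H n).
  have := ccontinuous_lmf (cH n); congr lmf.
  by apply/funext => x; rewrite /H rmorphM.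
have IH n : power_integral r [set: R] (H n) = (s n * I)%:E.
  have := power_integral_dilation r0 ch (_ : 0 < (s n)^-1).
  rewrite invr_gt0 => /(_ (s0 n)); rewrite IE EFinM => ->.
  by rewrite muleA -EFinM divff ?gt_eqF// mul1e.
have lim x (d : R) : 0 < d -> exists M0, forall M, (M0 <= M)%N ->
    nc (H M x - h x%:C) <= d.
  move=> d0; have [d1 d10 hd] := ch x%:C d d0.
  exists (Num.trunc (eta * `|x| / d1)).+1 => M hM; apply: hd.
  rewrite -rmorphB nc_real.
  have -> : (s M)^-1 * x - x = - ((1 - (s M)^-1) * x) by ring.
  rewrite normrN normrM.
  have b1 : 0 <= 1 - (s M)^-1 by rewrite subr_ge0 invf_le1// ltW.
  rewrite ger0_norm//.
  have b2 : 1 - (s M)^-1 <= eta / M.+1%:R.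
    have -> : 1 - (s M)^-1 = (s M - 1) / s M.
      by rewrite mulrBl divff ?gt_eqF// mul1r.
    rewrite [s M - 1]addrAC subrr add0r ler_pdivrMr// ler_peMr ?(ltW (s1 M))//.
    by rewrite divr_ge0 ?(ltW eta0).
  apply: (le_trans (ler_wpM2r (normr_ge0 x) b2)).
  rewrite mulrAC ler_pdivrMr// [leRHS]mulrC -ler_pdivrMr//.
  rewrite (le_trans (ltW (truncnS_gt _)))// ler_nat.
  by rewrite (leq_trans hM).
have [||||n hn] := dominated_small (ltW K0) etaI e0 (lmf_nc_powR r mh)
  (fun n => lmf_nc_powR r (mH n)) (fun n => lmf_nc_powR r (lmfB mh (mH n)))
  (fun=> powR_ge0 _ _) (fun _ _ => powR_ge0 _ _) (fun _ _ => powR_ge0 _ _)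
  _ _ _ IE.
- move=> n x; have := powR_add_le r0 ltr01 (nc_ge0 (h x%:C)) (nc_ge0 (H n x)).
  rewrite invr1 -KE; apply: le_trans.
  by apply: ge0_ler_powR; rewrite ?nnegrE ?(ltW r0) ?addr_ge0 ?nc_ge0// ncB.
- move=> x; apply: cvg_powR => //; [by move=> n; exact: nc_ge0|exact: nc_ge0|].
  exact/nc_seq_cvg/lim.
- move=> x; rewrite -[0](powR0 (lt0r_neq0 r0)) -(nc0 R).
  apply: cvg_powR => //; [by move=> n; exact: nc_ge0|exact: nc_ge0|].
  apply: nc_seq_cvg => d /lim-/(_ x)[M0 hM]; exists M0 => M /hM.
  by rewrite subr0 nc_distC.
- move=> n; rewrite -[X in (X <= _)%E]/(power_integral r [set: R] (H n)) IH lee_fin.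
  rewrite /s mulrDl mul1r lerD2l ler_wpM2r//.
  by rewrite ler_pdivrMr// ler_peMr ?(ltW eta0)// ler1n.
exists (s n)^-1; last exact: hn.
by rewrite invr_gt0 s0 invf_lt1 ?s0 ?s1.
Qed.

End LpLimits.

(** * Approximation by entire functions and by polynomials *)

Section BSpace.
Variable R : realType.
Implicit Types (g h : R[i] -> R[i]) (s t : R).

Lemma B_space_cderivable s g : B_space s g -> forall z, cderivable g z.
Proof. by case => /entireP. Qed.

Lemma B_space_bound s g (e : R) : B_space s g -> 0 < e ->
  exists2 C, 0 <= C & forall z, nc (g z) <= C * expR ((s + e) * nc z).
Proof.
move=> [_ hg] /hg[C hC]; exists C => //.
by have := le_trans (nc_ge0 _) (hC 0); rewrite nc0 mulr0 expR0 mulr1.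
Qed.

Lemma B_space_mono s t g : s <= t -> B_space s g -> B_space t g.
Proof.
move=> st hg; split=> [|e e0]; first by case: hg.
have [C C0 hC] := B_space_bound hg e0; exists C => z; rewrite (le_trans (hC z))//.
by rewrite ler_wpM2l// ler_expR ler_wpM2r ?nc_ge0// lerD2r.
Qed.

Lemma B_spaceD s g h : B_space s g -> B_space s h ->
  B_space s (fun z => g z + h z).
Proof.
move=> hg hh; split.
  by apply/entireP => z; 
    exact: cderivableD (B_space_cderivable hg z) (B_space_cderivable hh z).
move=> e e0; have [C _ hC] := B_space_bound hg e0.
have [D _ hD] := B_space_bound hh e0; exists (C + D) => z.
by rewrite (le_trans (ncD _ _))// mulrDl lerD.
Qed.

Lemma B_spaceN s g : B_space s g -> B_space s (fun z => - g z).
Proof.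
move=> hg; split.
  apply/entireP => z; rewrite (_ : (fun z => _) = (fun z => (fun=> 0) z - g z)).
    by apply: cderivableB; [exact: cderivable_cst|exact: B_space_cderivable hg _].
  by apply/funext => w; rewrite sub0r.
by move=> e e0; have [C _ hC] := B_space_bound hg e0; exists C => z; rewrite ncN.
Qed.

Lemma cderivable_dilation g (rho : R) z : 0 < rho ->
  cderivable g (rho%:C * z) -> cderivable (fun w => g (rho%:C * w)) z.
Proof.
move=> r0 [l hl]; exists (l * rho%:C) => e e0.
have [d d0 hd] := hl (e / rho) (divr_gt0 e0 r0).
exists (d / rho) => [|w]; first exact: divr_gt0.
rewrite ler_pdivlMr// => hw.
have E : nc (rho%:C * w - rho%:C * z) = rho * nc (w - z).
  by rewrite -mulrBr ncM nc_real gtr0_norm.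
have := hd (rho%:C * w); rewrite E mulrC => /(_ _).
rewrite [_ * rho]mulrC in hw; rewrite mulrC => /(_ hw).
by rewrite -mulrBr !mulrA divfK ?gt_eqF.
Qed.

Lemma B_space_dilation s g (rho : R) : 0 < rho -> B_space s g ->
  B_space (rho * s) (fun z => g (rho%:C * z)).
Proof.
move=> r0 hg; split.
  apply/entireP => z; apply: cderivable_dilation => //.
  exact: B_space_cderivable hg _.
move=> e e0; have er : 0 < e / rho by exact: divr_gt0.
have [C _ hC] := B_space_bound hg er; exists C => z.
have := hC (rho%:C * z); rewrite ncM nc_real gtr0_norm// mulrA.
by have -> : (s + e / rho) * rho = rho * s + e by field; rewrite gt_eqF.
Qed.

End BSpace.

Section Approximation.
Variable R : realType.
Implicit Types (f : R -> R[i]) (g : R[i] -> R[i]).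

Local Notation LS := (lebesgue_space R).
Local Notation lmf := (@lebesgue_measurable_fun R).

Lemma M_space_natural_bound (K N : R) f : 0 < K -> M_space K N f ->
  exists q : nat, forall A x : R, 1 <= A -> - A <= x <= A ->
    nc (f x) <= K * (1 + A) ^+ q.
Proof.
move=> K0 [_ hf]; exists (Num.trunc `|N|).+1 => A x A1 xA.
rewrite (le_trans (hf x))// ler_wpM2l ?(ltW K0)//.
have x1 : 1 <= 1 + `|x| by rewrite lerDl.
apply: (@le_trans _ _ ((1 + `|x|) ^+ (Num.trunc `|N|).+1)).
  rewrite -powR_mulrn; last by lra.
  apply: ler_powR => //.
  by rewrite (le_trans (ler_norm N))// ltW// truncnS_gt.
have A0 : 0 <= 1 + A by lra.
have x0 : 0 <= 1 + `|x| by rewrite addr_ge0.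
by rewrite lerXn2r ?nnegrE// lerD2l ler_norml.
Qed.

(** An approximant of a polynomially bounded function cannot be large on an
    interval, so it has polynomial growth as well. *)
Lemma Lp_growth (p : \bar R) (K N : R) f g (tau l : R) : (0 < p)%E -> 0 < K ->
  M_space K N f -> 0 <= tau -> B_space tau g -> 0 <= l ->
  Lp_le p [set: R] (fun x => f x - g x%:C) l ->
  exists2 C', 0 <= C' & exists L, forall x : R, nc (g x%:C) <= C' * (1 + `|x|) ^+ L.
Proof.
move=> p0 K0 fM tau0 Bg l0 hl.
have [q hq] := M_space_natural_bound K0 fM.
have dg := B_space_cderivable Bg; have mg := cderivable_lmf dg.
have mf := fM.1.
have [C C0 hC] := B_space_bound Bg ltr01.
have tau1 : 0 <= tau + 1 by lra.
case: p p0 hl => [r|_|//]; last first.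
  move=> /= hl; apply: (@growth_on_line _ g (tau + 1) C (2 * (l + K)) 1 q.+1) => //.
    by rewrite mulr_ge0// addr_ge0// ltW.
  move=> A u v m A1 Au uv vA m0 hm.
  have [x xuv] := ae_interval_point uv hl => /(_ I) hx.
  have m1 : m <= (l + K) * (1 + A) ^+ q.
    rewrite (le_trans (hm x xuv))// powRr1 ?nc_ge0//.
    have -> : g x%:C = f x - (f x - g x%:C) by ring.
    rewrite (le_trans (ncB _ _))// [X in X <= _]addrC mulrDl lerD//.
      by rewrite (le_trans hx)// ler_peMr// exprn_ege1//; lra.
    by apply: hq => //; move/andP: xuv => [? ?]; apply/andP; split; lra.
  have uv1 : v - u <= 2 * (1 + A) by lra.
  apply: (le_trans (ler_pM _ m0 uv1 m1)); first by lra.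
  by rewrite exprS le_eqVlt; apply/orP; left; apply/eqP; ring.
rewrite lte_fin => r0 /= hl.
pose q' := (Num.trunc (q%:R * r)).+1.
have [J JE] : exists J : R, J = (1 + 1) `^ r by exists ((1 + 1) `^ r).
have J0 : 0 <= J by rewrite JE powR_ge0.
pose B := J * (l `^ r + 2 * K `^ r).
apply: (@growth_on_line _ g (tau + 1) C B r q'.+1) => //.
  by rewrite mulr_ge0// addr_ge0 ?mulr_ge0 ?powR_ge0.
move=> A u v m A1 Au uv vA m0 hm.
apply: (interval_minorant mg _ Au uv vA m0 hm).
have A0 : 0 <= A by lra.
have mI := @itv_lebesgue_measurable R `[- A, A].
have mfg : lmf (fun x => f x - g x%:C) by exact: lmfB.
have -> : (fun x : R => g x%:C) = (fun x => f x + - (f x - g x%:C)).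
  by apply/funext => x; ring.
apply: le_trans (power_integralD r0 ltr01 mI mf (lmfN mfg)) _.
have h1 : (power_integral r `[(- A)%R, A] f <= ((K `^ r * (1 + A) ^+ q') * (2 * A))%:E)%E.
  have e0 : 0 <= K * (1 + A) ^+ q by rewrite mulr_ge0 ?(ltW K0)// exprn_ge0//; lra.
  apply: le_trans (power_integral_bounded r0 A0 e0 mf (fun x => hq A x A1)) _.
  rewrite lee_fin ler_wpM2r//; first by lra.
  have a1 : 0 <= 1 + A by lra.
  rewrite powRM ?exprn_ge0 ?(ltW K0)// ler_wpM2l ?powR_ge0//.
  rewrite -!powR_mulrn// -powRrM; apply: ler_powR; first by lra.
  by rewrite ltW// truncnS_gt.
have h2 : (power_integral r `[(- A)%R, A] (fun x => - (f x - g x%:C))%R <= (l `^ r)%:E)%E.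
  have sub : `[- A, A]%classic `<=` [set: R] by [].
  have mT : measurable ([set: R] : set LS) by exact: measurableT.
  have hN : Lp_le r%:E [set: R] (fun x => - (f x - g x%:C)) l by exact: Lp_leN.
  exact: (@Lp_le_subset R r%:E _ _ _ l mI mT (lmfN mfg) sub hN).
rewrite invr1 -JE.
apply: (@le_trans _ _ (J%:E * ((K `^ r * (1 + A) ^+ q') * (2 * A))%:E +
    J%:E * (l `^ r)%:E)%E).
  by apply: leeD; apply: lee_wpmul2l; rewrite ?lee_fin.
rewrite -!EFinM -EFinD lee_fin -mulrDr /B -(mulrA J _ (_ ^+ q'.+1)) ler_wpM2l//.
rewrite (mulrDl (l `^ r)) addrC; apply: lerD.
  by rewrite ler_peMr ?powR_ge0// exprn_ege1//; lra.
have -> : 2 * K `^ r * (1 + A) ^+ q'.+1 = K `^ r * (1 + A) ^+ q' * (2 * (1 + A)).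
  by rewrite exprSr; ring.
rewrite ler_wpM2l ?mulr_ge0 ?powR_ge0 ?exprn_ge0//; lra.
Qed.

Lemma length_large (a : nat -> R) (C sigma : R) :
  (forall n, (1 <= n)%N -> `|a n - n%:R| <= C) -> 0 < sigma ->
  forall B : R, exists n0, forall n, (n0 <= n)%N ->
    [/\ (1 <= n)%N, B <= n%:R & B <= a n / sigma].
Proof.
move=> a_near sg0 B; pose k := (Num.trunc `|B|).+1.
pose k' := (Num.trunc (`|B| * sigma + C)).+1.
exists (maxn k k') => n; rewrite geq_max => /andP[kn k'n].
have n1 : (1 <= n)%N by exact: leq_trans kn.
split => //.
  by rewrite (le_trans (ler_norm B))// (le_trans (ltW (truncnS_gt _)))// ler_nat.
rewrite ler_pdivlMr//.
have h : `|B| * sigma + C <= n%:R.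
  by rewrite (le_trans (ltW (truncnS_gt _)))// ler_nat.
have := a_near n n1; rewrite ler_norml => /andP[h1 _].
have : B * sigma <= `|B| * sigma by rewrite ler_wpM2r ?(ltW sg0)// ler_norm.
by move: h1 h; clear; lra.
Qed.

(** In [entire_poly_approx] the uniform error beats every power of [n], hence also
    the power of the interval length lost in [Lp_le_bounded]. *)
Lemma poly_approximants (p : \bar R) (a : nat -> R) (C : R) g (tau sigma : R) C' L :
  (0 < p)%E ->
  (forall n, (1 <= n)%N -> 0 < a n) ->
  (forall n, (1 <= n)%N -> `|a n - n%:R| <= C) ->
  0 < tau -> tau < sigma -> B_space tau g -> 0 <= C' ->
  (forall x : R, nc (g x%:C) <= C' * (1 + `|x|) ^+ L) ->
  exists Q : nat -> {poly R[i]}, [/\ forall n, (1 <= n)%N -> (size (Q n) <= n.+1)%N,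
    forall d, 0 < d -> exists n0, forall n, (n0 <= n)%N ->
      Lp_le p `[- (a n / sigma), a n / sigma] (fun x => g x%:C - (Q n).[x%:C]) d &
    forall x e, 0 < e -> exists n0, forall n, (n0 <= n)%N ->
      nc (g x%:C - (Q n).[x%:C]) <= e].
Proof.
move=> p0 a_gt0 a_near tau0 ts Bg C'0 hg.
have sg0 : 0 < sigma by exact: lt_trans ts.
have C0 : 0 <= C by rewrite (le_trans _ (a_near 1 _)).
have [m hm] := Lp_le_bounded p0.
have dg := B_space_cderivable Bg.
pose tau' := (tau + sigma) / 2.
have e0 : 0 < (sigma - tau) / 2 by lra.
have [C2 C20 hC2] := B_space_bound Bg e0.
have tE : tau + (sigma - tau) / 2 = tau' by rewrite /tau'; lra.
rewrite tE in hC2.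
have C30 : 0 <= C2 + C' by rewrite addr_ge0.
have b1 z : nc (g z) <= (C2 + C') * expR (tau' * nc z).
  by rewrite (le_trans (hC2 z))// ler_wpM2r ?expR_ge0// lerDl.
have b2 (x : R) : nc (g x%:C) <= (C2 + C') * (1 + `|x|) ^+ L.
  by rewrite (le_trans (hg x))// ler_wpM2r ?exprn_ge0 ?addr_ge0// lerDr.
have t1 : 0 < tau' by rewrite /tau'; lra.
have t2 : tau' < sigma by rewrite /tau'; lra.
have [D0 hD0] := entire_poly_approx m.+1 dg t1 t2 C30 b1 b2 a_gt0 a_near.
have [D DD0 D_ge0] : exists2 D, D0 <= D & 0 <= D.
  by exists (Num.max D0 0); rewrite le_max lexx ?orbT.
have ex n : exists P : {poly R[i]}, (1 <= n)%N -> (size P <= n.+1)%N /\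
    forall x : R, - (a n / sigma) <= x <= a n / sigma ->
    nc (g x%:C - P.[x%:C]) <= D / (1 + n%:R) ^+ m.+1.
  case: n => [|n]; first by exists 0.
  have [P sP hP] := hD0 n.+1 isT; exists P => _; split=> // x xA.
  rewrite ler_pdivlMr ?exprn_gt0 ?ltr_wpDr//.
  by rewrite (le_trans (hP x xA)).
have [Q hQ] := choice ex.
have large := length_large a_near sg0.
exists Q; split.
- by move=> n /hQ[].
- move=> d d0.
  pose E := 2 * (1 + C) / sigma.
  have E0 : 0 <= E by rewrite divr_ge0 ?(ltW sg0)//; lra.
  have [n0 hn0] := large (1 + D * E ^+ m / d).
  exists n0 => n /hn0[n1 hn hA].
  have DE : 0 <= D * E ^+ m / d by rewrite divr_ge0 ?mulr_ge0 ?exprn_ge0// ltW.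
  have [_ hP] := hQ n n1.
  have N0 : 0 < 1 + n%:R :> R by rewrite ltr_wpDr.
  have mgQ : lmf (fun x => g x%:C - (Q n).[x%:C]).
    by apply: lmfB; [exact: cderivable_lmf|exact: poly_lmf].
  have A1 : 1 <= a n / sigma by lra.
  apply: (hm _ _ _ _ A1 _ mgQ hP).
    by rewrite divr_ge0// exprn_ge0// ltW.
  have AE : 2 * (a n / sigma) <= E * (1 + n%:R).
    rewrite /E mulrA [X in _ <= X]mulrAC ler_wpM2r ?invr_ge0 ?(ltW sg0)//.
    rewrite -mulrA ler_wpM2l//.
    have := a_near n n1; rewrite ler_norml => /andP[_ h].
    have : 0 <= C * n%:R by rewrite mulr_ge0.
    by rewrite mulrDl mul1r mulrDr mulr1; lra.
  have An0 : 0 <= 2 * (a n / sigma) by lra.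
  apply: (@le_trans _ _ (D / (1 + n%:R) ^+ m.+1 * (E * (1 + n%:R)) ^+ m)).
    rewrite ler_wpM2l ?divr_ge0 ?exprn_ge0 ?(ltW N0)//.
    by rewrite lerXn2r ?nnegrE// mulr_ge0// ltW.
  have -> : D / (1 + n%:R) ^+ m.+1 * (E * (1 + n%:R)) ^+ m =
      D * E ^+ m / (1 + n%:R).
    rewrite exprMn exprS invfM; field.
    by rewrite ?expf_neq0 gt_eqF.
  rewrite ler_pdivrMr// [leRHS]mulrC -ler_pdivrMr//; lra.
- move=> x e e1.
  have [n0 hn0] := large (`|x| + D / e).
  exists n0 => n /hn0[n1 hn hA]; have [_ hP] := hQ n n1.
  have De : 0 <= D / e by rewrite divr_ge0// ltW.
  have N0 : 0 < 1 + n%:R :> R by rewrite ltr_wpDr.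
  rewrite (le_trans (hP x _))//.
    by rewrite -ler_norml; lra.
  rewrite ler_pdivrMr ?exprn_gt0//.
  apply: (@le_trans _ _ (e * (1 + n%:R))).
    by rewrite mulrC -ler_pdivrMr//; have := normr_ge0 x; lra.
  rewrite ler_wpM2l ?(ltW e1)// exprS ler_peMr ?(ltW N0)// exprn_ege1//.
  by rewrite lerDl.
Qed.

End Approximation.

(** * Upper and lower bounds for the polynomial errors *)

Section Limits.
Variable R : realType.
Implicit Types (f : R -> R[i]) (g : R[i] -> R[i]).

Local Notation LS := (lebesgue_space R).
Local Notation lmf := (@lebesgue_measurable_fun R).

Lemma Lp_le_ext (p : \bar R) Om f f' (l : R) : f =1 f' ->
  Lp_le p Om f l -> Lp_le p Om f' l.
Proof. by move=> /funext ->. Qed.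

Lemma M_space_lmf (K N : R) f : M_space K N f -> lmf f.
Proof. by case. Qed.

(** An approximant of type smaller than [sigma] has polynomial growth, and is
    therefore well approximated by polynomials on the intervals. *)
Lemma poly_error_le (p : \bar R) (a : nat -> R) (C K N : R) f g (tau sigma l1 l : R) :
  (0 < p)%E -> (forall n, (1 <= n)%N -> 0 < a n) ->
  (forall n, (1 <= n)%N -> `|a n - n%:R| <= C) ->
  0 < K -> M_space K N f -> 0 < tau -> tau < sigma -> B_space tau g ->
  0 <= l1 -> l1 < l -> Lp_le p [set: R] (fun x => f x - g x%:C) l1 ->
  exists n0, forall n, (n0 <= n)%N ->
    (poly_approx_error n p (a n / sigma) f <= l%:E)%E.
Proof.
move=> p0 a_gt0 a_near K0 fM tau0 ts Bg l10 ll hl.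
have [C' C'0 [L hg]] := Lp_growth p0 K0 fM (ltW tau0) Bg l10 hl.
have [Q [sQ Qg _]] := poly_approximants p0 a_gt0 a_near tau0 ts Bg C'0 hg.
have [d d0 hd] := Lp_le_perturb p0 l10 ll.
have [n0 hn0] := Qg d d0.
exists n0.+1 => n hn; have n1 : (1 <= n)%N by exact: leq_trans hn.
have mf := M_space_lmf fM.
have mg := cderivable_lmf (B_space_cderivable Bg).
have mI := @itv_lebesgue_measurable R `[- (a n / sigma), a n / sigma].
have mT : measurable ([set: R] : set LS) by exact: measurableT.
have l0 : 0 <= l by exact: le_trans (ltW ll).
have mfg : lmf (fun x => f x - g x%:C) by exact: lmfB.
have mgQ : lmf (fun x => g x%:C - (Q n).[x%:C]) by exact: lmfB (poly_lmf _).
have sub : `[- (a n / sigma), a n / sigma]%classic `<=` [set: R] by [].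
have h1 := @Lp_le_subset R p _ _ _ l1 mI mT mfg sub hl.
have h2 := hd _ _ _ mI mfg mgQ h1 (hn0 n (ltnW hn)).
have h3 : Lp_le p `[- (a n / sigma), a n / sigma]
    (fun x => f x - (Q n).[x%:C]) l.
  by apply: Lp_le_ext h2 => x; ring.
apply: (@le_trans _ _ (Lp_norm p `[- (a n / sigma), a n / sigma]
    (fun x => f x - (Q n).[x%:C])%R)).
  by apply: ereal_inf_lbound; exists (Q n) => //=; exact: sQ.
by apply/Lp_normP.
Qed.

(** If the polynomial errors are infinitely often below [l], subtract from the
    near optimal polynomials those that approximate [g0]. The differences are
    bounded in the norm, hence have a locally convergent subsequence, and Fatou's
    lemma transfers the bound to the limit. *)
Lemma entire_approximant (p : \bar R) (a : nat -> R) (C K N : R) f g0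
    (s0 sigma l0 l : R) :
  (0 < p)%E -> (forall n, (1 <= n)%N -> 0 < a n) ->
  (forall n, (1 <= n)%N -> `|a n - n%:R| <= C) ->
  0 < K -> M_space K N f -> 0 < s0 -> s0 < sigma -> B_space s0 g0 ->
  0 <= l0 -> Lp_le p [set: R] (fun x => f x - g0 x%:C) l0 -> 0 <= l ->
  (forall n0, exists2 n, (n0 <= n)%N &
     (poly_approx_error n p (a n / sigma) f < l%:E)%E) ->
  exists2 g, B_space sigma g & Lp_le p [set: R] (fun x => f x - g x%:C) l.
Proof.
move=> p0 a_gt0 a_near K0 fM s00 ss Bg0 l00 hl0 l_ge0 freq.
have sg0 : 0 < sigma by exact: lt_trans ss.
have C0 : 0 <= C by rewrite (le_trans _ (a_near 1 _)).
have [C' C'0 [L hg]] := Lp_growth p0 K0 fM (ltW s00) Bg0 l00 hl0.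
have [Q [sQ Qg Qlim]] := poly_approximants p0 a_gt0 a_near s00 ss Bg0 C'0 hg.
have [n1 hn1] := Qg 1 ltr01.
have [n2 hn2] := length_large a_near sg0 1.
have mf := M_space_lmf fM.
have mg := cderivable_lmf (B_space_cderivable Bg0).
have mT : measurable ([set: R] : set LS) by exact: measurableT.
have mfg : lmf (fun x => f x - g0 x%:C) by exact: lmfB.
have mI n := @itv_lebesgue_measurable R `[- (a n / sigma), a n / sigma].
have sub n : `[- (a n / sigma), a n / sigma]%classic `<=` [set: R] by [].
have ex m : exists nP : nat * {poly R[i]}, [/\ (m + n1 + n2 <= nP.1)%N,
    (size nP.2 <= nP.1.+1)%N & Lp_le p `[- (a nP.1 / sigma), a nP.1 / sigma]
      (fun x => f x - nP.2.[x%:C]) l].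
  have [n mn] := freq (m + n1 + n2)%N.
  move=> /ereal_inf_lt[_ [P /= sP <-] /ltW hP].
  exists (n, P); split=> //=.
  by apply/(Lp_normP _ _ p0 l_ge0).
have [nP hnP] := choice ex.
pose nu m := (nP m).1; pose P m := (nP m).2.
have nuE m : [/\ (m <= nu m)%N, (n1 <= nu m)%N & (n2 <= nu m)%N].
  have [h _ _] := hnP m; rewrite /nu; split; apply: leq_trans h.
  - by rewrite -addnA leq_addr.
  - by rewrite addnAC leq_addl.
  - by rewrite leq_addl.
have nu1 m : [/\ (1 <= nu m)%N & 1 <= a (nu m) / sigma].
  by have [_ _ /hn2[]] := nuE m.
pose A m := a (nu m) / sigma.
have A1 m : 1 <= A m by have [] := nu1 m.
have A0 m : 0 < A m by exact: lt_le_trans (A1 m).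
pose S m := P m - Q (nu m).
have sS m : (size (S m) <= (nu m).+1)%N.
  rewrite (leq_trans (size_polyD _ _))// geq_max size_polyN.
  have [_ -> _] := hnP m; apply: sQ; by have [] := nu1 m.
have SE m x : (S m).[x] = (P m).[x] - (Q (nu m)).[x] by rewrite hornerD hornerN.
have [L1 L10 hL1] := Lp_leD p0 l00 ler01.
have [L2 L20 hL2] := Lp_leD p0 L10 l_ge0.
have mfP m : lmf (fun x => f x - (P m).[x%:C]) by exact: lmfB (poly_lmf _).
have mgQ n : lmf (fun x => g0 x%:C - (Q n).[x%:C]) by exact: lmfB (poly_lmf _).
have SL m : Lp_le p `[- A m, A m] (fun x => (S m).[x%:C]) L2.
  have h0 := @Lp_le_subset R p _ _ _ l0 (mI (nu m)) mT mfg (sub _) hl0.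
  have [_ /hn1 h1 _] := nuE m.
  have h2 := hL1 _ _ _ (mI _) mfg (mgQ _) h0 h1.
  have [_ _ /Lp_leN h3] := hnP m.
  have := hL2 _ _ _ (mI _) (lmfD mfg (mgQ _)) (lmfN (mfP m)) h2 h3.
  by apply: Lp_le_ext => x; rewrite SE; ring.
have [k hk] := Lp_le_weighted p0.
have [W hW] := hk (sigma + (C + (2 * k)%:R)) L2 L20.
have nuA m : (nu m)%:R <= sigma * A m + C.
  have [n_gt0 _] := nu1 m; have := a_near (nu m) n_gt0.
  rewrite ler_norml => /andP[h _].
  by rewrite /A mulrC divfK ?gt_eqF//; move: h; clear; lra.
have hw m x : - A m <= x <= A m ->
    nc (S m).[x%:C] * (1 - (x / A m) ^+ 2) ^+ k <= W.
  apply: (hW (A m) (nu m)) => //.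
    by rewrite addn_gt0; have [-> _] := nu1 m.
  rewrite natrD mulrDl.
  have : C + (2 * k)%:R <= (C + (2 * k)%:R) * A m.
    by rewrite ler_peMr// addr_ge0.
  by move: (nuA m); clear; lra.
have [||G [psi [psiM BG Glim]]] := polynomial_compactness sg0 A1 _ _ sS hw.
- move=> e e0; have [n3 hn3] := length_large a_near sg0 (C / e).
  exists n3 => m mn; have [mnu _ _] := nuE m.
  have [_ _] := hn3 (nu m) (leq_trans mn mnu).
  rewrite ler_pdivrMr// -/(A m) => h.
  by rewrite (le_trans (nuA m))// mulrDl lerD2l mulrC.
- move=> B; have [n3 hn3] := length_large a_near sg0 B.
  exists n3 => m mn; have [mnu _ _] := nuE m.
  by have [] := hn3 (nu m) (leq_trans mn mnu).
exists (fun z => g0 z + G z).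
  by apply: B_spaceD => //; apply: B_space_mono Bg0; exact: ltW.
apply: (@Lp_le_limit R p l (fun M => A (psi M))
  (fun M x => f x - (P (psi M)).[x%:C])) => //.
- by move=> M; have [] := hnP (psi M).
- move=> B; have [n3 hn3] := length_large a_near sg0 B.
  exists n3 => M Mn; have [mnu _ _] := nuE (psi M).
  have [_ _] := hn3 (nu (psi M)) (leq_trans Mn (leq_trans (psiM M) mnu)).
  by [].
- move=> x e e0; have e2 : 0 < e / 2 by rewrite divr_gt0.
  have [M1 hM1] := Glim x _ e2; have [M2 hM2] := Qlim x _ e2.
  exists (maxn M1 M2) => M; rewrite geq_max => /andP[/hM1 h1 h2].
  have [mnu _ _] := nuE (psi M).
  have {h2} := hM2 _ (leq_trans h2 (leq_trans (psiM M) mnu)).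
  rewrite SE in h1.
  set q := (Q _).[_] in h1 *; set pp := (P _).[_] in h1 *.
  move=> h2.
  have -> : f x - pp - (f x - (g0 x%:C + G x%:C)) =
    (g0 x%:C - q) - (pp - q - G x%:C) by ring.
  by rewrite (le_trans (ncB _ _))// [e]splitr lerD.
Qed.

Lemma Lp_norm_ge0 (p : \bar R) Om f : (0 <= Lp_norm p Om f)%E.
Proof. exact: Lnorm_ge0. Qed.

Lemma poly_approx_error_ge0 n (p : \bar R) (b : R) f :
  (0 <= poly_approx_error n p b f)%E.
Proof. by apply: le_ereal_inf_tmp => _ [P _ <-]; exact: Lp_norm_ge0. Qed.

Lemma entire_approx_error_ge0 (s : R) (p : \bar R) f :
  (0 <= entire_approx_error s p f)%E.
Proof. by apply: le_ereal_inf_tmp => _ [P _ <-]; exact: Lp_norm_ge0. Qed.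

Lemma entire_approx_error_mono (s t : R) (p : \bar R) f : s <= t ->
  (entire_approx_error t p f <= entire_approx_error s p f)%E.
Proof.
move=> st; apply: le_ereal_inf_tmp => _ [g Bg <-]; apply: ereal_inf_lbound.
by exists g => //; exact: B_space_mono Bg.
Qed.

Lemma entire_approx_error_le (s l : R) (p : \bar R) f g : (0 < p)%E -> 0 <= l ->
  B_space s g -> Lp_le p [set: R] (fun x => f x - g x%:C) l ->
  (entire_approx_error s p f <= l%:E)%E.
Proof.
move=> p0 l0 Bg hl.
apply: (@le_trans _ _ (Lp_norm p [set: R] (fun x => f x - g x%:C)%R)).
  by apply: ereal_inf_lbound; exists g.
by apply/Lp_normP.
Qed.

Lemma entire_approx_error_lt (s : R) (p l : \bar R) f : (0 < p)%E ->
  (entire_approx_error s p f < l)%E ->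
  exists g, exists2 l1 : R, 0 <= l1 & [/\ B_space s g, (l1%:E < l)%E &
    Lp_le p [set: R] (fun x => f x - g x%:C) l1].
Proof.
move=> p0 /ereal_inf_lt[_ [g Bg <-] hl].
have n0 := Lp_norm_ge0 p [set: R] (fun x => f x - g x%:C).
have nf : Lp_norm p [set: R] (fun x => f x - g x%:C) \is a fin_num.
  by rewrite ge0_fin_numE// (lt_le_trans hl)// leey.
exists g, (fine (Lp_norm p [set: R] (fun x => f x - g x%:C))).
  exact: fine_ge0.
split => //; first by rewrite fineK.
by apply/(Lp_normP _ _ p0 (fine_ge0 n0)); rewrite fineK.
Qed.

Lemma entire_approx_error_fin (s t : R) (p : \bar R) f : s <= t ->
  (entire_approx_error s p f < +oo)%E ->
  exists2 al : R, 0 <= al & entire_approx_error t p f = al%:E.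
Proof.
move=> st h; have h0 := entire_approx_error_ge0 t p f.
have hf : entire_approx_error t p f \is a fin_num.
  by rewrite ge0_fin_numE// (le_lt_trans (entire_approx_error_mono p f st)).
by exists (fine (entire_approx_error t p f)); rewrite ?fine_ge0 ?fineK.
Qed.

(** For finite exponents a near optimal approximant of type [sigma] can be
    replaced by one of smaller type: after subtracting [g0] it is in [L_r], where
    dilations are continuous. *)
Lemma smaller_type (r : R) f g0 g (s0 sigma l0 l1 l : R) : 0 < r -> lmf f ->
  0 < s0 -> s0 < sigma -> B_space s0 g0 -> B_space sigma g -> 0 <= l0 -> 0 <= l1 ->
  l1 < l -> Lp_le r%:E [set: R] (fun x => f x - g0 x%:C) l0 ->
  Lp_le r%:E [set: R] (fun x => f x - g x%:C) l1 ->
  exists tau, exists2 g1, 0 < tau < sigma & B_space tau g1 /\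
    Lp_le r%:E [set: R] (fun x => f x - g1 x%:C) l.
Proof.
move=> r0 mf s00 ss Bg0 Bg l00 l10 ll h0 h1.
have p0 : (0 < r%:E)%E by rewrite lte_fin.
have mT : measurable ([set: R] : set LS) by exact: measurableT.
have mg0 := cderivable_lmf (B_space_cderivable Bg0).
have mg := cderivable_lmf (B_space_cderivable Bg).
have mfg0 : lmf (fun x => f x - g0 x%:C) by exact: lmfB.
have mfg : lmf (fun x => f x - g x%:C) by exact: lmfB.
have sg0 : 0 < sigma by exact: lt_trans ss.
pose h z := g z - g0 z.
have Bh : B_space sigma h.
  apply: B_spaceD => //; apply: B_spaceN; apply: B_space_mono Bg0; exact: ltW.
have ch z : ccontinuous h z.
  exact/cderivable_ccontinuous/(B_space_cderivable Bh).
have [L L0 hL] := Lp_leD p0 l00 l10.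
have hh : Lp_le r%:E [set: R] (fun x => h x%:C) L.
  have := hL _ _ _ mT mfg0 (lmfN mfg) h0 (Lp_leN h1).
  by apply: Lp_le_ext => x; rewrite /h; ring.
have [d d0 hd] := Lp_le_perturb p0 l10 ll.
have [rho /andP[rho0 rho1] hrho] := dilation_close r0 ch hh (powR_gt0 r d0).
pose g1 z := g0 z + h (rho%:C * z).
exists (Num.max s0 (rho * sigma)), g1.
  by rewrite lt_max s00 gt_max ss gtr_pMl ?rho1.
split.
  apply: B_spaceD; first by apply: B_space_mono Bg0; rewrite le_max lexx.
  apply: (@B_space_mono _ (rho * sigma)); first by rewrite le_max lexx orbT.
  exact: B_space_dilation.
have mh : lmf (fun x => h x%:C - h (rho * x)%:C).
  apply: lmfB; first exact: ccontinuous_lmf.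
  have := cderivable_lmf (B_space_cderivable (B_space_dilation rho0 Bh)).
  by congr lmf; apply/funext => x; rewrite rmorphM.
have := hd _ _ _ mT mfg mh h1 hrho.
by apply: Lp_le_ext => x; rewrite /g1 rmorphM /h; ring.
Qed.

End Limits.

(** * The two limit relations *)

Section Conclusion.
Variable R : realType.
Implicit Types (u : nat -> \bar R).

Lemma limn_einf_lt u (l : \bar R) : (limn_einf u < l)%E ->
  forall n0, exists2 n, (n0 <= n)%N & (u n < l)%E.
Proof.
move=> hl n0.
have : (einfs u n0 < l)%E.
  apply: le_lt_trans hl; rewrite limn_einf_lim.
  by apply: lime_ge; [exact: is_cvg_einfs|
    exists n0 => // n /= hn; exact: nondecreasing_einfs].
by move=> /ereal_inf_lt[_ [n hn <-] hu]; exists n.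
Qed.

Lemma le_limn_einf u (l : \bar R) : (forall n, (l <= u n)%E) -> (l <= limn_einf u)%E.
Proof.
move=> h; rewrite limn_einf_lim; apply: lime_ge; first exact: is_cvg_einfs.
by apply: nearW => n; apply: le_ereal_inf_tmp => _ [m _ <-].
Qed.

Lemma limn_esup_le u (l : \bar R) n0 : (forall n, (n0 <= n)%N -> (u n <= l)%E) ->
  (limn_esup u <= l)%E.
Proof.
move=> h; rewrite limn_esup_lim; apply: lime_le; first exact: is_cvg_esups.
exists n0 => // n /= hn; apply: ge_ereal_sup => _ [m hm <-].
by apply: h; exact: leq_trans hm.
Qed.

(** Monotonicity makes the limit exist; for a divergent function the value of
    [lim] would say nothing about the values of [phi]. *)
Lemma le_lim_at_left (phi : R -> \bar R) (s0 sigma : R) (l : \bar R) : s0 < sigma ->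
  (forall t, s0 < t -> phi t \is a fin_num) -> (forall t, (0 <= phi t)%E) ->
  (forall s t, s <= t -> (phi t <= phi s)%E) ->
  (forall t, s0 < t -> t < sigma -> (l <= phi t)%E) ->
  (l <= lim (phi t @[t --> sigma^'-]))%E.
Proof.
move=> ss phif phi0 mono hl.
pose psi t : R := - fine (phi t).
have cpsi : cvg (psi t @[t --> sigma^'-]).
  apply: nondecreasing_at_left_is_cvgr.
    near=> x => s t; rewrite !in_itv/= => /andP[xs _] /andP[xt _] st.
    have x0 : s0 < x by near: x; exact: nbhs_left_gt.
    by rewrite lerN2 fine_le ?phif ?(lt_trans x0)// mono.
  near=> x; exists 0 => _ [t _ <-].
  by rewrite oppr_le0 fine_ge0.
have nearE : \forall t \near sigma^'-, s0 < t /\ t < sigma.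
  near=> t; split; first by near: t; exact: nbhs_left_gt.
  by near: t; exact: nbhs_left_lt.
have cphi : phi t @[t --> sigma^'-] --> (- lim (psi t @[t --> sigma^'-]))%:E.
  apply: (@cvg_trans _ ((- psi t)%:E @[t --> sigma^'-])).
    apply: near_eq_cvg; apply: filterS nearE => t [t0 _].
    by rewrite /psi opprK fineK// phif.
  by apply: cvg_EFin; [exact: nearW|exact: cvgN].
apply: lime_ge; first by apply/cvg_ex; eexists; exact: cphi.
by apply: filterS nearE => t [t0 t1]; exact: hl.
Unshelve. all: by end_near. Qed.

Lemma cvg_approx u (al : R) : (forall n, (0 <= u n)%E) ->
  (forall e : R, 0 < e -> exists n0, forall n, (n0 <= n)%N -> (u n <= (al + e)%:E)%E) ->
  (forall e : R, 0 < e -> exists n0, forall n, (n0 <= n)%N -> ((al - e)%:E <= u n)%E) ->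
  u n @[n --> \oo] --> al%:E.
Proof.
move=> u0 hu hl; apply/fine_cvgP; split.
  have [n0 hn0] := hu 1 ltr01; exists n0 => // n /= hn.
  by rewrite ge0_fin_numE// (le_lt_trans (hn0 n hn))// ltry.
apply: cvg_seq_le => e e0; have [n0 hn0] := hu e e0; have [n1 hn1] := hl e e0.
exists (maxn n0 n1) => n; rewrite geq_max => /andP[/hn0 h0 /hn1 h1].
have uf : u n \is a fin_num by rewrite ge0_fin_numE// (le_lt_trans h0)// ltry.
move: h0 h1; rewrite -[u n]fineK// !lee_fin /= ler_norml => h0 h1.
by apply/andP; split; lra.
Qed.

End Conclusion.

Local Close Scope complex_scope.
Unset Implicit Arguments.

Theorem theorem1p1 (R : realType) (a : nat -> R) (C : R)
    (a_gt0 : forall n : nat, (1 <= n)%N -> 0 < a n)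
    (a_near : forall n : nat, (1 <= n)%N -> `|a n - n%:R| <= C)
    (p : \bar R) (p_gt0 : (0 < p)%E)
    (sigma0 : R) (sigma0_gt0 : 0 < sigma0)
    (K N : R) (K_gt0 : 0 < K) (N_ge0 : 0 <= N)
    (f : R -> R[i]) (fM : M_space K N f)
    (fA : (entire_approx_error sigma0 p f < +oo)%E)
    (sigma : R) (sigma_gt : sigma0 < sigma) :
  (p = +oo%E ->
    [/\ (entire_approx_error sigma p f <=
           limn_einf (fun n => poly_approx_error n p (a n / sigma) f))%E,
        (limn_einf (fun n => poly_approx_error n p (a n / sigma) f) <=
           limn_esup (fun n => poly_approx_error n p (a n / sigma) f))%E &
        (limn_esup (fun n => poly_approx_error n p (a n / sigma) f) <=
           entire_approx_error_left sigma p f)%E]) /\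
  ((p < +oo)%E ->
    poly_approx_error n p (a n / sigma) f @[n --> \oo] -->
      entire_approx_error sigma p f).
Proof.
have [g0 [l0 l00 [Bg0 _ hg0]]] := entire_approx_error_lt p_gt0 fA.
have lower l : 0 <= l -> (l%:E < entire_approx_error sigma p f)%E ->
    exists n0, forall n, (n0 <= n)%N ->
      (l%:E <= poly_approx_error n p (a n / sigma) f)%E.
  move=> l_ge0 hl; apply: contrapT => no.
  have [|g Bg hg] := entire_approximant p_gt0 a_gt0 a_near K_gt0 fM sigma0_gt0
      sigma_gt Bg0 l00 hg0 l_ge0.
    move=> n0; apply: contrapT => h; apply: no; exists n0 => n hn.
    by rewrite leNgt; apply/negP => hlt; apply: h; exists n.
  by have := entire_approx_error_le p_gt0 l_ge0 Bg hg; rewrite leNgt hl.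
split=> [pE|pfin].
- split; last 1 first.
  + apply: (le_lim_at_left sigma_gt).
    * move=> t st; have [al _ ->] := entire_approx_error_fin (ltW st) fA.
      by [].
    * by move=> t; exact: entire_approx_error_ge0.
    * by move=> s t; exact: entire_approx_error_mono.
    * move=> t t0 ts; have [al al0 alE] := entire_approx_error_fin (ltW t0) fA.
      rewrite alE; apply/lee_addgt0Pr => e e0.
      have lt1 : (entire_approx_error t p f < (al + e / 2)%:E)%E.
        by rewrite alE lte_fin ltrDl divr_gt0.
      have [g [l1 l10 [Bg l1l hg]]] := entire_approx_error_lt p_gt0 lt1.
      have lt2 : l1 < al + e by move: l1l; rewrite lte_fin; lra.
      have tt : 0 < t by exact: lt_trans t0.
      have [n0 hn0] := poly_error_le p_gt0 a_gt0 a_near K_gt0 fM tt ts Bg l10 lt2 hg.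
      exact: limn_esup_le hn0.
  + rewrite leNgt; apply/negP => hlt.
    set u := fun n => _ in hlt.
    have [al al0 alE] := entire_approx_error_fin (ltW sigma_gt) fA.
    have u0 : (0 <= limn_einf u)%E.
      by apply: le_limn_einf => n; exact: poly_approx_error_ge0.
    have uf : limn_einf u \is a fin_num.
      by rewrite ge0_fin_numE// (lt_trans hlt)// alE ltry.
    pose la := fine (limn_einf u).
    have laE : limn_einf u = la%:E by rewrite fineK.
    have la0 : 0 <= la by exact: fine_ge0.
    have laal : la < al by rewrite -lte_fin -laE -alE.
    have [||n0 hn0] := lower ((la + al) / 2); first by lra.
      by rewrite alE lte_fin; lra.
    have lt3 : (limn_einf u < ((la + al) / 2)%:E)%E by rewrite laE lte_fin; lra.
    have [n hn] := limn_einf_lt lt3 n0.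
    by rewrite ltNge hn0.
  + exact: limn_einf_sup.
- have [r r0 pE] : exists2 r : R, 0 < r & p = r%:E.
    by case: (p) p_gt0 pfin => [r||//]; [rewrite lte_fin => r0 _; exists r|].
  have [al al0 alE] := entire_approx_error_fin (ltW sigma_gt) fA.
  rewrite alE; apply: cvg_approx.
  + by move=> n; exact: poly_approx_error_ge0.
  + move=> e e0.
    have lt1 : (entire_approx_error sigma p f < (al + e / 3)%:E)%E.
      by rewrite alE lte_fin ltrDl divr_gt0.
    have [g [l1 l10 [Bg l1l hg]]] := entire_approx_error_lt p_gt0 lt1.
    have lt2 : l1 < al + e / 2 by move: l1l; rewrite lte_fin; lra.
    have lt3 : al + e / 2 < al + e by lra.
    have l2 : 0 <= al + e / 2 by lra.
    have hg0r := hg0; have hgr := hg; rewrite pE in hg0r hgr.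
    have [tau [g1 /andP[tau0 ts] [Bg1 hg1]]] := smaller_type r0 (M_space_lmf fM)
      sigma0_gt0 sigma_gt Bg0 Bg l00 l10 lt2 hg0r hgr.
    rewrite -pE in hg1.
    exact: poly_error_le p_gt0 a_gt0 a_near K_gt0 fM tau0 ts Bg1 l2 lt3 hg1.
  + move=> e e0; have [ale|ale] := lerP 0 (al - e).
      by apply: lower => //; rewrite alE lte_fin; lra.
    exists 0%N => n _; apply: le_trans (poly_approx_error_ge0 _ _ _ _).
    by rewrite lee_fin ltW.
Qed.
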